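(* Let $\mathcal{D}$ be the standard Engel structure on $\mathbb{R}^4$, and let $\gamma_0,\gamma_1\colon S^1\rightarrow\mathbb{R}^4$ be two horizontal loops, i.e. (smooth) embeddings of the circle everywhere tangent to $\mathcal{D}$. Then $\gamma_0$ and $\gamma_1$ are horizontally isotopic (isotopic via horizontal loops) if and only if their rotation numbers agree, $\mathrm{rot}(\gamma_0)=\mathrm{rot}(\gamma_1)$.
   Context: Let $(x,y,z,w)$ be Cartesian coordinates on $\mathbb{R}^4$. The standard Engel structure $\mathcal{D}$ on $\mathbb{R}^4$ is the tangent $2$-plane distribution defined by the equations $dz-y\,dx=0$ and $dw-z\,dx=0$; equivalently, it is spanned at each point by the vector fields $e_1:=\partial_x+y\,\partial_z+z\,\partial_w$ and $e_2:=\partial_y$. A horizontal loop is an embedding $\gamma\colon S^1\rightarrow\mathbb{R}^4$ (smooth; in particular injective with nowhere vanishing velocity) that is everywhere tangent to $\mathcal{D}$. Writing $\gamma(s)=(x(s),y(s),z(s),w(s))$, $s\in S^1$, this means $z'(s)-y(s)x'(s)=0$ and $w'(s)-z(s)x'(s)=0$ for all $s\in S^1$. A horizontal isotopy between horizontal loops $\gamma_0$ and $\gamma_1$ is an isotopy via horizontal loops, i.e. a smooth family $\gamma_t\colon S^1\rightarrow\mathbb{R}^4$, $t\in[0,1]$, from $\gamma_0$ to $\gamma_1$ such that every $\gamma_t$ is a horizontal loop. Two horizontal loops are horizontally isotopic if there is a horizontal isotopy between them. The rotation number $\mathrm{rot}(\gamma)\in\mathbb{Z}$ of a horizontal loop $\gamma$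 is the number of complete turns of the velocity vector $\gamma'(s)\in\mathcal{D}_{\gamma(s)}$, as the loop is traversed once in positive direction, relative to the trivialisation of $\mathcal{D}$ given by $e_1,e_2$. That is, writing $\gamma'(s)=a(s)e_1+b(s)e_2$ at $\gamma(s)$ (so $a=x'$, $b=y'$), it is the winding number about the origin of the loop $s\mapsto(a(s),b(s))\in\mathbb{R}^2\setminus\{0\}$. *)

(* Defs.v *)
From Stdlib Require Import Reals Lra Lia ZArith ClassicalEpsilon.
From Coquelicot Require Import Coquelicot.
Open Scope R_scope.

(** * Points and vectors of R^4 *)

Definition R4 : Type := (R * R * R * R)%type.

Definition cx (p : R4) : R := fst (fst (fst p)).
Definition cy (p : R4) : R := snd (fst (fst p)).
Definition cz (p : R4) : R := snd (fst p).
Definition cw (p : R4) : R := snd p.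

Definition zero4 : R4 := (0, 0, 0, 0).
Definition add4 (u v : R4) : R4 :=
  (cx u + cx v, cy u + cy v, cz u + cz v, cw u + cw v).
Definition scal4 (c : R) (v : R4) : R4 := (c * cx v, c * cy v, c * cz v, c * cw v).

(** * The standard Engel structure *)

(** [engel p v]: the tangent vector [v] at [p] is annihilated by the 1-forms
    dz - y dx and dw - z dx. *)
Definition engel (p v : R4) : Prop :=
  cz v - cy p * cx v = 0 /\ cw v - cz p * cx v = 0.

Definition e1 (p : R4) : R4 := (1, 0, cy p, cz p).
Definition e2 (p : R4) : R4 := (0, 1, 0, 0).

(** Coordinates of a vector of the distribution in the frame [e1], [e2]; this
    reading of [cx] and [cy] is justified by [engel_frame]. *)
Definition frame1 (v : R4) : R := cx v.
Definition frame2 (v : R4) : R := cy v.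

Lemma engel_frame (p v : R4) (a b : R) :
  v = add4 (scal4 a (e1 p)) (scal4 b (e2 p)) <->
  engel p v /\ frame1 v = a /\ frame2 v = b.
Proof.
  destruct p as [[[px py] pz] pw], v as [[[vx vy] vz] vw].
  unfold engel, frame1, frame2, add4, scal4, e1, e2, cx, cy, cz, cw; simpl.
  split.
  - intros H; injection H; intros; subst; repeat split; ring.
  - intros [[H1 H2] [H3 H4]]; subst.
    f_equal; [f_equal; [f_equal|]|]; lra.
Qed.

(** * Loops

    The circle is R/Z: a map out of it is a 1-periodic map out of R. *)

Definition smooth (f : R -> R) : Prop := forall n s, ex_derive_n f n s.

Definition smooth4 (g : R -> R4) : Prop :=
  smooth (fun s => cx (g s)) /\ smooth (fun s => cy (g s)) /\
  smooth (fun s => cz (g s)) /\ smooth (fun s => cw (g s)).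

Definition velocity (g : R -> R4) (s : R) : R4 :=
  (Derive (fun u => cx (g u)) s, Derive (fun u => cy (g u)) s,
   Derive (fun u => cz (g u)) s, Derive (fun u => cw (g u)) s).

Definition periodic {A : Type} (g : R -> A) : Prop := forall s, g (s + 1) = g s.

(** Since the circle is compact, an injective immersion is an embedding. *)
Definition embedded_loop (g : R -> R4) : Prop :=
  periodic g /\ smooth4 g /\
  (forall s, velocity g s <> zero4) /\
  (forall s t, g s = g t -> exists k : Z, t = s + IZR k).

Definition horizontal_loop (g : R -> R4) : Prop :=
  embedded_loop g /\ forall s, engel (g s) (velocity g s).

(** * Horizontal isotopy *)

(** Smoothness on an arbitrary subset of the plane: near each point of [A], [f]
    coincides on [A] with a smooth function defined on an open set. *)
Definition smooth_on (A : R -> R -> Prop) (f : R -> R -> R) : Prop :=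
  forall t s, A t s ->
    exists g : R -> R -> R,
      locally_2d (fun u v => (forall n, ex_diff_n g n u v) /\
                             (A u v -> f u v = g u v)) t s.

Definition smooth4_on (A : R -> R -> Prop) (G : R -> R -> R4) : Prop :=
  smooth_on A (fun t s => cx (G t s)) /\ smooth_on A (fun t s => cy (G t s)) /\
  smooth_on A (fun t s => cz (G t s)) /\ smooth_on A (fun t s => cw (G t s)).

(** The family is smooth jointly in the parameter t and the point s. *)
Definition horizontal_isotopy (G : R -> R -> R4) (g0 g1 : R -> R4) : Prop :=
  smooth4_on (fun t s => 0 <= t <= 1) G /\
  (forall t, 0 <= t <= 1 -> horizontal_loop (G t)) /\
  (forall s, G 0 s = g0 s) /\ (forall s, G 1 s = g1 s).

Definition horizontally_isotopic (g0 g1 : R -> R4) : Prop :=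
  exists G : R -> R -> R4, horizontal_isotopy G g0 g1.

(** * Rotation number *)

(** [winding a b k]: along one period, a continuous angle function of the
    1-periodic plane curve (a, b) increases by 2 PI k. *)
Definition winding (a b : R -> R) (k : Z) : Prop :=
  exists theta : R -> R,
    (forall s, continuous theta s) /\
    (forall s, a s = sqrt (a s ^ 2 + b s ^ 2) * cos (theta s) /\
               b s = sqrt (a s ^ 2 + b s ^ 2) * sin (theta s)) /\
    theta 1 - theta 0 = 2 * PI * IZR k.

Definition is_rot (g : R -> R4) (k : Z) : Prop :=
  winding (fun s => frame1 (velocity g s)) (fun s => frame2 (velocity g s)) k.

(** The integer chosen here exists and is unique for horizontal loops: see
    [rotP]. *)
Definition rot (g : R -> R4) : Z := epsilon (inhabits 0%Z) (is_rot g).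

Lemma cos_eq_1_2PI (d : R) : cos d = 1 -> exists k : Z, d = 2 * PI * IZR k.
Proof.
  intros H.
  assert (E : cos d = 1 - 2 * sin (d / 2) * sin (d / 2)).
  { rewrite <- cos_2a_sin. f_equal. field. }
  destruct (sin_eq_0_0 (d / 2)) as [k Hk]; [nra|].
  exists k. lra.
Qed.

Lemma same_angle (x y : R) :
  cos x = cos y -> sin x = sin y -> exists k : Z, x - y = 2 * PI * IZR k.
Proof.
  intros Hc Hs. apply cos_eq_1_2PI. rewrite cos_minus, Hc, Hs.
  generalize (sin2_cos2 y). unfold Rsqr. lra.
Qed.

Lemma polar_angle (a b : R) :
  0 < a ^ 2 + b ^ 2 ->
  exists t, a = sqrt (a ^ 2 + b ^ 2) * cos t /\ b = sqrt (a ^ 2 + b ^ 2) * sin t.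
Proof.
  intros H. set (r := sqrt (a ^ 2 + b ^ 2)).
  assert (Hr : 0 < r) by now apply sqrt_lt_R0.
  assert (Hrr : r * r = a ^ 2 + b ^ 2) by (apply sqrt_sqrt; lra).
  assert (E : (a / r) * (a / r) + (b / r) * (b / r) = 1).
  { replace (a / r * (a / r) + b / r * (b / r)) with ((a ^ 2 + b ^ 2) / (r * r))
      by (field; lra).
    rewrite Hrr. field. lra. }
  assert (Hx : -1 <= a / r <= 1) by nra.
  assert (Hs : sqrt (1 - (a / r)²) = Rabs (b / r)).
  { rewrite <- sqrt_Rsqr_abs. f_equal. unfold Rsqr. lra. }
  destruct (Rle_dec 0 (b / r)) as [Hb | Hb].
  - exists (acos (a / r)). rewrite cos_acos, sin_acos by assumption.
    rewrite Hs, Rabs_pos_eq by assumption. split; field; lra.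
  - exists (- acos (a / r)). rewrite cos_neg, sin_neg, cos_acos, sin_acos by assumption.
    rewrite Hs, Rabs_left by lra. split; field; lra.
Qed.

Lemma winding_exists (a b : R -> R) :
  (forall s, ex_derive a s) -> (forall s, ex_derive b s) ->
  (forall s, continuous (Derive a) s) -> (forall s, continuous (Derive b) s) ->
  (forall s, 0 < a s ^ 2 + b s ^ 2) -> periodic a -> periodic b ->
  exists k, winding a b k.
Proof.
  intros da db ca cb Hr pa pb.
  set (w := fun s => (a s * Derive b s - b s * Derive a s) / (a s ^ 2 + b s ^ 2)).
  assert (ka : forall s, continuous a s) by (intro; now apply (ex_derive_continuous a)).
  assert (kb : forall s, continuous b s) by (intro; now apply (ex_derive_continuous b)).
  assert (cr : forall s, continuous (fun s => a s ^ 2 + b s ^ 2) s).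
  { intros s. apply (ex_derive_continuous (fun s => a s ^ 2 + b s ^ 2)).
    auto_derive. auto. }
  assert (cw : forall s, continuous w s).
  { intros s. apply (continuous_mult (fun s => a s * Derive b s - b s * Derive a s)
                      (fun s => / (a s ^ 2 + b s ^ 2))).
    - apply (continuous_minus (fun s => a s * Derive b s) (fun s => b s * Derive a s)).
      + now apply (continuous_mult a (Derive b)).
      + now apply (continuous_mult b (Derive a)).
    - apply continuous_Rinv_comp; auto. apply Rgt_not_eq, Hr. }
  destruct (polar_angle (a 0) (b 0) (Hr 0)) as [t0 [Ha0 Hb0]].
  set (th := fun s => t0 + RInt w 0 s).
  assert (dI : forall s, is_derive (fun s => RInt w 0 s) s (w s)).
  { intros s. apply (is_derive_RInt w (fun s => RInt w 0 s) 0 s); auto.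
    apply filter_forall. intros x. apply (RInt_correct w 0 x).
    apply ex_RInt_continuous. auto. }
  assert (dth : forall s, is_derive th s (w s)).
  { intros s. unfold th. rewrite <- (Rplus_0_l (w s)).
    apply (is_derive_plus (fun _ => t0) (fun s => RInt w 0 s)); auto.
    apply (is_derive_const t0). }
  assert (th0 : th 0 = t0).
  { unfold th. rewrite RInt_point. apply Rplus_0_r. }
  set (Q := fun s => (b s * cos (th s) - a s * sin (th s)) / sqrt (a s ^ 2 + b s ^ 2)).
  set (P := fun s => (a s * cos (th s) + b s * sin (th s)) / sqrt (a s ^ 2 + b s ^ 2)).
  assert (Hq : forall s, 0 < sqrt (a s ^ 2 + b s ^ 2)) by (intros; now apply sqrt_lt_R0).
  assert (Hqq : forall s, sqrt (a s ^ 2 + b s ^ 2) * sqrt (a s ^ 2 + b s ^ 2)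
                          = a s ^ 2 + b s ^ 2).
  { intros s. apply sqrt_sqrt. specialize (Hr s). lra. }
  assert (eth : forall s, ex_derive th s) by (intros s; eexists; apply dth).
  assert (Dth : forall s, Derive th s = w s)
    by (intros s; apply is_derive_unique, dth).
  set (l := fun s => (a s * Derive a s + b s * Derive b s) / (a s ^ 2 + b s ^ 2)).
  assert (dr : forall s, is_derive (fun s => sqrt (a s ^ 2 + b s ^ 2)) s
                                   (l s * sqrt (a s ^ 2 + b s ^ 2))).
  { intros s. evar_last.
    - apply (is_derive_sqrt (fun s => a s ^ 2 + b s ^ 2) s
               (2 * (a s * Derive a s + b s * Derive b s))); auto.
      auto_derive; auto. rewrite !Rmult_1_r. unfold id.
      change (Derive (fun x => a x) s) with (Derive a s).
      change (Derive (fun x => b x) s) with (Derive b s). ring.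
    - cbv beta. unfold l. specialize (Hq s). specialize (Hqq s).
      rewrite <- Hqq at 2. field. lra. }
  assert (quot : forall (u : R -> R), (forall s, is_derive u s (l s * u s)) ->
                 forall s, is_derive (fun s => u s / sqrt (a s ^ 2 + b s ^ 2)) s 0).
  { intros u du s. specialize (Hq s). evar_last.
    - apply (is_derive_div u (fun s => sqrt (a s ^ 2 + b s ^ 2)) s _ _ (du s) (dr s)).
      lra.
    - field. lra. }
  assert (dQ : forall s, is_derive Q s 0).
  { apply quot. intros s. specialize (Hr s). auto_derive; auto.
    change (Derive (fun x => th x) s) with (Derive th s).
    change (Derive (fun x => a x) s) with (Derive a s).
    change (Derive (fun x => b x) s) with (Derive b s).
    rewrite Dth. unfold w, l. field. lra. }
  assert (dP : forall s, is_derive P s 0).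
  { apply quot. intros s. specialize (Hr s). auto_derive; auto.
    change (Derive (fun x => th x) s) with (Derive th s).
    change (Derive (fun x => a x) s) with (Derive a s).
    change (Derive (fun x => b x) s) with (Derive b s).
    rewrite Dth. unfold w, l. field. lra. }
  assert (cst : forall f : R -> R, (forall s, is_derive f s 0) -> forall s, f s = f 0).
  { intros f df s. destruct (Rtotal_order s 0) as [Hs | [-> | Hs]]; auto.
    - apply (eq_is_derive f s 0); [intros t _; exact (df t) | exact Hs].
    - symmetry. apply (eq_is_derive f 0 s); [intros t _; exact (df t) | exact Hs]. }
  assert (Q0 : Q 0 = 0 /\ P 0 = 1).
  { unfold Q, P. rewrite th0. specialize (Hq 0).
    generalize (sin2_cos2 t0). unfold Rsqr. intros Hsc.
    set (q := sqrt (a 0 ^ 2 + b 0 ^ 2)) in *. rewrite Ha0, Hb0. split.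
    - field. lra.
    - transitivity (sin t0 * sin t0 + cos t0 * cos t0); [field; lra | auto]. }
  destruct Q0 as [Q0 P0].
  assert (ang : forall s, a s = sqrt (a s ^ 2 + b s ^ 2) * cos (th s) /\
                          b s = sqrt (a s ^ 2 + b s ^ 2) * sin (th s)).
  { intros s. generalize (cst Q dQ s) (cst P dP s). rewrite Q0, P0.
    unfold Q, P. specialize (Hq s). intros H1 H2.
    generalize (sin2_cos2 (th s)). unfold Rsqr. intros Hsc.
    set (q := sqrt (a s ^ 2 + b s ^ 2)) in *.
    set (C := cos (th s)) in *. set (S := sin (th s)) in *.
    assert (N1 : b s * C - a s * S = 0).
    { transitivity ((b s * C - a s * S) / q * q); [field; lra | rewrite H1; ring]. }
    assert (N2 : a s * C + b s * S = q).
    { transitivity ((a s * C + b s * S) / q * q); [field; lra | rewrite H2; ring]. }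
    split.
    - transitivity (a s * (S * S + C * C)); [rewrite Hsc; ring|].
      replace (a s * (S * S + C * C)) with
        ((a s * C + b s * S) * C - (b s * C - a s * S) * S) by ring.
      rewrite N1, N2. ring.
    - transitivity (b s * (S * S + C * C)); [rewrite Hsc; ring|].
      replace (b s * (S * S + C * C)) with
        ((a s * C + b s * S) * S + (b s * C - a s * S) * C) by ring.
      rewrite N1, N2. ring. }
  assert (E : exists k : Z, th 1 - th 0 = 2 * PI * IZR k).
  { assert (a1 : a 1 = a 0) by (rewrite <- (pa 0); f_equal; ring).
    assert (b1 : b 1 = b 0) by (rewrite <- (pb 0); f_equal; ring).
    destruct (ang 0) as [A0 B0], (ang 1) as [A1 B1].
    rewrite a1, b1 in A1, B1. specialize (Hq 0).
    set (q := sqrt (a 0 ^ 2 + b 0 ^ 2)) in *.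
    apply same_angle; apply Rmult_eq_reg_l with q; lra. }
  destruct E as [k Hk]. exists k, th. repeat split; auto; try apply ang.
  intros s. apply (ex_derive_continuous th). auto.
Qed.

Lemma winding_unique (a b : R -> R) (k l : Z) :
  (forall s, 0 < a s ^ 2 + b s ^ 2) -> winding a b k -> winding a b l -> k = l.
Proof.
  intros Hr (th & cth & ath & Hk) (ph & cph & aph & Hl).
  set (d := fun s => (th s - ph s) / (2 * PI)).
  assert (HPI := PI_RGT_0).
  assert (Hd : forall s, exists m : Z, d s = IZR m).
  { intros s. destruct (ath s) as [A B], (aph s) as [A' B'].
    assert (Hq := sqrt_lt_R0 _ (Hr s)). set (q := sqrt (a s ^ 2 + b s ^ 2)) in *.
    destruct (same_angle (th s) (ph s)) as [m Hm].
    1, 2: apply Rmult_eq_reg_l with q; lra.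
    exists m. unfold d. rewrite Hm. field. lra. }
  assert (cd : continuity d).
  { intros s. apply continuity_pt_filterlim.
    apply (continuous_mult (fun s => th s - ph s) (fun _ => / (2 * PI))).
    - now apply (continuous_minus th ph).
    - apply continuous_const. }
  assert (E : d 1 - d 0 = IZR (k - l)).
  { unfold d. rewrite minus_IZR.
    replace ((th 1 - ph 1) / (2 * PI) - (th 0 - ph 0) / (2 * PI))
      with (((th 1 - th 0) - (ph 1 - ph 0)) / (2 * PI)) by (field; lra).
    rewrite Hk, Hl. field. lra. }
  destruct (Z.eq_dec k l) as [|Hkl]; auto. exfalso.
  assert (H : exists e : R, (e = 1 \/ e = -1) /\
              Rmin (d 0) (d 1) <= d 0 + e / 2 <= Rmax (d 0) (d 1)).
  { destruct (Z_lt_le_dec k l) as [H | H].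
    - exists (-1). split; [lra|].
      assert (IZR (k - l) <= -1) by (apply IZR_le; lia).
      rewrite Rmin_right, Rmax_left by lra. lra.
    - exists 1. split; [lra|].
      assert (1 <= IZR (k - l)) by (apply IZR_le; lia).
      rewrite Rmin_left, Rmax_right by lra. lra. }
  destruct H as (e & He & He').
  destruct (IVT_gen d 0 1 _ cd He') as (x & _ & Hx).
  destruct (Hd x) as [m Hm], (Hd 0) as [n Hn].
  rewrite Hm, Hn in Hx.
  destruct He as [-> | ->].
  - assert (H : IZR (2 * m) = IZR (2 * n + 1)) by (rewrite plus_IZR, !mult_IZR; lra).
    apply eq_IZR in H. lia.
  - assert (H : IZR (2 * m) = IZR (2 * n - 1)) by (rewrite minus_IZR, !mult_IZR; lra).
    apply eq_IZR in H. lia.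
Qed.

Lemma rotP (g : R -> R4) (k : Z) : horizontal_loop g -> is_rot g k <-> rot g = k.
Proof.
  intros [[pg [[sx [sy _]] [vg _]]] hg].
  assert (Hr : forall s, 0 < frame1 (velocity g s) ^ 2 + frame2 (velocity g s) ^ 2).
  { intros s. destruct (hg s) as [H1 H2]. specialize (vg s).
    set (v := velocity g s) in *. unfold frame1, frame2.
    assert (H : cx v <> 0 \/ cy v <> 0).
    { destruct (Req_dec (cx v) 0) as [Ex|]; auto.
      destruct (Req_dec (cy v) 0) as [Ey|]; auto.
      exfalso; apply vg. rewrite Ex in H1, H2.
      destruct v as [[[vx vy] vz] vw]. unfold zero4, cx, cy, cz, cw in *; simpl in *.
      f_equal; [f_equal; [f_equal|]|]; lra. }
    destruct H; nra. }
  assert (X : exists k, is_rot g k).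
  { assert (per : forall f : R -> R, periodic f -> periodic (Derive f)).
    { intros f pf s.
      rewrite <- (Derive_ext (fun u => f (u + 1)) f s) by apply pf.
      unfold Derive. apply f_equal, Lim_ext. intros h.
      now replace (s + h + 1) with (s + 1 + h) by ring. }
    assert (der2 : forall f, smooth f -> forall s, ex_derive (Derive f) s)
      by (intros f sf s; exact (sf 2%nat s)).
    assert (der3 : forall f, smooth f -> forall s, continuous (Derive (Derive f)) s)
      by (intros f sf s; apply (ex_derive_continuous (Derive (Derive f))), (sf 3%nat s)).
    apply winding_exists; auto; try (now apply der2); try (now apply der3).
    - apply (per (fun u => cx (g u))). intros s. now rewrite pg.
    - apply (per (fun u => cy (g u))). intros s. now rewrite pg. }
  assert (S := epsilon_spec (inhabits 0%Z) (is_rot g) X). fold (rot g) in S.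
  split.
  - intros K. now apply (winding_unique _ _ _ _ Hr S).
  - now intros <-.
Qed.

(* Main.v *)
Require Import Defs.
From Stdlib Require Import Reals Lra Lia ZArith List Classical ClassicalEpsilon
  FunctionalExtensionality.
From Coquelicot Require Import Coquelicot.
From mathcomp Require all_boot.
Open Scope R_scope.

(** A horizontal loop is determined up to translation in z and w by its projection (x, y), a closed
    immersed plane curve with the same rotation number; the lift closes up iff the integrals of
    y dx and of x y dx over the circle vanish, and a double point of the lift is a pair s < u with
    x(s) = x(u), y(s) = y(u) such that both integrals over [s, u] vanish.

    Given two loops with the same rotation number, interpolate the angles and speeds of their plane
    velocities and subtract a multiple of the speed to get zero mean, as in the proof of the
    Whitney-Graustein theorem; then add to y a combination of x'^3 and x x'^3 that makes the two
    integrals vanish. This gives a family of horizontal immersions. A double point is given by four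
    equations in the three unknowns t, s, u, so a generic perturbation, trivial at t = 0 and t = 1,
    has none: perturb x by multiples of cos and sin, and y by a finite number of functions on which
    the last three equations, which are linear in y, are locally independent. Instead of Sard's
    theorem, a count on grids: with n values for each of the K parameters, each of the n^3 cells of
    (t, s, u)-space of side 1/n contains a double point for at most O(n^(K-4)) of the n^K
    parameters. *)

(** * A class of smooth functions of two variables *)

(** The equations degenerate in two places, and the count on grids is run away from both. When u
    tends to s or to s + 1 they all become trivial; there double points are excluded because the
    curves are immersed, with one gap [h0] for all small parameters. At t = 0 and t = 1 the
    perturbation vanishes by design; there the embeddedness of the given loops persists, by
    compactness, for a time [tau] common to all small parameters.

    On the remaining compact region the system is triangular. The equation x(s) = x(u) involves only
    the two parameters of cos and sin, and one of these two functions always separates s from u.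
    Once x is fixed, the other three equations are affine in the remaining parameters. Their
    independence is established where y(s) = y(u); elsewhere there is no double point anyway.

    The moments are corrected after the perturbation, so that every perturbed curve lifts to a
    closed one. The count needs Lipschitz bounds uniform in all variables; families are therefore
    made periodic in t as well, which reduces uniformity to the compactness of a cube. *)

Ltac triang := apply Rle_trans with (1 := Rabs_triang _ _).
Ltac rmin := unfold Rmin; repeat destruct Rle_dec; lra.

(** Only [flat 0] serves as a cut-off. The higher ones are there because differentiating [flat k]
    produces [flat (k + 1)] and [flat (k + 2)]. *)
Definition flat (k : nat) (u : R) : R :=
  if Rlt_dec 0 u then / u ^ k * exp (- / u) else 0.

(* Each constructor has partial derivatives in the class, hence [sm_ex_diff_n] by induction on the
   order alone. *)
Inductive sm : (R -> R -> R) -> Prop :=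
| sm_smooth h : smooth h -> sm (fun _ s => h s)
| sm_t : sm (fun t _ => t)
| sm_const c : sm (fun _ _ => c)
| sm_plus f g : sm f -> sm g -> sm (fun t s => f t s + g t s)
| sm_mult f g : sm f -> sm g -> sm (fun t s => f t s * g t s)
| sm_sin f : sm f -> sm (fun t s => sin (f t s))
| sm_cos f : sm f -> sm (fun t s => cos (f t s))
| sm_inv f : (forall t s, f t s <> 0) -> sm f -> sm (fun t s => / f t s)
| sm_sqrt f : (forall t s, 0 < f t s) -> sm f -> sm (fun t s => sqrt (f t s))
| sm_flat k f : sm f -> sm (fun t s => flat k (f t s))
| sm_int f : sm f -> sm (fun t s => RInt (f t) 0 s)
| sm_tot f : sm f -> sm (fun t s => RInt (f t) 0 1)
| sm_prim h w : (forall s, is_derive h s (w s)) -> sm (fun _ s => w s) ->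
                sm (fun _ s => h s).

Lemma sm_ext f g : (forall t s, f t s = g t s) -> sm f -> sm g.
Proof.
  intros E. replace g with f; auto.
  extensionality t. extensionality s. apply E.
Qed.

Lemma sm_opp f : sm f -> sm (fun t s => - f t s).
Proof.
  intros H. apply sm_ext with (fun t s => (-1) * f t s).
  - intros; ring.
  - apply sm_mult; auto. apply sm_const.
Qed.

Lemma sm_minus f g : sm f -> sm g -> sm (fun t s => f t s - g t s).
Proof.
  intros H K. apply sm_plus; auto. now apply sm_opp.
Qed.

Lemma sm_pow f n : sm f -> sm (fun t s => f t s ^ n).
Proof.
  intros H. induction n as [|n IH].
  - exact (sm_const 1).
  - exact (sm_mult f _ H IH).
Qed.

Lemma sm_div f g : (forall t s, g t s <> 0) -> sm f -> sm g ->
  sm (fun t s => f t s / g t s).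
Proof. intros N H K. apply sm_mult; auto. now apply sm_inv. Qed.

Lemma sm_s : sm (fun _ s => s).
Proof. apply (sm_prim (fun s => s) (fun _ => 1)); [intros s; auto_derive; auto|apply sm_const]. Qed.

Lemma is_derive_cst (c s : R) : is_derive (fun _ => c) s 0.
Proof. apply (is_derive_const (K := R_AbsRing) (V := R_NormedModule)). Qed.

(** ** The flat functions [u^-k exp (-1/u)] *)

Lemma exp_ge_pow n x : 0 <= x -> x ^ n / INR (fact n) <= exp x.
Proof.
  intros Hx. apply Rle_trans with (2 := exp_ge_taylor x n Hx).
  destruct n as [|n]; [simpl; lra|]. rewrite tech5.
  assert (0 <= sum_f_R0 (fun k => x ^ k / INR (fact k)) n); [|lra].
  apply cond_pos_sum. intros k. apply Rdiv_le_0_compat; [now apply pow_le|apply INR_fact_lt_0].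
Qed.

(** A quadratic bound yields derivative 0 at the origin. It comes from the Taylor term of order k +
    2 in exp (1/u). *)
Lemma flat_bound k : exists C, 0 < C /\ forall u, Rabs (flat k u) <= C * u ^ 2.
Proof.
  exists (INR (fact (k + 2))). split; [apply INR_fact_lt_0|].
  intros u. unfold flat. destruct (Rlt_dec 0 u) as [Hu|Hu].
  - assert (Hv : 0 < / u) by now apply Rinv_0_lt_compat.
    assert (B := exp_ge_pow (k + 2) (/ u) (Rlt_le _ _ Hv)).
    assert (P : 0 < (/ u) ^ (k + 2)) by now apply pow_lt.
    assert (F := INR_fact_lt_0 (k + 2)).
    rewrite Rabs_pos_eq.
    2: { apply Rmult_le_pos; [|left; apply exp_pos].
         left. now apply Rinv_0_lt_compat, pow_lt. }
    rewrite exp_Ropp, <- pow_inv.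
    assert (I : / exp (/ u) <= / ((/ u) ^ (k + 2) / INR (fact (k + 2)))).
    { apply Rinv_le_contravar; auto. apply Rdiv_lt_0_compat; auto. }
    apply Rle_trans with ((/ u) ^ k * / ((/ u) ^ (k + 2) / INR (fact (k + 2)))).
    + apply Rmult_le_compat_l; auto. left. now apply pow_lt.
    + right. rewrite pow_add, !pow_inv. field. repeat split; try lra; now apply pow_nonzero, Rgt_not_eq.
  - rewrite Rabs_R0. apply Rmult_le_pos; [left; apply INR_fact_lt_0|]. apply pow2_ge_0.
Qed.

Lemma flat_derive k u :
  is_derive (flat k) u (- INR k * flat (k + 1) u + flat (k + 2) u).
Proof.
  destruct (Rtotal_order 0 u) as [Hu|[<-|Hu]].
  - apply is_derive_ext_loc with (fun u => / u ^ k * exp (- / u)).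
    + exists (mkposreal u Hu). intros v Hv. apply Rabs_lt_between' in Hv. simpl in Hv.
      unfold flat. destruct (Rlt_dec 0 v); auto. lra.
    + assert (P := pow_lt u k Hu). unfold flat. destruct (Rlt_dec 0 u); [|lra].
      auto_derive; [split; [lra|split; [lra|auto]]|].
      rewrite !pow_add, pow_1.
      destruct k as [|k]; simpl pred; [simpl; field; lra|].
      change (match k with O => 1 | S _ => INR k + 1 end) with (INR (S k)).
      assert (P' := pow_lt u k Hu). simpl (u ^ S k). field. lra.
  - replace (- INR k * flat (k + 1) 0 + flat (k + 2) 0) with 0.
    2: { unfold flat. destruct (Rlt_dec 0 0); [lra|ring]. }
    destruct (flat_bound k) as (C & HC & B).
    apply is_derive_Reals. intros e He.
    assert (Hd : 0 < e / C) by now apply Rdiv_lt_0_compat.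
    exists (mkposreal _ Hd). intros h Hh Hh'. simpl in Hh'.
    rewrite Rplus_0_l. replace (flat k 0) with 0.
    2: { unfold flat. destruct (Rlt_dec 0 0); [lra|ring]. }
    rewrite !Rminus_0_r, Rabs_div by auto.
    specialize (B h). assert (A := Rabs_pos_lt h Hh).
    apply Rmult_lt_reg_r with (Rabs h); auto.
    unfold Rdiv. rewrite Rmult_assoc, Rinv_l, Rmult_1_r by lra.
    apply Rle_lt_trans with (1 := B). rewrite <- (pow2_abs h).
    replace (C * Rabs h ^ 2) with ((Rabs h * C) * Rabs h) by ring.
    apply Rmult_lt_compat_r; auto. apply Rlt_div_r in Hh'; auto.
  - apply is_derive_ext_loc with (fun _ => 0).
    + assert (Hu' : 0 < - u) by lra.
      exists (mkposreal (- u) Hu'). intros v Hv. apply Rabs_lt_between' in Hv. simpl in Hv.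
      unfold flat. destruct (Rlt_dec 0 v); auto. lra.
    + replace (- INR k * flat (k + 1) u + flat (k + 2) u) with 0.
      * apply is_derive_cst.
      * unfold flat. destruct (Rlt_dec 0 u); [lra|ring].
Qed.

(** ** Closure of the class under differentiation *)

Lemma ex_RInt_cont (f : R -> R) (a b : R) : (forall x, continuous f x) -> ex_RInt f a b.
Proof. intros H. apply (ex_RInt_continuous (V := R_CompleteNormedModule)). auto. Qed.

Lemma abs_RInt_le_both (f : R -> R) (a b M : R) :
  (forall x, continuous f x) -> (forall x, Rmin a b <= x <= Rmax a b -> Rabs (f x) <= M) ->
  Rabs (RInt f a b) <= M * Rabs (b - a).
Proof.
  intros cf H.
  assert (I : forall a b, ex_RInt f a b) by (intros; apply ex_RInt_cont; auto).
  destruct (Rle_dec a b) as [L|L].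
  - rewrite (Rabs_pos_eq (b - a)), Rmult_comm by lra. rewrite Rmin_left, Rmax_right in H by lra.
    now apply abs_RInt_le_const.
  - rewrite <- opp_RInt_swap, Rabs_Ropp by auto.
    rewrite (Rabs_left1 (b - a)), Rmult_comm by lra.
    replace (- (b - a)) with (a - b) by ring. rewrite Rmin_right, Rmax_left in H by lra.
    apply abs_RInt_le_const; auto. lra.
Qed.

Lemma cont2_r f : (forall t s, continuity_2d_pt f t s) -> forall t s, continuous (f t) s.
Proof.
  intros H t s. apply continuity_pt_filterlim. intros e He.
  destruct (H t s (mkposreal e He)) as [d Hd].
  exists d. split; [apply cond_pos|]. intros x [_ Hx]. apply Hd; auto.
  rewrite Rminus_diag, Rabs_R0. apply cond_pos.
Qed.

(** The increment splits into a change of the integrand, small by uniform continuity on a compact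
    interval, and a change of the upper limit for fixed t. *)
Lemma cont2_int f : (forall t s, continuity_2d_pt f t s) ->
  forall t s, continuity_2d_pt (fun t s => RInt (f t) 0 s) t s.
Proof.
  intros H t s e.
  assert (cf := cont2_r f H).
  assert (If : forall t a b, ex_RInt (f t) a b) by (intros; apply ex_RInt_cont; auto).
  (* Bounds every upper limit within distance 1 of [s]. *)
  set (M := Rabs s + 1). assert (HM : 0 < M) by (unfold M; generalize (Rabs_pos s); lra).
  assert (He : 0 < e / (4 * M)) by (apply Rdiv_lt_0_compat; [apply cond_pos|lra]).
  destruct (uniform_continuity_2d_1d' f (- M) M t (fun x _ => H t x) (mkposreal _ He)) as [d Hd].
  assert (C : continuous (fun s => RInt (f t) 0 s) s).
  { apply (ex_derive_continuous (fun s => RInt (f t) 0 s)). exists (f t s).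
    apply (is_derive_RInt (f t) _ 0); auto.
    apply filter_forall. intros x. now apply (RInt_correct (f t) 0 x). }
  apply continuity_pt_filterlim in C.
  assert (He2 : 0 < e / 2) by (generalize (cond_pos e); lra).
  destruct (C _ He2) as (d' & Hd' & K).
  assert (Hm : 0 < Rmin (Rmin d d') 1).
  { repeat apply Rmin_pos; try lra; try apply cond_pos; auto. }
  exists (mkposreal _ Hm). simpl. intros u v Hu Hv.
  assert (L1 := Rmin_l (Rmin d d') 1). assert (L2 := Rmin_r (Rmin d d') 1).
  assert (L3 := Rmin_l d d'). assert (L4 := Rmin_r d d').
  replace (RInt (f u) 0 v - RInt (f t) 0 s) with
    (RInt (fun x => f u x - f t x) 0 v + (RInt (f t) 0 v - RInt (f t) 0 s)).
  2: { rewrite (RInt_minus (V := R_CompleteNormedModule) (f u) (f t)) by auto.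
       unfold minus, plus, opp; simpl. ring. }
  apply Rle_lt_trans with (1 := Rabs_triang _ _).
  assert (Hv' : Rabs v <= M).
  { unfold M. replace v with (s + (v - s)) by ring.
    triang. lra. }
  assert (A : Rabs (RInt (fun x => f u x - f t x) 0 v) <= e / (4 * M) * Rabs (v - 0)).
  { apply abs_RInt_le_both.
    - intros x. now apply (continuous_minus (f u) (f t)).
    - intros x Hx.
      assert (Hx' : - M <= x <= M).
      { apply Rabs_le_between in Hv'. revert Hx. unfold Rmin, Rmax. destruct (Rle_dec 0 v); lra. }
      assert (Pd := cond_pos d). left. apply (Hd x t x u); auto; try lra.
      + apply Rabs_lt_between' in Hu. lra.
      + rewrite Rminus_diag, Rabs_R0. apply cond_pos. }
  rewrite Rminus_0_r in A.
  assert (B : Rabs (RInt (f t) 0 v - RInt (f t) 0 s) < e / 2).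
  { destruct (Req_dec v s) as [->|N].
    - rewrite Rminus_diag, Rabs_R0; auto.
    - apply K. split; [split; [exact I|auto]|].
      apply Rlt_le_trans with (1 := Hv). lra. }
  assert (e / (4 * M) * Rabs v <= e / 4).
  { apply Rle_trans with (e / (4 * M) * M).
    - apply Rmult_le_compat_l; auto. lra.
    - right. field. lra. }
  generalize (cond_pos e). lra.
Qed.

Lemma cont1_2_r (h : R -> R) t s : continuous h s -> continuity_2d_pt (fun _ s => h s) t s.
Proof.
  intros H. apply (continuity_1d_2d_pt_comp h (fun _ s => s)).
  - now apply continuity_pt_filterlim.
  - apply continuity_2d_pt_id2.
Qed.

Lemma sm_cont f : sm f -> forall t s, continuity_2d_pt f t s.
Proof.
  induction 1; intros t s.
  - apply cont1_2_r, (ex_derive_continuous h). exact (H 1%nat s).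
  - apply continuity_2d_pt_id1.
  - apply continuity_2d_pt_const.
  - now apply continuity_2d_pt_plus.
  - now apply continuity_2d_pt_mult.
  - apply continuity_1d_2d_pt_comp; auto. apply continuity_sin.
  - apply continuity_1d_2d_pt_comp; auto. apply continuity_cos.
  - now apply continuity_2d_pt_inv.
  - apply continuity_1d_2d_pt_comp; auto. apply continuity_pt_sqrt. now left.
  - apply continuity_1d_2d_pt_comp; auto.
    apply continuity_pt_filterlim, (ex_derive_continuous (flat k)).
    eexists; apply flat_derive.
  - now apply cont2_int.
  - intros e. destruct (cont2_int f IHsm t 1 e) as [d Hd]. exists d.
    intros u v Hu _. apply Hd; auto. rewrite Rminus_diag, Rabs_R0. apply cond_pos.
  - apply cont1_2_r, (ex_derive_continuous h). eexists; apply H.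
Qed.

Lemma sm_continuous f : sm f -> forall t s, continuous (f t) s.
Proof. intros H. apply cont2_r. now apply sm_cont. Qed.

Lemma sm_ex_RInt f t a b : sm f -> ex_RInt (f t) a b.
Proof. intros H. apply ex_RInt_cont. intros; now apply sm_continuous. Qed.

Lemma is_derive_RInt_sm f t s : sm f -> is_derive (fun s => RInt (f t) 0 s) s (f t s).
Proof.
  intros H. apply (is_derive_RInt (f t) (fun s => RInt (f t) 0 s) 0).
  - apply filter_forall. intros x. apply (RInt_correct (f t) 0 x). now apply sm_ex_RInt.
  - now apply sm_continuous.
Qed.

Lemma is_derive_RInt_param_sm f ft t a b : sm f -> sm ft ->
  (forall t s, is_derive (fun z => f z s) t (ft t s)) ->
  is_derive (fun t => RInt (f t) a b) t (RInt (ft t) a b).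
Proof.
  intros H K D.
  assert (E : (fun u v => Derive (fun z => f z v) u) = ft).
  { extensionality u. extensionality v. apply is_derive_unique, D. }
  assert (E' : (fun v => Derive (fun z => f z v) t) = ft t).
  { extensionality v. apply is_derive_unique, D. }
  rewrite <- E'. apply (is_derive_RInt_param f a b t).
  - apply filter_forall. intros x u _. eexists; apply D.
  - intros u _. rewrite E. now apply sm_cont.
  - apply filter_forall. intros x. now apply sm_ex_RInt.
Qed.

Definition has_partials (f ft fs : R -> R -> R) : Prop :=
  forall t s, is_derive (fun z => f z s) t (ft t s) /\ is_derive (f t) s (fs t s).

Lemma is_derive_comp_R (h f : R -> R) x dh df :
  is_derive h (f x) dh -> is_derive f x df -> is_derive (fun x => h (f x)) x (dh * df).
Proof.
  intros H K. evar_last; [apply (is_derive_comp h f); eauto|].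
  unfold scal; simpl. unfold mult; simpl. ring.
Qed.

(** For a primitive in s, the t-derivative is the primitive of the t-derivative of the integrand,
    and the s-derivative is the integrand; both stay in the class. *)
Lemma sm_partials f : sm f -> exists ft fs, sm ft /\ sm fs /\ has_partials f ft fs.
Proof.
  (* The chain rule once for all constructors that apply a function of one real variable. *)
  assert (comp : forall (h h' : R -> R) f,
    (exists ft fs, sm ft /\ sm fs /\ has_partials f ft fs) -> sm (fun t s => h' (f t s)) ->
    (forall t s, is_derive h (f t s) (h' (f t s))) ->
    exists ft fs, sm ft /\ sm fs /\ has_partials (fun t s => h (f t s)) ft fs).
  { intros h h' g (gt & gs & Ht & Hs & P) S D.
    exists (fun t s => h' (g t s) * gt t s), (fun t s => h' (g t s) * gs t s).
    split; [now apply (sm_mult (fun t s => h' (g t s)))|].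
    split; [now apply (sm_mult (fun t s => h' (g t s)))|].
    intros t s. destruct (P t s).
    split; [apply (is_derive_comp_R h (fun z => g z s))|apply (is_derive_comp_R h (g t))]; auto. }
  induction 1.
  - exists (fun _ _ => 0), (fun _ s => Derive h s). split; [apply sm_const|split].
    + apply sm_smooth. intros n s. generalize (H (S n) s). clear.
      destruct n as [|n]; [simpl; auto|]. intros H.
      assert (E : forall k x, Derive_n (Derive h) k x = Derive_n h (S k) x).
      { induction k as [|k IH]; auto. intros x.
        change (Derive (Derive_n (Derive h) k) x = Derive (Derive_n h (S k)) x).
        now apply Derive_ext. }
      change (ex_derive (Derive_n (Derive h) n) s).
      apply ex_derive_ext with (Derive_n h (S n)); auto.
    + intros t s. split; [apply is_derive_cst|].
      apply Derive_correct. exact (H 1%nat s).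
  - exists (fun _ _ => 1), (fun _ _ => 0).
    split; [apply sm_const|split; [apply sm_const|intros t s; split]].
    + apply (is_derive_id (K := R_AbsRing)).
    + apply is_derive_cst.
  - exists (fun _ _ => 0), (fun _ _ => 0).
    split; [apply sm_const|split; [apply sm_const|intros t s; split]].
    + apply is_derive_cst.
    + apply is_derive_cst.
  - destruct IHsm1 as (ft & fs & Ht & Hs & P), IHsm2 as (gt & gs & Kt & Ks & Q).
    exists (fun t s => ft t s + gt t s), (fun t s => fs t s + gs t s).
    split; [now apply sm_plus|split; [now apply sm_plus|]].
    intros t s. destruct (P t s), (Q t s). split.
    + now apply (is_derive_plus (fun z => f z s) (fun z => g z s)).
    + now apply (is_derive_plus (f t) (g t)).
  - destruct IHsm1 as (ft & fs & Ht & Hs & P), IHsm2 as (gt & gs & Kt & Ks & Q).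
    exists (fun t s => ft t s * g t s + f t s * gt t s),
      (fun t s => fs t s * g t s + f t s * gs t s).
    split; [|split]; try (apply sm_plus; now apply sm_mult).
    intros t s. destruct (P t s), (Q t s). split.
    + apply (is_derive_mult (fun z => f z s) (fun z => g z s)); auto. intros; apply Rmult_comm.
    + apply (is_derive_mult (f t) (g t)); auto. intros; apply Rmult_comm.
  - apply (comp sin cos); auto; [now apply sm_cos|]. intros; apply is_derive_sin.
  - apply (comp cos (fun u => - sin u)); auto; [|intros; apply is_derive_cos].
    apply sm_opp. now apply sm_sin.
  - apply (comp Rinv (fun u => - (/ u * / u))); auto.
    + apply sm_opp. apply sm_mult; now apply sm_inv.
    + intros t s. auto_derive; auto. field. auto.
  - apply (comp sqrt (fun u => / (2 * sqrt u))); auto.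
    + apply sm_inv.
      * intros t s. apply Rgt_not_eq. apply Rmult_lt_0_compat; [lra|]. now apply sqrt_lt_R0.
      * apply sm_mult; [apply sm_const|now apply sm_sqrt].
    + intros t s. auto_derive; auto. specialize (H t s). apply sqrt_lt_R0 in H. field. lra.
  - apply (comp (flat k) (fun u => - INR k * flat (k + 1) u + flat (k + 2) u)); auto.
    + apply sm_plus; [apply sm_mult|]; [apply sm_const| |]; now apply sm_flat.
    + intros t s. apply flat_derive.
  - destruct IHsm as (ft & fs & Ht & Hs & P).
    exists (fun t s => RInt (ft t) 0 s), f. split; [now apply sm_int|split; auto].
    intros t s. split.
    + apply is_derive_RInt_param_sm; auto. intros; apply P.
    + now apply is_derive_RInt_sm.
  - destruct IHsm as (ft & fs & Ht & Hs & P).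
    exists (fun t s => RInt (ft t) 0 1), (fun _ _ => 0).
    split; [now apply sm_tot|split; [apply sm_const|]].
    intros t s. split.
    + apply is_derive_RInt_param_sm; auto. intros; apply P.
    + apply is_derive_cst.
  - exists (fun _ _ => 0), (fun _ s => w s).
    split; [apply sm_const|split; [auto|intros t s; split; auto]].
    apply is_derive_cst.
Qed.

(** * Smoothness of the class in the sense of the statement *)

Definition Ds (f : R -> R -> R) (t s : R) : R := Derive (f t) s.
Definition Dt (f : R -> R -> R) (t s : R) : R := Derive (fun z => f z s) t.

Lemma sm_Ds f : sm f -> sm (Ds f) /\ forall t s, is_derive (f t) s (Ds f t s).
Proof.
  intros H. destruct (sm_partials f H) as (ft & fs & Ht & Hs & P).
  assert (E : forall t s, fs t s = Ds f t s).
  { intros t s. symmetry. apply is_derive_unique, P. }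
  split.
  - now apply sm_ext with fs.
  - intros t s. rewrite <- E. apply P.
Qed.

Lemma sm_Dt f : sm f -> sm (Dt f) /\ forall t s, is_derive (fun z => f z s) t (Dt f t s).
Proof.
  intros H. destruct (sm_partials f H) as (ft & fs & Ht & Hs & P).
  assert (E : forall t s, ft t s = Dt f t s).
  { intros t s. symmetry. apply is_derive_unique, (P t s). }
  split.
  - now apply sm_ext with ft.
  - intros t s. rewrite <- E. apply P.
Qed.

Lemma sm_ex_diff_n f n : sm f -> forall t s, ex_diff_n f n t s.
Proof.
  revert f. induction n as [|n IH]; intros f H t s; simpl; split; try now apply sm_cont.
  { exact I. }
  destruct (sm_Ds f H) as [H1 D1], (sm_Dt f H) as [H2 D2].
  split; [eexists; apply D2|split; [eexists; apply D1|]].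
  split; apply IH; auto.
Qed.

Lemma sm_smooth_r f t : sm f -> smooth (f t).
Proof.
  intros H.
  assert (E : forall n, exists g, sm g /\ forall s, Derive_n (f t) n s = g t s).
  { induction n as [|n (g & Hg & E)].
    - exists f. split; auto.
    - exists (Ds g). split; [now apply sm_Ds|]. intros s. simpl. now apply Derive_ext. }
  intros n s. destruct n as [|n]; [exact I|].
  destruct (E n) as (g & Hg & Eg). simpl. apply ex_derive_ext with (g t).
  - intros u. symmetry. apply Eg.
  - eexists. now apply (sm_Ds g Hg).
Qed.

Lemma sm_smooth_on f : sm f -> smooth_on (fun t s => 0 <= t <= 1) f.
Proof.
  intros H t s _. exists f. exists (mkposreal 1 Rlt_0_1). intros u v _ _.
  split; auto. intros n. now apply sm_ex_diff_n.
Qed.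

(** The time parameter of interpolations. It is 2-periodic and stays in [0, 1], so families are
    defined for all t and live on a torus, where bounds follow from compactness. *)
Definition rho (t : R) : R := sin (PI / 2 * t) ^ 2.

Lemma rho_0 : rho 0 = 0.
Proof. unfold rho. rewrite Rmult_0_r, sin_0. ring. Qed.
Lemma rho_1 : rho 1 = 1.
Proof. unfold rho. rewrite Rmult_1_r, sin_PI2. ring. Qed.
Lemma rho_range t : 0 <= rho t <= 1.
Proof.
  unfold rho. generalize (sin2_cos2 (PI / 2 * t)) (pow2_ge_0 (sin (PI / 2 * t))) (pow2_ge_0 (cos (PI / 2 * t))).
  unfold Rsqr. simpl. lra.
Qed.
Lemma rho_per t : rho (t + 2) = rho t.
Proof.
  unfold rho. replace (PI / 2 * (t + 2)) with (PI / 2 * t + PI) by field.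
  rewrite neg_sin. ring.
Qed.
Lemma sm_rho : sm (fun t _ => rho t).
Proof. apply (sm_pow (fun t _ => sin (PI / 2 * t))), sm_sin, sm_mult; [apply sm_const|apply sm_t]. Qed.

Ltac smt := repeat match goal with
  | |- sm _ => assumption
  | |- sm (fun t s => _) => apply sm_const
  | |- sm (fun t s => t) => apply sm_t
  | |- sm (fun t s => rho t) => apply sm_rho
  | |- sm (fun t s => s) => apply sm_s
  | |- sm (fun t s => @?f t s + @?g t s) => apply (sm_plus f g)
  | |- sm (fun t s => @?f t s - @?g t s) => apply (sm_minus f g)
  | |- sm (fun t s => @?f t s * @?g t s) => apply (sm_mult f g)
  | |- sm (fun t s => - @?f t s) => apply (sm_opp f)
  | |- sm (fun t s => @?f t s ^ ?n) => apply (sm_pow f n)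
  | |- sm (fun t s => sin (@?f t s)) => apply (sm_sin f)
  | |- sm (fun t s => cos (@?f t s)) => apply (sm_cos f)
  | |- sm (fun t s => flat ?k (@?f t s)) => apply (sm_flat k f)
  | |- sm (fun t s => @?f t s / @?g t s) => apply (sm_div f g)
  | |- sm (fun t s => RInt (fun u => @?f t u) 0 1) => apply (sm_tot f)
  | |- sm (fun t s => RInt (@?f t) 0 1) => apply (sm_tot f)
  | |- sm (fun t s => RInt (@?f t) 0 s) => apply (sm_int f)
  | |- sm (fun t s => RInt (fun u => @?f t u) 0 s) => apply (sm_int f)
  | _ => progress cbv beta
  end.

(** * Compactness of a cube *)

Definition in_box (lo hi x y z : R) : Prop :=
  lo <= x <= hi /\ lo <= y <= hi /\ lo <= z <= hi.

Definition close3 (d a b c x y z : R) : Prop :=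
  Rabs (x - a) < d /\ Rabs (y - b) < d /\ Rabs (z - c) < d.

Lemma box_cover (lo hi : R) (delta : R -> R -> R -> posreal) :
  exists l : list (R * R * R),
    forall x y z, in_box lo hi x y z -> exists a b c,
      In (a, b, c) l /\ in_box lo hi a b c /\ close3 (delta a b c) a b c x y z.
Proof.
  apply NNPP. intros N.
  apply (compactness_list 3 (lo, (lo, (lo, tt))) (hi, (hi, (hi, tt)))
           (fun p => delta (fst p) (fst (snd p)) (fst (snd (snd p))))).
  intros [l Hl]. apply N.
  exists (map (fun p => (fst p, fst (snd p), fst (snd (snd p)))) l).
  intros x y z (Hx & Hy & Hz).
  destruct (Hl (x, (y, (z, tt)))) as ((a & b & c & []) & Hin & Hb & Hc).
  { simpl. tauto. }
  exists a, b, c. simpl in Hb, Hc. split; [|split].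
  - apply in_map_iff. exists (a, (b, (c, tt))). auto.
  - unfold in_box. tauto.
  - unfold close3. tauto.
Qed.

(** A finite subcover in which each neighbourhood carries a datum [u]; by [mono] the radii can all
    be lowered to their minimum. It later selects finitely many perturbing functions. *)
Lemma box_choice {A : Type} (lo hi : R) (Q : A -> Prop) (P : R -> R -> R -> R -> A -> Prop) :
  (forall x y z d d' u, 0 < d' <= d -> P x y z d u -> P x y z d' u) ->
  (forall a b c, in_box lo hi a b c -> exists d u, 0 < d /\ Q u /\
     forall x y z, close3 d a b c x y z -> in_box lo hi x y z -> P x y z d u) ->
  exists d l, 0 < d /\ (forall u, In u l -> Q u) /\
    forall x y z, in_box lo hi x y z -> exists u, In u l /\ P x y z d u.
Proof.
  intros mono loc.
  (* [A] may be empty, hence the option: points outside the box receive [None]. *)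
  set (R0 := fun a b c (du : posreal * option A) => in_box lo hi a b c ->
     exists u, snd du = Some u /\ Q u /\
     forall x y z, close3 (fst du) a b c x y z -> in_box lo hi x y z -> P x y z (fst du) u).
  assert (E : forall a b c, exists du, R0 a b c du).
  { intros a b c. destruct (classic (in_box lo hi a b c)) as [H|H].
    - destruct (loc a b c H) as (d & u & Hd & Hu & K).
      exists (mkposreal d Hd, Some u). intros _. exists u. auto.
    - exists (mkposreal 1 Rlt_0_1, None). now intros K. }
  set (F := fun a b c => proj1_sig (constructive_indefinite_description _ (E a b c))).
  assert (D : forall a b c, R0 a b c (F a b c))
    by (intros; unfold F; now destruct constructive_indefinite_description).
  clearbody F. clear E.
  destruct (box_cover lo hi (fun a b c => fst (F a b c))) as [l Hl].
  assert (M : exists d, 0 < d /\ forall a b c, In (a, b, c) l -> d <= fst (F a b c)).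
  { clear Hl. induction l as [|[[a b] c] l (d & Hd & IH)].
    - exists 1. split; [lra|]. intros a b c [].
    - exists (Rmin d (fst (F a b c))). split.
      + apply Rmin_pos; auto. apply cond_pos.
      + intros a' b' c' [H|H].
        * injection H; intros; subst. apply Rmin_r.
        * apply Rle_trans with (1 := Rmin_l _ _). auto. }
  destruct M as (d & Hd & M).
  (* The list of centres may contain points outside the box, about whose data nothing is known. *)
  set (l' := filter (fun q => if excluded_middle_informative
       (in_box lo hi (fst (fst q)) (snd (fst q)) (snd q)) then true else false) l).
  set (sel := fun q : R * R * R => snd (F (fst (fst q)) (snd (fst q)) (snd q))).
  exists d, (flat_map (fun q => match sel q with Some u => u :: nil | None => nil end) l').
  split; [auto|split].
  - intros u Hu. apply in_flat_map in Hu. destruct Hu as ([[a b] c] & Hq & Hu).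
    apply filter_In in Hq. destruct Hq as [_ Hq]. simpl in Hq.
    destruct excluded_middle_informative as [Hb|]; [|discriminate].
    destruct (D a b c Hb) as (v & Ev & Qv & _). unfold sel in Hu; simpl in Hu. rewrite Ev in Hu.
    destruct Hu as [<-|[]]. auto.
  - intros x y z H. destruct (Hl x y z H) as (a & b & c & Hin & Hb & Hc).
    destruct (D a b c Hb) as (v & Ev & Qv & K). exists v. split.
    + apply in_flat_map. exists (a, b, c). split.
      * apply filter_In. split; auto. simpl. now destruct excluded_middle_informative.
      * unfold sel; simpl. rewrite Ev. now left.
    + apply mono with (fst (F a b c)); auto.
Qed.

(** Here [d] is both the radius of a neighbourhood and the constant in the predicate. Local positive
    lower bounds thus become uniform, and upper bounds do too when written as [/ d]. *)
Lemma box_uniform (lo hi : R) (P : R -> R -> R -> R -> Prop) :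
  (forall x y z d d', 0 < d' <= d -> P x y z d -> P x y z d') ->
  (forall a b c, in_box lo hi a b c -> exists d, 0 < d /\
     forall x y z, close3 d a b c x y z -> in_box lo hi x y z -> P x y z d) ->
  exists d, 0 < d /\ forall x y z, in_box lo hi x y z -> P x y z d.
Proof.
  intros mono loc.
  destruct (box_choice lo hi (fun _ : unit => True) (fun x y z d _ => P x y z d))
    as (d & l & Hd & _ & H).
  - intros x y z d d' _. apply mono.
  - intros a b c Hb. destruct (loc a b c Hb) as (d & Hd & K). exists d, tt. auto.
  - exists d. split; auto. intros x y z Hb. destruct (H x y z Hb) as (_ & _ & K). exact K.
Qed.

Definition cont3 (F : R -> R -> R -> R) : Prop :=
  forall a b c e, 0 < e -> exists d, 0 < d /\
    forall x y z, close3 d a b c x y z -> Rabs (F x y z - F a b c) < e.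

Lemma box_bounded (lo hi : R) (F : R -> R -> R -> R) : cont3 F ->
  exists M, 0 < M /\ forall x y z, in_box lo hi x y z -> Rabs (F x y z) <= M.
Proof.
  intros C.
  destruct (box_uniform lo hi (fun x y z d => Rabs (F x y z) <= / d)) as (d & Hd & D).
  - intros x y z d d' Hd H. apply Rle_trans with (1 := H). apply Rinv_le_contravar; lra.
  - intros a b c _. destruct (C a b c 1 Rlt_0_1) as (d & Hd & D).
    set (m := / (Rabs (F a b c) + 1)).
    assert (A := Rabs_pos (F a b c)).
    assert (Hm : 0 < m) by (apply Rinv_0_lt_compat; lra).
    exists (Rmin d m). split; [now apply Rmin_pos|].
    intros x y z (H1 & H2 & H3) _.
    assert (L := Rmin_l d m). assert (L' := Rmin_r d m).
    assert (B : Rabs (F x y z - F a b c) < 1) by (apply D; repeat split; lra).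
    apply Rle_trans with (/ m).
    + unfold m. rewrite Rinv_inv.
      replace (F x y z) with ((F x y z - F a b c) + F a b c) by ring.
      triang. lra.
    + apply Rinv_le_contravar; auto. now apply Rmin_pos.
  - exists (/ d). split; auto. now apply Rinv_0_lt_compat.
Qed.

Lemma cont3_of_2 (f : R -> R -> R) : (forall t s, continuity_2d_pt f t s) ->
  cont3 (fun x y _ => f x y).
Proof.
  intros H a b c e He. destruct (H a b (mkposreal e He)) as [d Hd].
  exists d. split; [apply cond_pos|]. intros x y z (H1 & H2 & _). now apply Hd.
Qed.

(** * Isotopic loops have equal rotation numbers *)

(** The cosine of the angle difference stays positive. If the difference changed by a nonzero
    multiple of 2 PI over a period, it would pass through a value shifted by PI, where the cosine
    has the opposite sign. *)
Lemma winding_dot (a b a' b' : R -> R) (k l : Z) :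
  (forall s, 0 < a s * a' s + b s * b' s) -> winding a b k -> winding a' b' l -> k = l.
Proof.
  intros Hr (th & cth & ath & Hk) (ph & cph & aph & Hl).
  assert (Hc : forall s, 0 < cos (th s - ph s)).
  { intros s. specialize (Hr s). destruct (ath s) as [A B], (aph s) as [A' B'].
    assert (P := sqrt_pos (a s ^ 2 + b s ^ 2)). assert (P' := sqrt_pos (a' s ^ 2 + b' s ^ 2)).
    set (q := sqrt (a s ^ 2 + b s ^ 2)) in *. set (q' := sqrt (a' s ^ 2 + b' s ^ 2)) in *.
    rewrite A, A', B, B' in Hr. rewrite cos_minus.
    set (u := cos (th s) * cos (ph s) + sin (th s) * sin (ph s)).
    assert (E : 0 < (q * q') * u) by (unfold u; lra).
    assert (0 <= q * q') by now apply Rmult_le_pos. nra. }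
  destruct (Z.eq_dec k l) as [|Hkl]; auto. exfalso.
  set (d := fun s => th s - ph s).
  assert (HPI := PI_RGT_0).
  assert (cd : continuity d).
  { intros s. apply continuity_pt_filterlim. now apply (continuous_minus th ph). }
  assert (E : d 1 - d 0 = 2 * PI * IZR (k - l)) by (unfold d; rewrite minus_IZR; lra).
  assert (H : exists e : R, (e = PI \/ e = - PI) /\
              Rmin (d 0) (d 1) <= d 0 + e <= Rmax (d 0) (d 1)).
  { destruct (Z_lt_le_dec k l) as [H | H].
    - exists (- PI). split; [lra|].
      assert (IZR (k - l) <= -1) by (apply IZR_le; lia).
      assert (d 1 - d 0 <= - 2 * PI) by nra.
      rewrite Rmin_right, Rmax_left by lra. lra.
    - exists PI. split; [lra|].
      assert (1 <= IZR (k - l)) by (apply IZR_le; lia).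
      assert (d 1 - d 0 >= 2 * PI) by nra.
      rewrite Rmin_left, Rmax_right by lra. lra. }
  destruct H as (e & He & He').
  destruct (IVT_gen d 0 1 _ cd He') as (x & _ & Hx).
  assert (C0 := Hc 0). assert (Cx := Hc x). fold (d 0) in C0. fold (d x) in Cx.
  rewrite Hx in Cx.
  assert (cos (d 0 + e) = - cos (d 0)).
  { destruct He as [-> | ->]; [apply neg_cos|].
    rewrite cos_plus, cos_neg, sin_neg, cos_PI, sin_PI. ring. }
  lra.
Qed.

(** The local smooth extension agrees with [f] only for times in [0, 1], but for all nearby s, so
    the two have the same s-derivative at those times. *)
Lemma smooth_on_Derive_cont f : smooth_on (fun t s => 0 <= t <= 1) f ->
  forall t s e, 0 <= t <= 1 -> 0 < e -> exists d, 0 < d /\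
    forall u v, Rabs (u - t) < d -> Rabs (v - s) < d -> 0 <= u <= 1 ->
      Rabs (Derive (f u) v - Derive (f t) s) < e.
Proof.
  intros S t s e Ht He. destruct (S t s Ht) as (g & d0 & Hg).
  assert (E : forall u v, Rabs (u - t) < d0 -> Rabs (v - s) < d0 -> 0 <= u <= 1 ->
    Derive (f u) v = Derive (g u) v).
  { intros u v Hu Hv Hu'. apply Derive_ext_loc.
    assert (P : 0 < d0 - Rabs (v - s)) by lra.
    exists (mkposreal _ P). intros z Hz. apply Hg; auto.
    assert (Hz' : Rabs (z - v) < d0 - Rabs (v - s)) by exact Hz.
    replace (z - s) with ((z - v) + (v - s)) by ring.
    apply Rle_lt_trans with (1 := Rabs_triang _ _). lra. }
  assert (C : continuity_2d_pt (fun u v => Derive (fun z => g u z) v) t s).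
  { destruct (Hg t s) as [H _]; try (rewrite Rminus_diag, Rabs_R0; apply cond_pos).
    apply (H 1%nat). }
  destruct (C (mkposreal e He)) as [d1 Hd].
  exists (Rmin d0 d1). split; [apply Rmin_pos; apply cond_pos|].
  intros u v Hu Hv Hu'.
  assert (L := Rmin_l d0 d1). assert (L' := Rmin_r d0 d1).
  rewrite (E u v), (E t s) by (auto; try (rewrite Rminus_diag, Rabs_R0; apply cond_pos); lra).
  apply Hd; lra.
Qed.

Lemma periodic_Derive (f : R -> R) : periodic f -> periodic (Derive f).
Proof.
  intros pf s. rewrite <- (Derive_ext (fun u => f (u + 1)) f s) by apply pf.
  unfold Derive. apply f_equal, Lim_ext. intros h.
  now replace (s + h + 1) with (s + 1 + h) by ring.
Qed.

Lemma shift_Z (T : R) {B : Type} (f : R -> B) (k : Z) s :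
  (forall s, f (s + T) = f s) -> f (s + T * IZR k) = f s.
Proof.
  intros H.
  assert (N : forall n s, f (s + T * INR n) = f s).
  { induction n as [|n IH]; intros u; [simpl; f_equal; ring|].
    rewrite S_INR. replace (u + T * (INR n + 1)) with ((u + T * INR n) + T) by ring.
    rewrite H. apply IH. }
  destruct (Z_le_gt_dec 0 k) as [L|L].
  - rewrite <- (Z2Nat.id k L), <- INR_IZR_INZ. apply N.
  - rewrite <- (N (Z.to_nat (- k)) (s + T * IZR k)). f_equal.
    rewrite INR_IZR_INZ, Z2Nat.id by lia. rewrite opp_IZR. ring.
Qed.

Lemma period_reduce (T s : R) : 0 < T -> exists k : Z, 0 <= s + T * IZR k < T.
Proof.
  intros HT. exists (- Int_part (s / T))%Z. rewrite opp_IZR.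
  destruct (base_Int_part (s / T)) as [H1 H2].
  assert (E : s = T * (s / T)) by (field; lra).
  set (v := IZR (Int_part (s / T))) in *. set (r := s / T) in *. rewrite E. nra.
Qed.

Lemma horizontal_velocity_nz g s : horizontal_loop g ->
  0 < frame1 (velocity g s) ^ 2 + frame2 (velocity g s) ^ 2.
Proof.
  intros [[_ [_ [vg _]]] hg].
  destruct (hg s) as [H1 H2]. specialize (vg s).
  set (v := velocity g s) in *. unfold frame1, frame2.
  assert (H : cx v <> 0 \/ cy v <> 0).
  { destruct (Req_dec (cx v) 0) as [Ex|]; auto.
    destruct (Req_dec (cy v) 0) as [Ey|]; auto.
    exfalso; apply vg. rewrite Ex in H1, H2.
    destruct v as [[[vx vy] vz] vw]. unfold zero4, cx, cy, cz, cw in *; simpl in *.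
    f_equal; [f_equal; [f_equal|]|]; lra. }
  destruct H; nra.
Qed.

(** The scalar product drops by at most 2 e (|A| + |B|) + 2 e^2; the summand 1 in the hypothesis
    absorbs the quadratic term, since e <= 1. *)
Lemma dot_near (A B e a b a' b' : R) : 0 <= e -> e <= 1 ->
  2 * e * (Rabs A + Rabs B + 1) < A ^ 2 + B ^ 2 ->
  Rabs (a - A) < e -> Rabs (b - B) < e -> Rabs (a' - A) < e -> Rabs (b' - B) < e ->
  0 < a * a' + b * b'.
Proof.
  intros H0 He1 He Ha Hb Ha' Hb'.
  assert (G : forall A a a', Rabs (a - A) < e -> Rabs (a' - A) < e ->
            A ^ 2 - 2 * e * Rabs A - e ^ 2 <= a * a').
  { clear. intros A a a' H H'. apply Rabs_lt_between in H, H'.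
    set (p := a - A) in *. set (p' := a' - A) in *.
    replace (a * a') with (A ^ 2 + A * (p + p') + p * p') by (unfold p, p'; ring).
    assert (- (e ^ 2) <= p * p') by nra.
    assert (- (2 * e * Rabs A) <= A * (p + p')).
    { unfold Rabs. destruct (Rcase_abs A); nra. }
    lra. }
  generalize (G A a a' Ha Ha') (G B b b' Hb Hb'). nra.
Qed.

(** By compactness, velocities at times less than [d] apart have positive scalar product at every
    point, so [winding_dot] gives equal rotation numbers; steps of length 1/N < d then lead from 0
    to 1. *)
Lemma isotopic_rot g0 g1 : horizontally_isotopic g0 g1 -> rot g0 = rot g1.
Proof.
  intros (G & (Sx & Sy & _ & _) & HG & G0 & G1).
  set (a := fun t s => frame1 (velocity (G t) s)).
  set (b := fun t s => frame2 (velocity (G t) s)).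
  assert (pa : forall t, 0 <= t <= 1 -> periodic (a t)).
  { intros t Ht. apply periodic_Derive. intros s.
    destruct (HG t Ht) as [[p _] _]. now rewrite p. }
  assert (pb : forall t, 0 <= t <= 1 -> periodic (b t)).
  { intros t Ht. apply periodic_Derive. intros s.
    destruct (HG t Ht) as [[p _] _]. now rewrite p. }
  destruct (box_uniform 0 1 (fun t s _ d => forall u, Rabs (u - t) < d -> 0 <= u <= 1 ->
     0 < a t s * a u s + b t s * b u s)) as (d & Hd & D).
  - intros x y z d d' Hd H u Hu. apply H. lra.
  - intros t s c (Ht & _ & _).
    assert (N := horizontal_velocity_nz (G t) s (HG t Ht)). fold (a t s) (b t s) in N.
    set (m := Rabs (a t s) + Rabs (b t s) + 1).
    assert (Hm : 0 < m) by (unfold m; generalize (Rabs_pos (a t s)) (Rabs_pos (b t s)); lra).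
    set (e := Rmin 1 ((a t s ^ 2 + b t s ^ 2) / (4 * m))).
    assert (He : 0 < e) by (apply Rmin_pos; [lra|apply Rdiv_lt_0_compat; lra]).
    assert (He' : 2 * e * m < a t s ^ 2 + b t s ^ 2).
    { apply Rle_lt_trans with (2 * ((a t s ^ 2 + b t s ^ 2) / (4 * m)) * m).
      - apply Rmult_le_compat_r; [lra|]. apply Rmult_le_compat_l; [lra|]. apply Rmin_r.
      - replace (2 * ((a t s ^ 2 + b t s ^ 2) / (4 * m)) * m) with ((a t s ^ 2 + b t s ^ 2) / 2)
          by (field; lra). lra. }
    destruct (smooth_on_Derive_cont _ Sx t s e Ht He) as (d1 & Hd1 & K1).
    destruct (smooth_on_Derive_cont _ Sy t s e Ht He) as (d2 & Hd2 & K2).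
    assert (L := Rmin_l d1 d2). assert (L' := Rmin_r d1 d2).
    assert (HP : 0 < Rmin d1 d2) by now apply Rmin_pos.
    (* Halved so that a time this close to [t'] is still within [Rmin d1 d2] of [t]. *)
    exists (Rmin d1 d2 / 2). split; [lra|].
    intros t' s' z (B1 & B2 & _) (Ht' & _ & _) u Hu Hu'.
    assert (B3 : Rabs (u - t) < Rmin d1 d2).
    { replace (u - t) with ((u - t') + (t' - t)) by ring.
      apply Rle_lt_trans with (1 := Rabs_triang _ _). lra. }
    apply dot_near with (a t s) (b t s) e; try lra; auto; try apply Rmin_l.
    + apply K1; lra.
    + apply K2; lra.
    + apply K1; lra.
    + apply K2; lra.
  - assert (St : forall t u, 0 <= t <= 1 -> 0 <= u <= 1 -> Rabs (u - t) < d -> rot (G t) = rot (G u)).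
    { intros t u Ht Hu Htu.
      assert (W1 := proj2 (rotP (G t) _ (HG t Ht)) eq_refl).
      assert (W2 := proj2 (rotP (G u) _ (HG u Hu)) eq_refl).
      refine (winding_dot _ _ _ _ _ _ _ W1 W2). intros s.
      change (0 < a t s * a u s + b t s * b u s).
      destruct (period_reduce 1 s Rlt_0_1) as [k Hk].
      assert (Sh : forall f : R -> R, periodic f -> f s = f (s + 1 * IZR k))
        by (intros f pf; symmetry; now apply shift_Z).
      rewrite (Sh (a t)), (Sh (b t)), (Sh (a u)), (Sh (b u)) by auto.
      apply (D t (s + 1 * IZR k) 0); auto. repeat split; lra. }
    destruct (archimed_cor1 d Hd) as (N & HN & HN').
    assert (PN : 0 < INR N) by now apply lt_0_INR.
    assert (Ch : forall i, (i <= N)%nat -> rot (G (INR i / INR N)) = rot (G 0)).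
    { induction i as [|i IH]; intros Hi.
      - f_equal. f_equal. simpl. field. lra.
      - rewrite <- IH by lia.
        assert (R1 : forall j, (j <= N)%nat -> 0 <= INR j / INR N <= 1).
        { intros j Hj. apply le_INR in Hj. split.
          - apply Rdiv_le_0_compat; auto. apply pos_INR.
          - apply Rle_div_l; lra. }
        apply St; try (apply R1; lia). rewrite S_INR.
        replace (INR i / INR N - (INR i + 1) / INR N) with (- / INR N) by (field; lra).
        rewrite Rabs_Ropp, Rabs_pos_eq; auto. left. now apply Rinv_0_lt_compat. }
    specialize (Ch N (le_n N)). replace (INR N / INR N) with 1 in Ch by (field; lra).
    replace g0 with (G 0) by (extensionality s; apply G0).
    replace g1 with (G 1) by (extensionality s; apply G1). auto.
Qed.

(** * Integrals of continuous functions *)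

Lemma RIplus (f g : R -> R) a b : (forall x, continuous f x) -> (forall x, continuous g x) ->
  RInt (fun x => f x + g x) a b = RInt f a b + RInt g a b.
Proof. intros. apply (RInt_plus (V := R_CompleteNormedModule) f g); now apply ex_RInt_cont. Qed.

Lemma RIscal (f : R -> R) c a b : (forall x, continuous f x) ->
  RInt (fun x => c * f x) a b = c * RInt f a b.
Proof. intros. apply (RInt_scal (V := R_CompleteNormedModule) f); now apply ex_RInt_cont. Qed.

Lemma RIchasles (f : R -> R) a b c : (forall x, continuous f x) ->
  RInt f a b + RInt f b c = RInt f a c.
Proof. intros. apply (RInt_Chasles (V := R_CompleteNormedModule) f); now apply ex_RInt_cont. Qed.

Lemma ftc (F f : R -> R) a b : (forall s, is_derive F s (f s)) -> (forall s, continuous f s) ->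
  RInt f a b = F b - F a.
Proof.
  intros D C. apply is_RInt_unique. apply (is_RInt_derive F f); auto.
Qed.

Lemma cmult (f g : R -> R) s : continuous f s -> continuous g s -> continuous (fun s => f s * g s) s.
Proof. intros. now apply (continuous_mult f g). Qed.

Lemma cplus (f g : R -> R) s : continuous f s -> continuous g s -> continuous (fun s => f s + g s) s.
Proof. intros. now apply (continuous_plus f g). Qed.

Lemma cminus (f g : R -> R) s : continuous f s -> continuous g s -> continuous (fun s => f s - g s) s.
Proof. intros. now apply (continuous_minus f g). Qed.

Lemma cpow (f : R -> R) n s : continuous f s -> continuous (fun s => f s ^ n) s.
Proof.
  intros H. induction n as [|n IH]; [apply continuous_const|].
  exact (cmult f _ s H IH).
Qed.

Ltac cont := lazymatch goal with
  | |- continuous (fun s => @?f s + @?g s) _ => apply (cplus f g); cont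
  | |- continuous (fun s => @?f s - @?g s) _ => apply (cminus f g); cont
  | |- continuous (fun s => @?f s * @?g s) _ => apply (cmult f g); cont
  | |- continuous (fun s => @?f s ^ ?n) _ => apply (cpow f n); cont
  | |- continuous _ _ =>
      match goal with
      | H : forall s, continuous ?f s |- continuous ?g ?x => exact (H x)
      | H : forall t s, continuous (@?f t) s |- continuous ?g ?x => exact (H _ x)
      | H : forall w t s, continuous (@?f w t) s |- continuous ?g ?x => exact (H _ _ x)
      | _ => apply continuous_const
      | _ => progress cbv beta; cont
      end
  end.

Lemma RInt_pos_somewhere (f : R -> R) a b s0 : (forall s, continuous f s) ->
  (forall s, a < s < b -> 0 <= f s) -> a < s0 < b -> 0 < f s0 -> 0 < RInt f a b.
Proof.
  intros C P Hs H.
  assert (K := C s0). apply continuity_pt_filterlim in K.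
  destruct (K (f s0 / 2)) as (d & Hd & D); [lra|].
  set (e := Rmin (d / 2) (Rmin ((s0 - a) / 2) ((b - s0) / 2))).
  assert (He : 0 < e) by (unfold e; repeat apply Rmin_pos; lra).
  assert (L1 : e <= d / 2) by apply Rmin_l.
  assert (L2 : e <= (s0 - a) / 2) by (unfold e; rmin).
  assert (L3 : e <= (b - s0) / 2) by (unfold e; rmin).
  rewrite <- (RIchasles f a (s0 - e) b), <- (RIchasles f (s0 - e) (s0 + e) b) by auto.
  assert (0 <= RInt f a (s0 - e)).
  { apply RInt_ge_0; [lra|now apply ex_RInt_cont|]. intros; apply P; lra. }
  assert (0 <= RInt f (s0 + e) b).
  { apply RInt_ge_0; [lra|now apply ex_RInt_cont|]. intros; apply P; lra. }
  assert (0 < RInt f (s0 - e) (s0 + e)); [|lra].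
  apply RInt_gt_0; [lra| |auto].
  intros x Hx. destruct (Req_dec x s0) as [->|N]; auto.
  assert (B : Rabs (f x - f s0) < f s0 / 2).
  { apply D. split; [split; [exact I|auto]|]. simpl. unfold R_dist, Rdist. apply Rabs_lt_between'. lra. }
  apply Rabs_lt_between' in B. lra.
Qed.

Lemma RInt_zero_nonneg (f : R -> R) a b : (forall s, continuous f s) ->
  (forall s, a < s < b -> 0 <= f s) -> RInt f a b = 0 -> forall s, a < s < b -> f s = 0.
Proof.
  intros C P E s Hs. destruct (P s Hs) as [H|H]; auto.
  generalize (RInt_pos_somewhere f a b s C P Hs H). lra.
Qed.

Lemma const_of_derive0 (F : R -> R) a b : (forall s, a < s < b -> is_derive F s 0) ->
  (forall s, continuous F s) -> a <= b -> F a = F b.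
Proof.
  intros D C H. destruct H as [H|H]; [|now subst].
  destruct (MVT_gen F a b (fun _ => 0)) as (c & _ & E).
  - rewrite Rmin_left, Rmax_right by lra. auto.
  - intros x _. apply continuity_pt_filterlim, C.
  - lra.
Qed.

Lemma const_of_derive0' (F : R -> R) : (forall s, is_derive F s 0) -> forall s u, F s = F u.
Proof.
  intros D. assert (C : forall s, continuous F s).
  { intros s. apply (ex_derive_continuous F). eexists; apply D. }
  intros s u. destruct (Rle_dec s u).
  - apply const_of_derive0; auto.
  - symmetry. apply const_of_derive0; auto; lra.
Qed.

Lemma is_derive_shift (F : R -> R) c s l : is_derive F (s + c) l -> is_derive (fun s => F (s + c)) s l.
Proof.
  intros H. rewrite <- (Rmult_1_r l). apply (is_derive_comp_R F (fun s => s + c)); auto.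
  auto_derive; auto.
Qed.

Lemma prim_shift (F f : R -> R) : (forall s, is_derive F s (f s)) -> periodic f ->
  forall s, F (s + 1) = F s + (F 1 - F 0).
Proof.
  intros D p s.
  assert (E : F (s + 1) - F s = F (0 + 1) - F 0).
  { apply (const_of_derive0' (fun s => F (s + 1) - F s)). intros u.
    replace 0 with (f (u + 1) - f u) by (rewrite p; ring).
    apply (is_derive_minus (fun s => F (s + 1)) F); auto. now apply is_derive_shift. }
  rewrite Rplus_0_l in E. lra.
Qed.

Definition dper (f : R -> R -> R) : Prop :=
  (forall t s, f (t + 2) s = f t s) /\ (forall t s, f t (s + 1) = f t s).

(** * Whitney-Graustein *)

(* [phi] keeps the interpolated angle from being constant at some time, which can happen only if
   [k = 0] and [th1] is an affine function of [th0]. *)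
Lemma angle_detour (th0 th1 : R -> R) (k : Z) :
  (forall s, continuous th0 s) ->
  (forall s, th0 (s + 1) = th0 s + 2 * PI * IZR k) ->
  (forall s, th1 (s + 1) = th1 s + 2 * PI * IZR k) ->
  (exists s, 0 <= s <= 1 /\ th0 s <> th0 0) -> (exists s, 0 <= s <= 1 /\ th1 s <> th1 0) ->
  exists phi : R -> R, (phi = (fun _ => 0) \/ phi = (fun s => th0 s * th0 s)) /\ periodic phi /\
    forall rho, exists s, 0 <= s <= 1 /\
      (1 - rho) * th0 s + rho * th1 s + rho * (1 - rho) * phi s <>
      (1 - rho) * th0 0 + rho * th1 0 + rho * (1 - rho) * phi 0.
Proof.
  intros c0 p0 p1 N0 N1.
  destruct (Z.eq_dec k 0) as [->|Hk].
  2: { exists (fun _ => 0). split; auto. split; [now intros s|]. intros rho. exists 1. split; [lra|].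
       assert (E0 := p0 0). assert (E1 := p1 0). rewrite Rplus_0_l in E0, E1.
       assert (IZR k <> 0) by now apply not_0_IZR.
       assert (2 * PI * IZR k <> 0) by (generalize PI_RGT_0; intros; apply Rmult_integral_contrapositive; split; lra).
       rewrite E0, E1. intros E. lra. }
  destruct (classic (exists al be, forall s, 0 <= s <= 1 -> th1 s = al * th0 s + be)) as [A|A].
  - destruct A as (al & be & A). exists (fun s => th0 s * th0 s). split; auto.
    split; [intros s; rewrite p0; f_equal; ring|]. intros rho.
    apply NNPP. intros N.
    assert (E : forall s, 0 <= s <= 1 ->
      (1 - rho) * th0 s + rho * th1 s + rho * (1 - rho) * (th0 s * th0 s) =
      (1 - rho) * th0 0 + rho * th1 0 + rho * (1 - rho) * (th0 0 * th0 0)).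
    { intros s Hs. apply NNPP. intros F. apply N. now exists s. }
    clear N. destruct N0 as (u & Hu & N0).
    (* The interpolated angle is a polynomial of degree at most 2 in [th0]. Equal values at x, y and
       their midpoint force its leading coefficient rho (1 - rho) to vanish, so the angle is [th0]
       or [th1], neither of which is constant. *)
    destruct (IVT_gen th0 0 u ((th0 0 + th0 u) / 2)) as (v & Hv & Ev).
    { intros s. apply continuity_pt_filterlim, c0. }
    { unfold Rmin, Rmax. destruct (Rle_dec (th0 0) (th0 u)); lra. }
    rewrite Rmin_left, Rmax_right in Hv by lra.
    assert (Hv' : 0 <= v <= 1) by lra.
    assert (E1 := E u Hu). assert (E2 := E v Hv').
    rewrite (A u Hu), (A 0) in E1 by lra. rewrite (A v Hv'), (A 0) in E2 by lra.
    rewrite Ev in E2. set (x := th0 0) in *. set (y := th0 u) in *.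
    set (B := (1 - rho) + rho * al) in *.
    assert (F1 : (y - x) * (B + rho * (1 - rho) * (x + y)) = 0) by (unfold B; lra).
    assert (F2 : (y - x) * (B + rho * (1 - rho) * (x + (x + y) / 2)) = 0) by (unfold B; lra).
    assert (D : y - x <> 0) by lra.
    apply Rmult_integral in F1, F2. destruct F1 as [|F1]; [lra|]. destruct F2 as [|F2]; [lra|].
    assert (F3 : (rho * (1 - rho)) * (y - x) = 0) by lra.
    apply Rmult_integral in F3. destruct F3 as [F3|F3]; [|lra].
    apply Rmult_integral in F3. destruct N1 as (w & Hw & N1).
    specialize (E w Hw). destruct F3 as [F3|F3].
    + rewrite F3 in *. unfold B in F1. lra.
    + replace rho with 1 in * by lra. lra.
  - exists (fun _ => 0). split; auto. split; [now intros s|]. intros rho.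
    apply NNPP. intros N.
    assert (E : forall s, 0 <= s <= 1 ->
      (1 - rho) * th0 s + rho * th1 s = (1 - rho) * th0 0 + rho * th1 0).
    { intros s Hs. apply NNPP. intros F. apply N. exists s. split; auto. lra. }
    destruct (Req_dec rho 0) as [->|Hr].
    + destruct N0 as (u & Hu & N0). specialize (E u Hu). lra.
    (* A constant interpolation can be solved for [th1] as an affine function of [th0], the case
       already treated. *)
    + apply A. exists (- (1 - rho) / rho), (((1 - rho) * th0 0 + rho * th1 0) / rho).
      intros s Hs. apply Rmult_eq_reg_l with rho; auto. specialize (E s Hs). field_simplify; auto. lra.
Qed.

Lemma sm_of_smooth_Derive h : smooth h -> sm (fun _ s => Derive h s).
Proof. intros H. exact (proj1 (sm_Ds _ (sm_smooth h H))). Qed.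

(** The angle supplied by [is_rot] is merely continuous. Near s it equals [th s] plus the arctangent
    of the quotient of cross and scalar products of the velocities, so it is a primitive of the
    smooth function [w] and belongs to the class by [sm_prim]. *)
Lemma smooth_angle g k : horizontal_loop g -> is_rot g k ->
  exists th r : R -> R, sm (fun _ s => th s) /\ sm (fun _ s => r s) /\
    (forall s, 0 < r s) /\ periodic r /\
    (forall s, th (s + 1) = th s + 2 * PI * IZR k) /\
    (forall s, Derive (fun u => cx (g u)) s = r s * cos (th s)) /\
    (forall s, Derive (fun u => cy (g u)) s = r s * sin (th s)).
Proof.
  intros Hg (th & cth & ath & Hk).
  assert (Hr := fun s => horizontal_velocity_nz g s Hg).
  destruct Hg as [[pg [[sx [sy _]] _]] _].
  set (a := fun s => frame1 (velocity g s)) in *.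
  set (b := fun s => frame2 (velocity g s)) in *.
  assert (ath' : forall s, a s = sqrt (a s ^ 2 + b s ^ 2) * cos (th s) /\
                           b s = sqrt (a s ^ 2 + b s ^ 2) * sin (th s)) by exact ath.
  clear ath. rename ath' into ath.
  assert (Sa : sm (fun _ s => a s)) by exact (sm_of_smooth_Derive _ sx).
  assert (Sb : sm (fun _ s => b s)) by exact (sm_of_smooth_Derive _ sy).
  assert (pa : periodic a) by (apply periodic_Derive; intros s; now rewrite pg).
  assert (pb : periodic b) by (apply periodic_Derive; intros s; now rewrite pg).
  assert (Hr' : forall s, 0 < a s ^ 2 + b s ^ 2) by exact Hr. clear Hr.
  destruct (sm_Ds _ Sa) as [Sa' Da]. destruct (sm_Ds _ Sb) as [Sb' Db].
  unfold Ds in Da, Db, Sa', Sb'.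
  set (w := fun s => (a s * Derive b s - b s * Derive a s) / (a s ^ 2 + b s ^ 2)).
  assert (Sw : sm (fun _ s => w s)).
  { unfold w. smt. intros _ s. specialize (Hr' s). lra. }
  assert (Dth : forall s, is_derive th s (w s)).
  { intros s.
    assert (K := cth s). apply continuity_pt_filterlim in K.
    destruct (K (PI / 2)) as (d & Hd & D); [generalize PI_RGT_0; lra|].
    apply is_derive_ext_loc with
      (fun u => th s + atan ((a s * b u - b s * a u) / (a s * a u + b s * b u))).
    - exists (mkposreal d Hd). intros u Hu.
      assert (Hu' : - (PI / 2) < th u - th s < PI / 2).
      { apply Rabs_lt_between. destruct (Req_dec u s) as [->|N].
        - rewrite Rminus_diag, Rabs_R0. generalize PI_RGT_0; lra.
        - apply D. split; [split; [exact I|auto]|]. exact Hu. }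
      assert (C : 0 < cos (th u - th s)) by (apply cos_gt_0; lra).
      replace ((a s * b u - b s * a u) / (a s * a u + b s * b u)) with (tan (th u - th s)).
      + rewrite atan_tan by lra. lra.
      + destruct (ath s) as [A1 B1], (ath u) as [A2 B2].
        assert (Q1 := sqrt_lt_R0 _ (Hr' s)). assert (Q2 := sqrt_lt_R0 _ (Hr' u)).
        set (q1 := sqrt (a s ^ 2 + b s ^ 2)) in *. set (q2 := sqrt (a u ^ 2 + b u ^ 2)) in *.
        rewrite A1, A2, B1, B2. unfold tan. rewrite cos_minus in *. rewrite sin_minus.
        field. repeat split; try lra.
        replace (q1 * cos (th s) * (q2 * cos (th u)) + q1 * sin (th s) * (q2 * sin (th u)))
          with ((q1 * q2) * (cos (th u) * cos (th s) + sin (th u) * sin (th s))) by ring.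
        apply Rgt_not_eq. apply Rmult_lt_0_compat; auto. now apply Rmult_lt_0_compat.
    - assert (Hr := Hr' s).
      assert (Ea : ex_derive a s) by (eexists; apply (Da 0)).
      assert (Eb : ex_derive b s) by (eexists; apply (Db 0)).
      auto_derive.
      + repeat split; auto. apply Rgt_not_eq. simpl in Hr. lra.
      + unfold w. change (Derive (fun x => a x) s) with (Derive a s).
        change (Derive (fun x => b x) s) with (Derive b s).
        field. simpl in Hr. split; [lra|].
        apply Rgt_not_eq. 
        assert (0 < (a s * a s + b s * b s) * (a s * a s + b s * b s)) by (apply Rmult_lt_0_compat; lra).
        assert (0 <= (a s * b s - b s * a s) ^ 2) by apply pow2_ge_0. nra. }
  exists th, (fun s => sqrt (a s ^ 2 + b s ^ 2)).
  split; [now apply sm_prim with w|]. split; [|split; [|split; [|split; [|split]]]].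
  - apply (sm_sqrt (fun _ s => a s ^ 2 + b s ^ 2)); [auto|smt].
  - intros s. now apply sqrt_lt_R0.
  - intros s. now rewrite pa, pb.
  - intros s. rewrite <- Hk. apply (prim_shift th w); auto.
    assert (pa' := periodic_Derive a pa). assert (pb' := periodic_Derive b pb).
    intros u. unfold w. now rewrite pa, pb, pa', pb'.
  - apply ath.
  - apply ath.
Qed.

Ltac req := match goal with |- @eq _ ?a ?b => change (@eq R a b) end.
Ltac rext := apply RInt_ext; intros; req.
Ltac rilin := rewrite <- ?RIscal, <- ?RIplus by (intros; cont); rext.

(** * The Gram determinant of [1, x] for a weight *)

Definition m0 (w : R -> R) a b := RInt w a b.
Definition m1 (x w : R -> R) a b := RInt (fun s => x s * w s) a b.
Definition m2 (x w : R -> R) a b := RInt (fun s => x s * (x s * w s)) a b.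
Definition gdet x w a b := m0 w a b * m2 x w a b - m1 x w a b * m1 x w a b.
(** [gc1] and [gc2] are Cramer's rule for the coefficients c, d of a function (c + d x) w with
    prescribed integrals [p], and [q] against x. *)
Definition gc1 x w a b p q := (p * m2 x w a b - q * m1 x w a b) / gdet x w a b.
Definition gc2 x w a b p q := (q * m0 w a b - p * m1 x w a b) / gdet x w a b.

Lemma gram_solve x w a b p q : gdet x w a b <> 0 ->
  gc1 x w a b p q * m0 w a b + gc2 x w a b p q * m1 x w a b = p /\
  gc1 x w a b p q * m1 x w a b + gc2 x w a b p q * m2 x w a b = q.
Proof. intros H. unfold gc1, gc2, gdet in *. split; field; auto. Qed.

Lemma gram_int x w a b c d : (forall s, continuous x s) -> (forall s, continuous w s) ->
  RInt (fun s => (c + d * x s) * w s) a b = c * m0 w a b + d * m1 x w a b /\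
  RInt (fun s => x s * ((c + d * x s) * w s)) a b = c * m1 x w a b + d * m2 x w a b.
Proof.
  intros Cx Cw. unfold m0, m1, m2. split.
  - rilin. ring.
  - rilin. ring.
Qed.

(** Strict Cauchy-Schwarz inequality: the determinant is m0 times the integral of (x - c)^2 w. *)
Lemma gdet_pos x w a b : (forall s, continuous x s) -> (forall s, continuous w s) ->
  (forall s, a < s < b -> 0 <= w s) ->
  (forall c, exists s, a < s < b /\ 0 < (x s - c) ^ 2 * w s) -> 0 < gdet x w a b.
Proof.
  intros Cx Cw P N.
  assert (H0 : 0 < m0 w a b).
  { destruct (N 0) as (s & Hs & H).
    apply (RInt_pos_somewhere w a b s); auto.
    destruct (P s Hs) as [|E]; auto. rewrite <- E in H. lra. }
  (* The mean of [x] for the weight. *)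
  set (c := m1 x w a b / m0 w a b).
  assert (H : 0 < RInt (fun s => (x s - c) ^ 2 * w s) a b).
  { destruct (N c) as (s & Hs & H).
    apply (RInt_pos_somewhere (fun s => (x s - c) ^ 2 * w s) a b s); auto.
    - intros; cont.
    - intros u Hu. apply Rmult_le_pos; auto. apply pow2_ge_0. }
  assert (E : RInt (fun s => (x s - c) ^ 2 * w s) a b =
              m2 x w a b + (- (2 * c) * m1 x w a b + c ^ 2 * m0 w a b)).
  { unfold m0, m1, m2. rilin. ring. }
  rewrite E in H. unfold gdet.
  replace (m0 w a b * m2 x w a b - m1 x w a b * m1 x w a b) with
    (m0 w a b * (m2 x w a b + (- (2 * c) * m1 x w a b + c ^ 2 * m0 w a b))).
  - now apply Rmult_lt_0_compat.
  - unfold c. field. lra.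
Qed.

(** Otherwise [x] would equal [c] near a point where its derivative is not zero. *)
Lemma nonconst_sq (x xs : R -> R) a b : (forall s, is_derive x s (xs s)) ->
  (forall s, continuous xs s) -> (exists s, a < s < b /\ xs s <> 0) ->
  forall c, exists s, a < s < b /\ (x s - c) * xs s <> 0.
Proof.
  intros D C (s & Hs & Hx) c. apply NNPP. intros N.
  assert (Z : forall s, a < s < b -> (x s - c) * xs s = 0).
  { intros u Hu. apply NNPP. intros F. apply N. now exists u. }
  assert (K := C s). apply continuity_pt_filterlim in K.
  destruct (K (Rabs (xs s))) as (d & Hd & B); [now apply Rabs_pos_lt|].
  set (e := Rmin d (Rmin (s - a) (b - s))).
  assert (He : 0 < e) by (unfold e; repeat apply Rmin_pos; lra).
  assert (L1 : e <= d) by apply Rmin_l.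
  assert (L2 : e <= s - a) by (unfold e; rmin).
  assert (L3 : e <= b - s) by (unfold e; rmin).
  apply Hx. rewrite <- (is_derive_unique x s _ (D s)).
  rewrite (Derive_ext_loc x (fun _ => c) s); [apply Derive_const|].
  exists (mkposreal e He). intros u Hu.
  assert (Hu' : Rabs (u - s) < e) by exact Hu.
  assert (Hu2 := Hu'). apply Rabs_lt_between' in Hu2.
  assert (Nu : xs u <> 0).
  { intros E. destruct (Req_dec u s) as [->|Nu]; auto.
    assert (T : Rabs (xs u - xs s) < Rabs (xs s)).
    { apply B. split; [split; [exact I|auto]|]. simpl. unfold Rdist. lra. }
    rewrite E, Rminus_0_l, Rabs_Ropp in T. lra. }
  assert (Zu : (x u - c) * xs u = 0) by (apply Z; lra).
  apply Rmult_integral in Zu. destruct Zu; lra.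
Qed.

(** * Correcting the moments *)

(** The correcting factor x'^3 times dx = x' ds. Being a fourth power, it is nonnegative, as
    [gdet_pos] requires of a weight. *)
Definition wt (xs : R -> R) (s : R) : R := xs s ^ 3 * xs s.
Definition cc1 (x xs u : R -> R) : R := gc1 x (wt xs) 0 1
  (RInt (fun s => u s * xs s) 0 1) (RInt (fun s => x s * (u s * xs s)) 0 1).
Definition cc2 (x xs u : R -> R) : R := gc2 x (wt xs) 0 1
  (RInt (fun s => u s * xs s) 0 1) (RInt (fun s => x s * (u s * xs s)) 0 1).

(* Multiples of [x'^3] do not change the derivative where [x'] vanishes, so that immersed curves stay immersed. *)
Definition corr (x xs u : R -> R) (s : R) : R :=
  u s - (cc1 x xs u + cc2 x xs u * x s) * xs s ^ 3.

Lemma corr_closed (x xs u : R -> R) : (forall s, continuous x s) -> (forall s, continuous xs s) ->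
  (forall s, continuous u s) -> gdet x (wt xs) 0 1 <> 0 ->
  RInt (fun s => corr x xs u s * xs s) 0 1 = 0 /\
  RInt (fun s => x s * (corr x xs u s * xs s)) 0 1 = 0.
Proof.
  intros Cx Cs Cu D.
  assert (Cw : forall s, continuous (wt xs) s) by (intros; unfold wt; cont).
  set (p := RInt (fun s => u s * xs s) 0 1).
  set (q := RInt (fun s => x s * (u s * xs s)) 0 1).
  destruct (gram_solve x (wt xs) 0 1 p q D) as [E1 E2].
  destruct (gram_int x (wt xs) 0 1 (cc1 x xs u) (cc2 x xs u) Cx Cw) as [F1 F2].
  change (gc1 x (wt xs) 0 1 p q) with (cc1 x xs u) in *.
  change (gc2 x (wt xs) 0 1 p q) with (cc2 x xs u) in *.
  rewrite E1 in F1. rewrite E2 in F2. split.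
  - transitivity (p + (-1) * p); [|req; ring]. rewrite <- F1 at 2. unfold p.
    rilin. unfold corr, wt; ring.
  - transitivity (q + (-1) * q); [|req; ring]. rewrite <- F2 at 2. unfold q.
    rilin. unfold corr, wt; ring.
Qed.

(** Both numerators in Cramer's rule vanish. Hence the correction does not move the given loops at
    the ends of a family. *)
Lemma corr_id (x xs u : R -> R) : RInt (fun s => u s * xs s) 0 1 = 0 ->
  RInt (fun s => x s * (u s * xs s)) 0 1 = 0 -> forall s, corr x xs u s = u s.
Proof.
  intros E1 E2 s. unfold corr, cc1, cc2, gc1, gc2. rewrite E1, E2. unfold Rdiv. ring.
Qed.

Lemma wt_det_pos (x xs : R -> R) : (forall s, is_derive x s (xs s)) ->
  (forall s, continuous xs s) -> (exists s, 0 < s < 1 /\ xs s <> 0) -> 0 < gdet x (wt xs) 0 1.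
Proof.
  intros D C N.
  assert (Cx : forall s, continuous x s).
  { intros s. apply (ex_derive_continuous x). eexists; apply D. }
  apply gdet_pos; auto.
  - intros; unfold wt; cont.
  - intros s _. unfold wt. replace (xs s ^ 3 * xs s) with ((xs s ^ 2) ^ 2) by ring. apply pow2_ge_0.
  - intros c. destruct (nonconst_sq x xs 0 1 D C N c) as (s & Hs & H).
    exists s. split; auto. unfold wt.
    assert (xs s <> 0) by (intros E; apply H; rewrite E; ring).
    replace ((x s - c) ^ 2 * (xs s ^ 3 * xs s)) with (((x s - c) * xs s) ^ 2 * (xs s) ^ 2) by ring.
    apply Rmult_lt_0_compat; apply pow2_gt_0; auto.
Qed.

(** * Families of immersed plane curves *)

Definition immersed_family (X Y : R -> R -> R) : Prop :=
  sm X /\ sm Y /\ dper X /\ dper Y /\ (forall t s, Ds X t s <> 0 \/ Ds Y t s <> 0).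

Definition closed_family (X Y : R -> R -> R) : Prop := forall t,
  RInt (fun s => Y t s * Ds X t s) 0 1 = 0 /\
  RInt (fun s => X t s * (Y t s * Ds X t s)) 0 1 = 0.

Definition fcorr (X U : R -> R -> R) (t : R) : R -> R := corr (X t) (Ds X t) (U t).

Lemma dper_Ds f : dper f -> dper (Ds f).
Proof.
  intros [p q]. split; intros t s; unfold Ds.
  - apply Derive_ext. intros; apply p.
  - apply (periodic_Derive (f t)). exact (q t).
Qed.

Lemma dper_fcorr X U : dper X -> dper U -> dper (fcorr X U).
Proof.
  intros pX pU. destruct (dper_Ds X pX) as [pt ps].
  destruct pX as [pXt pXs], pU as [pUt pUs].
  split; intros t s; unfold fcorr.
  - replace (X (t + 2)) with (X t) by (extensionality v; auto).
    replace (Ds X (t + 2)) with (Ds X t) by (extensionality v; auto).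
    replace (U (t + 2)) with (U t) by (extensionality v; auto). reflexivity.
  - unfold corr. now rewrite pXs, ps, pUs.
Qed.

Lemma sm_fcorr X U : sm X -> sm U -> (forall t, gdet (X t) (wt (Ds X t)) 0 1 <> 0) -> sm (fcorr X U).
Proof.
  intros SX SU N. destruct (sm_Ds X SX) as [SD _].
  unfold fcorr, corr, cc1, cc2, gc1, gc2, m0, m1, m2, wt.
  smt; try (intros t _; apply N).
  all: unfold gdet, m0, m1, m2, wt; smt.
Qed.

Lemma Ds_fcorr X U t s : sm X -> sm U -> Ds X t s = 0 -> Ds (fcorr X U) t s = Ds U t s.
Proof.
  intros SX SU E. destruct (sm_Ds X SX) as [SD DX]. destruct (sm_Ds _ SD) as [_ DD].
  destruct (sm_Ds U SU) as [_ DU].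
  apply is_derive_unique. unfold fcorr, corr.
  assert (e1 : ex_derive (X t) s) by (eexists; apply DX).
  assert (e2 : ex_derive (Ds X t) s) by (eexists; apply DD).
  assert (e3 : ex_derive (U t) s) by (eexists; apply DU).
  auto_derive; auto. rewrite E. unfold Ds. change (fun x : R => U t x) with (U t). ring.
Qed.

(** By Rolle's theorem Y' vanishes inside the arc, and there the immersion property forces X' to be
    nonzero. *)
Lemma arc_nonconst X Y t a b : immersed_family X Y -> a < b -> Y t a = Y t b ->
  exists s, a < s < b /\ Ds X t s <> 0.
Proof.
  intros (_ & SY & _ & _ & N) Hab E.
  destruct (MVT_cor2 (Y t) (Ds Y t) a b Hab) as (c & Ec & Hc).
  - intros u _. apply is_derive_Reals, (sm_Ds Y SY).
  - exists c. split; auto. destruct (N t c) as [H|H]; auto. exfalso. apply H.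
    apply Rmult_eq_reg_r with (b - a); lra.
Qed.

Lemma family_det X Y : immersed_family X Y -> forall t, 0 < gdet (X t) (wt (Ds X t)) 0 1.
Proof.
  intros F t.
  assert (N : exists s, 0 < s < 1 /\ Ds X t s <> 0).
  { apply (arc_nonconst X Y); auto; [lra|]. destruct F as (_ & _ & _ & [_ pY] & _).
    rewrite <- (pY t 0). f_equal. ring. }
  destruct F as (SX & _).
  destruct (sm_Ds X SX) as [SD DX].
  apply wt_det_pos; auto. intros; now apply sm_continuous.
Qed.

Lemma family_corr X Y : immersed_family X Y -> immersed_family X (fcorr X Y) /\ closed_family X (fcorr X Y).
Proof.
  intros F. assert (D := family_det X Y F).
  assert (D' : forall t, gdet (X t) (wt (Ds X t)) 0 1 <> 0) by (intros t; specialize (D t); lra).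
  destruct F as (SX & SY & pX & pY & N).
  destruct (sm_Ds X SX) as [SD _].
  split.
  - split; [auto|split; [now apply sm_fcorr|split; [auto|split; [now apply dper_fcorr|]]]].
    intros t s. destruct (Req_dec (Ds X t s) 0) as [E|E]; auto. right.
    rewrite Ds_fcorr by auto. destruct (N t s) as [H|H]; [contradiction|exact H].
  - intros t. apply corr_closed; auto; intros; now apply sm_continuous.
Qed.

(** ** Loops and their moments *)

(** Horizontality gives y dx = dz and x y dx = x dz = d(xz) - z dx = d(xz - w). *)
Lemma loop_moments g : horizontal_loop g ->
  (forall a b, RInt (fun s => cy (g s) * Derive (fun u => cx (g u)) s) a b = cz (g b) - cz (g a)) /\
  (forall a b, RInt (fun s => cx (g s) * (cy (g s) * Derive (fun u => cx (g u)) s)) a b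
     = (cx (g b) * cz (g b) - cw (g b)) - (cx (g a) * cz (g a) - cw (g a))).
Proof.
  intros [[pg [[sx [sy [sz sw]]] _]] hg].
  assert (Dx := fun s => proj2 (sm_Ds _ (sm_smooth _ sx)) 0 s).
  assert (Dz := fun s => proj2 (sm_Ds _ (sm_smooth _ sz)) 0 s).
  assert (Dw := fun s => proj2 (sm_Ds _ (sm_smooth _ sw)) 0 s).
  assert (Sx := sm_smooth _ sx). assert (Sy := sm_smooth _ sy).
  assert (SDx := sm_of_smooth_Derive _ sx).
  unfold Ds in *.
  assert (Hz : forall s, Derive (fun u => cz (g u)) s = cy (g s) * Derive (fun u => cx (g u)) s).
  { intros s. destruct (hg s) as [H _]. unfold velocity in H. unfold cx, cz in *; simpl in H. lra. }
  assert (Hw : forall s, Derive (fun u => cw (g u)) s = cz (g s) * Derive (fun u => cx (g u)) s).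
  { intros s. destruct (hg s) as [_ H]. unfold velocity in H. unfold cx, cz, cw in *; simpl in H. lra. }
  split; intros a b.
  - apply (ftc (fun s => cz (g s))).
    + intros s. rewrite <- Hz. apply Dz.
    + intros s. exact (sm_continuous _ (sm_mult _ _ Sy SDx) 0 s).
  - apply (ftc (fun s => cx (g s) * cz (g s) - cw (g s))).
    + intros s.
      assert (e1 : ex_derive (fun u => cx (g u)) s) by (eexists; apply Dx).
      assert (e2 : ex_derive (fun u => cz (g u)) s) by (eexists; apply Dz).
      assert (e3 : ex_derive (fun u => cw (g u)) s) by (eexists; apply Dw).
      replace (cx (g s) * (cy (g s) * Derive (fun u => cx (g u)) s)) with
        ((Derive (fun u => cx (g u)) s * cz (g s) + cx (g s) * Derive (fun u => cz (g u)) s)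
          - Derive (fun u => cw (g u)) s) by (rewrite Hz, Hw; ring).
      apply (is_derive_minus (fun s => cx (g s) * cz (g s)) (fun s => cw (g s))); [|apply Dw].
      apply (is_derive_mult (fun s => cx (g s)) (fun s => cz (g s)));
        [apply Dx|apply Dz|intros; apply Rmult_comm].
    + intros s. exact (sm_continuous _ (sm_mult _ _ Sx (sm_mult _ _ Sy SDx)) 0 s).
Qed.

(** The equality case of the triangle inequality: a weighted mean of unit vectors has length 1 only
    if they all coincide. The nonnegative function r (1 - C cos th - S sin th) has integral zero, so
    the direction is constant, and then so is the angle since its derivative vanishes. *)
Lemma unit_mean_const (th r : R -> R) C S : sm (fun _ s => th s) -> sm (fun _ s => r s) ->
  (forall s, 0 < r s) -> C * C + S * S = 1 ->
  RInt (fun s => r s * cos (th s)) 0 1 = C * RInt r 0 1 ->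
  RInt (fun s => r s * sin (th s)) 0 1 = S * RInt r 0 1 ->
  forall s, 0 <= s <= 1 -> th s = th 0.
Proof.
  intros St Sr Pr HCS EC ES.
  assert (ct : forall s, continuous th s) by (intros; apply (sm_continuous _ St 0)).
  assert (cr : forall s, continuous r s) by (intros; apply (sm_continuous _ Sr 0)).
  assert (cc : forall s, continuous (fun s => cos (th s)) s)
    by (intros; apply (sm_continuous _ (sm_cos _ St) 0)).
  assert (cs : forall s, continuous (fun s => sin (th s)) s)
    by (intros; apply (sm_continuous _ (sm_sin _ St) 0)).
  set (f := fun s => r s * (1 - C * cos (th s) - S * sin (th s))).
  assert (I : RInt f 0 1 = 0).
  { transitivity (RInt r 0 1 + ((- C) * RInt (fun s => r s * cos (th s)) 0 1 +
                   (- S) * RInt (fun s => r s * sin (th s)) 0 1)).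
    - rilin. unfold f; ring.
    - rewrite EC, ES. replace (RInt r 0 1) with ((C * C + S * S) * RInt r 0 1) at 1 by (rewrite HCS; ring).
      req. ring. }
  assert (Q : forall s, (cos (th s) - C) ^ 2 + (sin (th s) - S) ^ 2 = 2 * (1 - C * cos (th s) - S * sin (th s))).
  { intros s. generalize (sin2_cos2 (th s)). unfold Rsqr. intros E.
    transitivity ((sin (th s) * sin (th s) + cos (th s) * cos (th s)) + (C * C + S * S)
       - 2 * (C * cos (th s) + S * sin (th s))); [ring|]. rewrite E, HCS. ring. }
  assert (Z : forall s, 0 < s < 1 -> f s = 0).
  { apply RInt_zero_nonneg; auto.
    - intros s. unfold f. cont.
    - intros s _. unfold f. apply Rmult_le_pos; [left; auto|].
      specialize (Q s). generalize (pow2_ge_0 (cos (th s) - C)) (pow2_ge_0 (sin (th s) - S)). lra. }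
  assert (Z' : forall s, 0 < s < 1 -> cos (th s) = C /\ sin (th s) = S).
  { intros s Hs. specialize (Z s Hs). unfold f in Z. apply Rmult_integral in Z.
    destruct Z as [Z|Z]; [specialize (Pr s); lra|]. specialize (Q s). rewrite Z in Q.
    generalize (pow2_ge_0 (cos (th s) - C)) (pow2_ge_0 (sin (th s) - S)). intros G1 G2.
    assert (H1 : (cos (th s) - C) ^ 2 = 0) by lra. assert (H2 : (sin (th s) - S) ^ 2 = 0) by lra.
    rewrite <- Rsqr_pow2 in H1, H2. apply Rsqr_0_uniq in H1, H2. lra. }
  assert (Dth : forall s, is_derive th s (Ds (fun _ s => th s) 0 s)) by apply (sm_Ds _ St).
  assert (D0 : forall s, 0 < s < 1 -> Ds (fun _ s => th s) 0 s = 0).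
  { intros s Hs.
    assert (loc : forall F : R -> R, (forall s, 0 < s < 1 -> F s = F (1 / 2)) -> Derive F s = 0).
    { intros F HF. rewrite (Derive_ext_loc F (fun _ => F (1 / 2)) s); [apply Derive_const|].
      assert (P : 0 < Rmin s (1 - s)) by (apply Rmin_pos; lra).
      exists (mkposreal _ P). intros u Hu. apply HF.
      assert (Hu' : Rabs (u - s) < Rmin s (1 - s)) by exact Hu.
      apply Rabs_lt_between' in Hu'.
      generalize (Rmin_l s (1 - s)) (Rmin_r s (1 - s)). lra. }
    assert (DC : is_derive (fun s => cos (th s)) s (- sin (th s) * Ds (fun _ s => th s) 0 s)).
    { apply (is_derive_comp_R cos th); auto. apply is_derive_cos. }
    assert (DS : is_derive (fun s => sin (th s)) s (cos (th s) * Ds (fun _ s => th s) 0 s)).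
    { apply (is_derive_comp_R sin th); auto. apply is_derive_sin. }
    apply is_derive_unique in DC, DS.
    assert (A' : - sin (th s) * Ds (fun _ s => th s) 0 s = 0).
    { rewrite <- DC. apply loc. intros u Hu. rewrite (proj1 (Z' u Hu)). symmetry. apply Z'. lra. }
    assert (B' : cos (th s) * Ds (fun _ s => th s) 0 s = 0).
    { rewrite <- DS. apply loc. intros u Hu. rewrite (proj2 (Z' u Hu)). symmetry. apply Z'. lra. }
    destruct (Z' s Hs) as [E1 E2]. rewrite E1 in B'. rewrite E2 in A'.
    set (v := Ds (fun _ s => th s) 0 s) in *.
    transitivity ((C * C + S * S) * v); [rewrite HCS; ring|].
    transitivity (C * (C * v) - S * (- S * v)); [ring|]. rewrite A', B'. ring. }
  intros s Hs. symmetry. apply const_of_derive0; auto; try lra.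
  intros u Hu. rewrite <- (D0 u) by lra. auto.
Qed.

(** ** The Whitney-Graustein family *)

(** Subtracting a multiple of the speed rather than a constant makes the result vanish only where
    the unit tangent equals the weighted mean of all unit tangents, which [unit_mean_const]
    excludes. *)
Definition balanced (c : R -> R) (th r : R -> R) (s : R) : R :=
  r s * (c (th s) - RInt (fun u => r u * c (th u)) 0 1 / RInt r 0 1).

Lemma balanced_mean c th r : (forall s, continuous (fun s => c (th s)) s) ->
  (forall s, continuous r s) -> RInt r 0 1 <> 0 -> RInt (balanced c th r) 0 1 = 0.
Proof.
  intros Cc Cr N. set (m := RInt (fun u => r u * c (th u)) 0 1 / RInt r 0 1).
  transitivity (RInt (fun u => r u * c (th u)) 0 1 + (- m) * RInt r 0 1).
  - rilin. unfold balanced. fold m. ring.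
  - req. unfold m. field. exact N.
Qed.

(** A closed curve already has velocity of mean zero, so at both ends of the family the construction
    returns the given curve. *)
Lemma balanced_end c th r h : smooth h -> periodic h -> (forall s, Derive h s = r s * c (th s)) ->
  forall s, h 0 + RInt (balanced c th r) 0 s = h s.
Proof.
  intros Sh ph D s.
  assert (Dh := proj2 (sm_Ds _ (sm_smooth _ Sh)) 0). unfold Ds in Dh.
  assert (C : forall s, continuous (Derive h) s)
    by (intros; apply (sm_continuous _ (sm_of_smooth_Derive _ Sh) 0)).
  assert (E : RInt (fun u => r u * c (th u)) 0 1 = 0).
  { rewrite <- (RInt_ext (Derive h)) by (intros; apply D).
    rewrite (ftc h (Derive h)) by auto. generalize (ph 0). rewrite Rplus_0_l. lra. }
  rewrite (RInt_ext _ (Derive h)).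
  - rewrite (ftc h (Derive h)) by auto. lra.
  - intros u _. unfold balanced. rewrite E, D. unfold Rdiv. req. ring.
Qed.

Lemma RInt_pos_fun r : (forall s, continuous r s) -> (forall s, 0 < r s) -> 0 < RInt r 0 1.
Proof. intros C P. apply RInt_gt_0; auto; lra. Qed.

Lemma whitney_graustein g0 g1 : horizontal_loop g0 -> horizontal_loop g1 -> rot g0 = rot g1 ->
  exists X Y, immersed_family X Y /\
    (forall s, X 0 s = cx (g0 s)) /\ (forall s, Y 0 s = cy (g0 s)) /\
    (forall s, X 1 s = cx (g1 s)) /\ (forall s, Y 1 s = cy (g1 s)).
Proof.
  intros H0 H1 E.
  assert (W0 := proj2 (rotP g0 _ H0) eq_refl).
  assert (W1 := proj2 (rotP g1 _ H1) eq_refl). rewrite <- E in W1.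
  set (k := rot g0) in *. clearbody k. clear E.
  destruct (smooth_angle g0 k H0 W0) as (th0 & r0 & St0 & Sr0 & P0 & q0 & p0 & A0 & B0).
  destruct (smooth_angle g1 k H1 W1) as (th1 & r1 & St1 & Sr1 & P1 & q1 & p1 & A1 & B1).
  (* With a constant angle the velocity of a closed curve would be a positive function times a fixed
     unit vector, and its integral could not vanish. *)
  assert (nc : forall g th r, horizontal_loop g -> sm (fun _ s => th s) -> sm (fun _ s => r s) ->
     (forall s, 0 < r s) -> (forall s, Derive (fun u => cx (g u)) s = r s * cos (th s)) ->
     (forall s, Derive (fun u => cy (g u)) s = r s * sin (th s)) ->
     exists s, 0 <= s <= 1 /\ th s <> th 0).
  { intros g th r [[pg [[sx [sy _]] _]] _] St Sr P A B. apply NNPP. intros N.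
    assert (Cst : forall s, 0 <= s <= 1 -> th s = th 0).
    { intros s Hs. apply NNPP. intros F. apply N. now exists s. }
    assert (cr : forall s, continuous r s) by (intros; apply (sm_continuous _ Sr 0)).
    assert (G : forall (h c : R -> R), smooth h -> periodic h ->
       (forall s, Derive h s = r s * c (th s)) -> c (th 0) = 0).
    { intros h c Sh ph D. assert (Dh := proj2 (sm_Ds _ (sm_smooth _ Sh)) 0). unfold Ds in Dh.
      assert (I : RInt (fun s => c (th 0) * r s) 0 1 = h 1 - h 0).
      { rewrite (RInt_ext _ (Derive h)).
        - apply ftc; auto. intros; apply (sm_continuous _ (sm_of_smooth_Derive _ Sh) 0).
        - intros s Hs. rewrite Rmin_left, Rmax_right in Hs by lra.
          rewrite D, (Cst s) by lra. req. ring. }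
      rewrite RIscal in I by auto. generalize (ph 0). rewrite Rplus_0_l. intros Eh.
      assert (Q := RInt_pos_fun r cr P). 
      assert (c (th 0) * RInt r 0 1 = 0) by lra.
      apply Rmult_integral in H. destruct H; auto. lra. }
    assert (G1 := G _ cos sx (fun s => f_equal cx (pg s)) A).
    assert (G2 := G _ sin sy (fun s => f_equal cy (pg s)) B).
    generalize (sin2_cos2 (th 0)). rewrite G1, G2. unfold Rsqr. lra. }
  assert (N0 := nc g0 th0 r0 H0 St0 Sr0 P0 A0 B0).
  assert (N1 := nc g1 th1 r1 H1 St1 Sr1 P1 A1 B1). clear nc.
  assert (c0 : forall s, continuous th0 s) by (intros; apply (sm_continuous _ St0 0)).
  destruct (angle_detour th0 th1 k c0 p0 p1 N0 N1) as (phi & Ephi & pphi & N).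
  assert (Sphi : sm (fun _ s => phi s)).
  { destruct Ephi as [-> | ->]; [apply sm_const|]. now apply (sm_mult (fun _ s => th0 s) (fun _ s => th0 s)). }
  set (th := fun p s => (1 - p) * th0 s + p * th1 s + p * (1 - p) * phi s).
  set (r := fun p s => (1 - p) * r0 s + p * r1 s).
  assert (Sth : sm (fun t s => th (rho t) s)) by (unfold th; smt).
  assert (Sr : sm (fun t s => r (rho t) s)) by (unfold r; smt).
  assert (Pr : forall t s, 0 < r (rho t) s).
  { intros t s. unfold r. generalize (rho_range t) (P0 s) (P1 s). intros. nra. }
  assert (Cr : forall t s, continuous (r (rho t)) s) by (intros; apply (sm_continuous _ Sr)).
  assert (PR : forall t, 0 < RInt (r (rho t)) 0 1) by (intros; apply RInt_pos_fun; auto).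
  assert (Sc : forall c, c = cos \/ c = sin -> sm (fun t s => c (th (rho t) s))).
  { intros c [-> | ->]; [now apply sm_cos|now apply sm_sin]. }
  (* The equality of the rotation numbers enters here: both angles, hence all interpolations, grow
     by the same multiple of 2 PI over a period. *)
  assert (pc : forall c, c = cos \/ c = sin -> forall p, periodic (fun s => c (th p s))).
  { intros c Hc p s. replace (th p (s + 1)) with (th p s + 2 * PI * IZR k).
    - apply shift_Z. intros u. destruct Hc as [-> | ->].
      + replace (u + 2 * PI) with (u + 2 * INR 1 * PI) by (simpl; ring). apply cos_period.
      + replace (u + 2 * PI) with (u + 2 * INR 1 * PI) by (simpl; ring). apply sin_period.
    - unfold th. rewrite p0, p1, pphi. ring. }
  assert (pr : forall p, periodic (r p)).
  { intros p s. unfold r. now rewrite q0, q1. }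
  set (v := fun c t s => balanced c (th (rho t)) (r (rho t)) s).
  assert (Sv : forall c, c = cos \/ c = sin -> sm (v c)).
  { intros c Hc. unfold v, balanced. assert (Scc := Sc c Hc). 
    smt; try (intros t _; specialize (PR t); lra). }
  (* [c] is cos for the first coordinate and sin for the second; [i0] and [i1] are the initial
     values to be interpolated. *)
  set (Z := fun c (i0 i1 : R) t s => (1 - rho t) * i0 + rho t * i1 + RInt (v c t) 0 s).
  assert (SZ : forall c i0 i1, c = cos \/ c = sin -> sm (Z c i0 i1)).
  { intros c i0 i1 Hc. assert (Svc := Sv c Hc). unfold Z.
    apply (sm_plus (fun t s => (1 - rho t) * i0 + rho t * i1) (fun t s => RInt (v c t) 0 s)); [smt|].
    now apply sm_int. }
  assert (DZ : forall c i0 i1 t s, c = cos \/ c = sin -> Ds (Z c i0 i1) t s = v c t s).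
  { intros c i0 i1 t s Hc. apply is_derive_unique. unfold Z.
    rewrite <- (Rplus_0_l (v c t s)).
    apply (is_derive_plus (fun _ => (1 - rho t) * i0 + rho t * i1) (fun s => RInt (v c t) 0 s)).
    - apply is_derive_cst.
    - apply is_derive_RInt_sm. now apply Sv. }
  assert (pZ : forall c i0 i1, c = cos \/ c = sin -> dper (Z c i0 i1)).
  { intros c i0 i1 Hc. split; intros t s; unfold Z.
    - unfold v. now rewrite rho_per.
    - f_equal. assert (Svc := Sv c Hc).
      rewrite (prim_shift (fun s => RInt (v c t) 0 s) (v c t)).
      + rewrite RInt_point. unfold v at 2.
        change (fun s => balanced c (th (rho t)) (r (rho t)) s) with (balanced c (th (rho t)) (r (rho t))).
        rewrite balanced_mean.
        * unfold zero; simpl. ring.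
        * intros u. apply (sm_continuous _ (Sc c Hc)).
        * auto.
        * specialize (PR t). lra.
      + intros u. now apply is_derive_RInt_sm.
      + intros u. unfold v, balanced. rewrite pr. f_equal. f_equal. apply (pc c Hc). }
  assert (lc : cos = cos \/ cos = sin) by auto. assert (ls : sin = cos \/ sin = sin) by auto.
  exists (Z cos (cx (g0 0)) (cx (g1 0))), (Z sin (cy (g0 0)) (cy (g1 0))).
  split; [|].
  - split; [auto|split; [auto|split; [auto|split; [auto|]]]].
    intros t s. rewrite !DZ by auto. apply not_and_or. intros [V1 V2].
    unfold v, balanced in V1, V2. specialize (Pr t). specialize (PR t).
    assert (Q := Pr s). apply Rmult_integral in V1, V2.
    destruct V1 as [V1|V1]; [lra|]. destruct V2 as [V2|V2]; [lra|].
    (* A zero velocity at [s] makes the unit vector of angle [th (rho t) s] the weighted mean of all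
       the others, so the angle would be constant, contrary to the choice of [phi]. *)
    destruct (N (rho t)) as (u & Hu & Nu). apply Nu. clear Nu.
    assert (quo : forall M Q : R, Q <> 0 -> M = M / Q * Q) by (intros; field; auto).
    apply (unit_mean_const (th (rho t)) (r (rho t)) (cos (th (rho t) s)) (sin (th (rho t) s))); auto.
    + assert (T : sm (fun _ s => th (rho t) s)) by (unfold th; smt). exact T.
    + assert (T : sm (fun _ s => r (rho t) s)) by (unfold r; smt). exact T.
    + generalize (sin2_cos2 (th (rho t) s)). unfold Rsqr. lra.
    + apply Rminus_diag_uniq in V1. rewrite V1. apply quo. lra.
    + apply Rminus_diag_uniq in V2. rewrite V2. apply quo. lra.
  - assert (E0t : th 0 = th0) by (extensionality s; unfold th; ring).
    assert (E0r : r 0 = r0) by (extensionality s; unfold r; ring).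
    assert (E1t : th 1 = th1) by (extensionality s; unfold th; ring).
    assert (E1r : r 1 = r1) by (extensionality s; unfold r; ring).
    destruct H0 as [[pg0 [[sx0 [sy0 _]] _]] _], H1 as [[pg1 [[sx1 [sy1 _]] _]] _].
    unfold Z, v. rewrite rho_0, rho_1, E0t, E0r, E1t, E1r.
    split; [|split; [|split]]; intros s.
    + rewrite <- (balanced_end cos th0 r0 _ sx0 (fun s => f_equal cx (pg0 s)) A0 s). f_equal. ring.
    + rewrite <- (balanced_end sin th0 r0 _ sy0 (fun s => f_equal cy (pg0 s)) B0 s). f_equal. ring.
    + rewrite <- (balanced_end cos th1 r1 _ sx1 (fun s => f_equal cx (pg1 s)) A1 s). f_equal. ring.
    + rewrite <- (balanced_end sin th1 r1 _ sy1 (fun s => f_equal cy (pg1 s)) B1 s). f_equal. ring.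
Qed.

(** ** Closed families and the double points of their lifts *)

Definition double_point (x y xs : R -> R) (s u : R) : Prop :=
  x s = x u /\ y s = y u /\ RInt (fun v => y v * xs v) s u = 0 /\
  RInt (fun v => x v * (y v * xs v)) s u = 0.

Definition simple_at (X Y : R -> R -> R) (t : R) : Prop :=
  forall s u, 0 <= s < u -> u <= 1 -> u - s < 1 -> ~ double_point (X t) (Y t) (Ds X t) s u.

Lemma lift_isotopy g0 g1 X Y : horizontal_loop g0 -> horizontal_loop g1 ->
  sm X -> sm Y -> dper X -> dper Y -> closed_family X Y ->
  (forall t s, 0 <= t <= 1 -> Ds X t s <> 0 \/ Ds Y t s <> 0) ->
  (forall t s u, 0 <= t <= 1 -> 0 <= s < u -> u < 1 -> ~ double_point (X t) (Y t) (Ds X t) s u) ->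
  (forall s, X 0 s = cx (g0 s)) -> (forall s, Y 0 s = cy (g0 s)) ->
  (forall s, X 1 s = cx (g1 s)) -> (forall s, Y 1 s = cy (g1 s)) ->
  horizontally_isotopic g0 g1.
Proof.
  intros H0 H1 SX SY [_ pX] [_ pY] Cl Im Si EX0 EY0 EX1 EY1.
  destruct (sm_Ds X SX) as [SD DX].
  assert (pD : forall t s, Ds X t (s + 1) = Ds X t s).
  { intros t. apply (periodic_Derive (X t)). exact (pX t). }
  set (a := fun t s => Y t s * Ds X t s). set (b := fun t s => X t s * (Y t s * Ds X t s)).
  assert (Sa : sm a) by (unfold a; smt). assert (Sb : sm b) by (unfold b; smt).
  set (Zc := fun t s => (1 - rho t) * cz (g0 0) + rho t * cz (g1 0) + RInt (a t) 0 s).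
  (* Since d(xz - w) = x y dx, the fourth coordinate is xz minus a primitive of x y dx, plus the
     interpolated initial values of w - xz. *)
  set (k0 := cw (g0 0) - cx (g0 0) * cz (g0 0)). set (k1 := cw (g1 0) - cx (g1 0) * cz (g1 0)).
  set (Wc := fun t s => X t s * Zc t s - RInt (b t) 0 s + ((1 - rho t) * k0 + rho t * k1)).
  assert (SZ : sm Zc).
  { unfold Zc. apply (sm_plus (fun t s => (1 - rho t) * cz (g0 0) + rho t * cz (g1 0))); [smt|now apply sm_int]. }
  assert (SW : sm Wc).
  { unfold Wc. apply (sm_plus (fun t s => X t s * Zc t s - RInt (b t) 0 s)); [|smt].
    apply (sm_minus (fun t s => X t s * Zc t s)); [smt|now apply sm_int]. }
  assert (DZ : forall t s, is_derive (Zc t) s (a t s)).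
  { intros t s. unfold Zc. rewrite <- (Rplus_0_l (a t s)).
    apply (is_derive_plus (fun _ => (1 - rho t) * cz (g0 0) + rho t * cz (g1 0)) (fun s => RInt (a t) 0 s)).
    - apply is_derive_cst.
    - now apply is_derive_RInt_sm. }
  assert (DW : forall t s, is_derive (Wc t) s (Zc t s * Ds X t s)).
  { intros t s. unfold Wc.
    replace (Zc t s * Ds X t s) with ((Ds X t s * Zc t s + X t s * a t s) - b t s + 0)
      by (unfold a, b; ring).
    apply (is_derive_plus (fun s => X t s * Zc t s - RInt (b t) 0 s) (fun _ => (1 - rho t) * k0 + rho t * k1)).
    2: apply is_derive_cst.
    apply (is_derive_minus (fun s => X t s * Zc t s) (fun s => RInt (b t) 0 s)); [|now apply is_derive_RInt_sm].
    apply (is_derive_mult (X t) (Zc t)); auto. intros; apply Rmult_comm. }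
  assert (Ca : forall t s, continuous (a t) s) by (intros; now apply sm_continuous).
  assert (Cb : forall t s, continuous (b t) s) by (intros; now apply sm_continuous).
  assert (pa : forall t, periodic (a t)) by (intros t s; unfold a; now rewrite pY, pD).
  assert (pb : forall t, periodic (b t)) by (intros t s; unfold b; now rewrite pX, pY, pD).
  assert (pI : forall f : R -> R -> R, sm f -> (forall t, periodic (f t)) -> (forall t, RInt (f t) 0 1 = 0) ->
     forall t s, RInt (f t) 0 (s + 1) = RInt (f t) 0 s).
  { intros f Sf pf If t s.
    rewrite (prim_shift (fun s => RInt (f t) 0 s) (f t)); auto.
    - rewrite RInt_point, If. unfold zero; simpl. ring.
    - intros u. now apply is_derive_RInt_sm. }
  assert (pZ : forall t, periodic (Zc t)).
  { intros t s. unfold Zc. now rewrite (pI a Sa pa (fun u => proj1 (Cl u))). }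
  assert (pW : forall t, periodic (Wc t)).
  { intros t s. unfold Wc. now rewrite (pI b Sb pb (fun u => proj2 (Cl u))), pX, pZ. }
  assert (ends : forall t g s, horizontal_loop g -> (forall s, X t s = cx (g s)) ->
     (forall s, Y t s = cy (g s)) -> (1 - rho t) * cz (g0 0) + rho t * cz (g1 0) = cz (g 0) ->
     (1 - rho t) * k0 + rho t * k1 = cw (g 0) - cx (g 0) * cz (g 0) ->
     (X t s, Y t s, Zc t s, Wc t s) = g s).
  { intros t g s Hg EX EY Ez Ew. destruct (loop_moments g Hg) as [M1 M2].
    assert (ED : Ds X t = Derive (fun u => cx (g u))).
    { extensionality u. apply Derive_ext. auto. }
    assert (Ea : RInt (a t) 0 s = cz (g s) - cz (g 0)).
    { rewrite <- M1. apply RInt_ext. intros u _. unfold a. now rewrite EY, ED. }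
    assert (Eb : RInt (b t) 0 s = cx (g s) * cz (g s) - cw (g s) - (cx (g 0) * cz (g 0) - cw (g 0))).
    { rewrite <- M2. apply RInt_ext. intros u _. unfold b. now rewrite EX, EY, ED. }
    unfold Wc, Zc. rewrite Ez, Ew, Ea, Eb, EX, EY.
    destruct (g s) as [[[x y] z] w]. unfold cx, cy, cz, cw; simpl.
    f_equal; [f_equal|]; ring. }
  exists (fun t s => (X t s, Y t s, Zc t s, Wc t s)).
  split; [|split; [|split]].
  - split; [|split; [|split]]; now apply sm_smooth_on.
  - intros t Ht. split; [split; [|split; [|split]]|].
    + intros s. now rewrite pX, pY, pZ, pW.
    + split; [|split; [|split]].
      * exact (sm_smooth_r X t SX).
      * exact (sm_smooth_r Y t SY).
      * exact (sm_smooth_r Zc t SZ).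
      * exact (sm_smooth_r Wc t SW).
    + intros s V. destruct (Im t s Ht) as [N|N]; apply N.
      * exact (f_equal cx V).
      * exact (f_equal cy V).
    + intros s u Esu.
      assert (E1 : X t s = X t u) by exact (f_equal cx Esu).
      assert (E2 : Y t s = Y t u) by exact (f_equal cy Esu).
      assert (E3 : Zc t s = Zc t u) by exact (f_equal cz Esu).
      assert (E4 : Wc t s = Wc t u) by exact (f_equal cw Esu). clear Esu.
      destruct (period_reduce 1 s Rlt_0_1) as [i Hi], (period_reduce 1 u Rlt_0_1) as [j Hj].
      assert (Sh : forall (f : R -> R) v l, periodic f -> f v = f (v + 1 * IZR l)).
      { intros f v l pf. symmetry. now apply shift_Z. }
      rewrite (Sh (X t) s i), (Sh (X t) u j) in E1 by exact (pX t).
      rewrite (Sh (Y t) s i), (Sh (Y t) u j) in E2 by exact (pY t).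
      rewrite (Sh (Zc t) s i), (Sh (Zc t) u j) in E3 by exact (pZ t).
      rewrite (Sh (Wc t) s i), (Sh (Wc t) u j) in E4 by exact (pW t).
      set (s' := s + 1 * IZR i) in *. set (u' := u + 1 * IZR j) in *.
      assert (dp : forall p q, X t p = X t q -> Y t p = Y t q -> Zc t p = Zc t q -> Wc t p = Wc t q ->
        double_point (X t) (Y t) (Ds X t) p q).
      { intros p q F1 F2 F3 F4. split; [auto|split; [auto|]].
        assert (K3 := RIchasles (a t) 0 p q (Ca t)). assert (K4 := RIchasles (b t) 0 p q (Cb t)).
        unfold Wc in F4. rewrite <- F1, <- F3 in F4. unfold Zc in F3.
        unfold a in K3 at 2. unfold b in K4 at 2. split; lra. }
      destruct (Rtotal_order s' u') as [L|[L|L]].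
      * exfalso. apply (Si t s' u'); try lra; auto.
      * exists (i - j)%Z. unfold s', u' in L. rewrite minus_IZR. lra.
      * exfalso. apply (Si t u' s'); try lra; auto.
    + intros s. unfold engel, velocity; simpl. unfold cx, cy, cz, cw; simpl.
      assert (Ez := is_derive_unique _ _ _ (DZ t s)). assert (Ew := is_derive_unique _ _ _ (DW t s)).
      change (Derive (fun u => Zc t u) s) with (Derive (Zc t) s).
      change (Derive (fun u => Wc t u) s) with (Derive (Wc t) s).
      change (Derive (fun u => X t u) s) with (Ds X t s).
      rewrite Ez, Ew. unfold a. split; ring.
  - intros s. apply (ends 0 g0 s); auto; unfold k0; rewrite rho_0; ring.
  - intros s. apply (ends 1 g1 s); auto; unfold k1; rewrite rho_1; ring.
Qed.

Lemma loop_simple g X Y t : horizontal_loop g -> (forall s, X t s = cx (g s)) ->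
  (forall s, Y t s = cy (g s)) -> simple_at X Y t.
Proof.
  intros Hg EX EY s u Hs Hu Hsu (D1 & D2 & D3 & D4).
  assert (ED : Ds X t = Derive (fun u => cx (g u))) by (extensionality v; apply Derive_ext; auto).
  assert (FX : X t = fun s => cx (g s)) by (extensionality v; auto).
  assert (FY : Y t = fun s => cy (g s)) by (extensionality v; auto).
  rewrite ED, FX, FY in *.
  destruct (loop_moments g Hg) as [M1 M2]. rewrite M1 in D3. rewrite M2 in D4.
  destruct Hg as [(_ & _ & _ & inj) _].
  destruct (inj s u) as [k Hk].
  - destruct (g s) as [[[x y] z] w], (g u) as [[[x' y'] z'] w'].
    unfold cx, cy, cz, cw in *; simpl in *.
    assert (z = z') by lra. subst. assert (w = w') by lra. now subst.
  - assert (0 < IZR k < 1) by lra.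
    assert (0 < k < 1)%Z by (split; apply lt_IZR; lra). lia.
Qed.

Lemma closed_end g X Y t : horizontal_loop g -> (forall s, X t s = cx (g s)) ->
  (forall s, Y t s = cy (g s)) ->
  RInt (fun s => Y t s * Ds X t s) 0 1 = 0 /\ RInt (fun s => X t s * (Y t s * Ds X t s)) 0 1 = 0.
Proof.
  intros Hg EX EY.
  assert (ED : Ds X t = Derive (fun u => cx (g u))) by (extensionality v; apply Derive_ext; auto).
  assert (FX : X t = fun s => cx (g s)) by (extensionality v; auto).
  assert (FY : Y t = fun s => cy (g s)) by (extensionality v; auto).
  rewrite ED, FX, FY in *.
  destruct (loop_moments g Hg) as [M1 M2]. rewrite M1, M2.
  destruct Hg as [[pg _] _]. assert (P := pg 0). rewrite Rplus_0_l in P. rewrite P.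
  split; req; ring.
Qed.

(** * Functions dual to the double point equations *)

(** Each sine changes sign when s increases by 1, so the product is 1-periodic; it is positive on
    the arc from a to b and negative on the complementary arc. Composed with [flat 0], it and its
    opposite give smooth cut-offs for the two arcs. *)
Definition arc (a b s : R) : R := sin (PI * (s - a)) * sin (PI * (b - s)).

Lemma arc_per a b s : arc a b (s + 1) = arc a b s.
Proof.
  unfold arc. replace (PI * (s + 1 - a)) with (PI * (s - a) + PI) by ring.
  rewrite neg_sin. replace (PI * (b - s)) with (PI * (b - (s + 1)) + PI) by ring.
  rewrite neg_sin. ring.
Qed.

Lemma arc_pos a b s : a < s < b -> b < a + 1 -> 0 < arc a b s.
Proof.
  intros. assert (P := PI_RGT_0). unfold arc.
  apply Rmult_lt_0_compat; apply sin_gt_0; nra.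
Qed.

Lemma arc_neg a b s : b < s < a + 1 -> a < b -> arc a b s < 0.
Proof.
  intros. assert (P := PI_RGT_0). unfold arc.
  replace (PI * (b - s)) with (- (PI * (s - b))) by ring. rewrite sin_neg.
  assert (0 < sin (PI * (s - a))) by (apply sin_gt_0; nra).
  assert (0 < sin (PI * (s - b))) by (apply sin_gt_0; nra).
  nra.
Qed.

Lemma arc_ends a b : arc a b a = 0 /\ arc a b b = 0.
Proof. unfold arc. rewrite !Rminus_diag, !Rmult_0_r, sin_0. split; ring. Qed.

Lemma flat_pos u : 0 < u -> 0 < flat 0 u.
Proof.
  intros H. unfold flat. destruct (Rlt_dec 0 u); [|lra].
  simpl. rewrite Rinv_1, Rmult_1_l. apply exp_pos.
Qed.

Lemma flat_nonpos u : u <= 0 -> flat 0 u = 0.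
Proof. intros H. unfold flat. destruct (Rlt_dec 0 u); [lra|auto]. Qed.

Lemma flat_nonneg u : 0 <= flat 0 u.
Proof.
  destruct (Rlt_dec 0 u); [left; now apply flat_pos|]. rewrite flat_nonpos; lra.
Qed.

(** The factor x' in the ansatz makes the weight x'^2 chi, which is nonnegative, so the Gram
    determinant is positive. *)
Lemma arc_solve (x xs chi : R -> R) a b p q : (forall s, is_derive x s (xs s)) ->
  (forall s, continuous xs s) -> (forall s, continuous chi s) ->
  (forall s, 0 <= chi s) -> (forall s, a < s < b -> 0 < chi s) ->
  (exists s, a < s < b /\ xs s <> 0) ->
  exists c d, RInt (fun s => ((c + d * x s) * xs s * chi s) * xs s) a b = p /\
    RInt (fun s => x s * (((c + d * x s) * xs s * chi s) * xs s)) a b = q.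
Proof.
  intros D C Cc P0 P N.
  assert (Cx : forall s, continuous x s).
  { intros s. apply (ex_derive_continuous x). eexists; apply D. }
  set (w := fun s => xs s * xs s * chi s).
  assert (Cw : forall s, continuous w s) by (intros; unfold w; cont).
  assert (G : 0 < gdet x w a b).
  { apply gdet_pos; auto.
    - intros s _. unfold w. apply Rmult_le_pos; auto. nra.
    - intros c. destruct (nonconst_sq x xs a b D C N c) as (s & Hs & H).
      exists s. split; auto. unfold w.
      replace ((x s - c) ^ 2 * (xs s * xs s * chi s)) with (((x s - c) * xs s) ^ 2 * chi s) by ring.
      apply Rmult_lt_0_compat; auto. now apply pow2_gt_0. }
  destruct (gram_solve x w a b p q) as [E1 E2]; [lra|].
  set (c := gc1 x w a b p q) in *. set (d := gc2 x w a b p q) in *.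
  destruct (gram_int x w a b c d Cx Cw) as [F1 F2].
  exists c, d. rewrite <- E1 at 1. rewrite <- E2 at 1. rewrite <- F1, <- F2.
  split; rext; unfold w; ring.
Qed.

Lemma RInt_periodic (f : R -> R) a : (forall s, continuous f s) -> periodic f ->
  RInt f a (a + 1) = RInt f 0 1.
Proof.
  intros C p.
  assert (D : forall s, is_derive (fun s => RInt f 0 s) s (f s)).
  { intros s. apply (is_derive_RInt f _ 0); auto. apply filter_forall. intros x.
    apply (RInt_correct f 0 x). now apply ex_RInt_cont. }
  assert (E := prim_shift _ f D p a). cbv beta in E. rewrite RInt_point in E.
  assert (K := RIchasles f 0 a (a + 1) C). unfold zero in E; simpl in E. lra.
Qed.

(** A cosine [ps0] produces the prescribed difference of values. A bump on each arc, vanishing at a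
    and b, then adjusts the integrals over that arc, with opposite targets on the two arcs. Thus the
    totals over the circle vanish, and the moment correction will leave [psi] unchanged. *)
Lemma dual_exists (X : R -> R -> R) t a b p1 p2 p3 : sm X -> dper X -> a < b < a + 1 ->
  (exists s, a < s < b /\ Ds X t s <> 0) -> (exists s, b < s < a + 1 /\ Ds X t s <> 0) ->
  exists psi : R -> R, sm (fun _ s => psi s) /\ periodic psi /\
    psi a - psi b = p1 /\
    RInt (fun s => psi s * Ds X t s) a b = p2 /\
    RInt (fun s => X t s * (psi s * Ds X t s)) a b = p3 /\
    RInt (fun s => psi s * Ds X t s) 0 1 = 0 /\
    RInt (fun s => X t s * (psi s * Ds X t s)) 0 1 = 0.
Proof.
  intros SX pX Hab N1 N2.
  destruct (sm_Ds X SX) as [SD DX]. destruct (dper_Ds X pX) as [_ pD]. destruct pX as [_ pX].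
  assert (Sx1 : sm (fun _ s => X t s)) by exact (sm_smooth _ (sm_smooth_r X t SX)).
  assert (Sx2 : sm (fun _ s => Ds X t s)) by exact (sm_smooth _ (sm_smooth_r _ t SD)).
  set (x := X t) in *. set (xs := Ds X t) in *.
  assert (Dx : forall s, is_derive x s (xs s)) by (intros; apply DX).
  assert (Cx : forall s, continuous x s) by (intros; now apply sm_continuous).
  assert (Cs : forall s, continuous xs s) by (intros; now apply sm_continuous).
  set (chA := fun s => flat 0 (arc a b s)). set (chB := fun s => flat 0 (- arc a b s)).
  assert (SA : sm (fun _ s => chA s)) by (unfold chA, arc; smt).
  assert (SB : sm (fun _ s => chB s)) by (unfold chB, arc; smt).
  assert (CA : forall s, continuous chA s) by (intros; apply (sm_continuous _ SA 0)).
  assert (CB : forall s, continuous chB s) by (intros; apply (sm_continuous _ SB 0)).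
  (* The difference of the values of cos (2 PI (s - a)) at a and b. *)
  set (h := 1 - cos (2 * PI * (b - a))).
  assert (Hh : h <> 0).
  { unfold h. intros E. destruct (cos_eq_1_2PI (2 * PI * (b - a))) as [k Hk]; [lra|].
    assert (P := PI_RGT_0). assert (b - a = IZR k) by (apply Rmult_eq_reg_l with (2 * PI); lra).
    assert (0 < k < 1)%Z by (split; apply lt_IZR; lra). lia. }
  set (ps0 := fun s => p1 / h * cos (2 * PI * (s - a))).
  assert (S0 : sm (fun _ s => ps0 s)) by (unfold ps0; smt).
  assert (C0 : forall s, continuous ps0 s) by (intros; apply (sm_continuous _ S0 0)).
  destruct (arc_solve x xs chA a b (p2 - RInt (fun s => ps0 s * xs s) a b)
     (p3 - RInt (fun s => x s * (ps0 s * xs s)) a b)) as (c & d & E1 & E2); auto.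
  { intros; apply flat_nonneg. }
  { intros; apply flat_pos, arc_pos; lra. }
  destruct (arc_solve x xs chB b (a + 1) (- p2 - RInt (fun s => ps0 s * xs s) b (a + 1))
     (- p3 - RInt (fun s => x s * (ps0 s * xs s)) b (a + 1))) as (c' & d' & E1' & E2'); auto.
  { intros; apply flat_nonneg. }
  { intros s Hs. apply flat_pos. assert (arc a b s < 0) by (apply arc_neg; lra). lra. }
  set (fA := fun s => (c + d * x s) * xs s * chA s) in *.
  set (fB := fun s => (c' + d' * x s) * xs s * chB s) in *.
  match type of E1 with _ = ?r => change (RInt (fun s => fA s * xs s) a b = r) in E1 end.
  match type of E2 with _ = ?r => change (RInt (fun s => x s * (fA s * xs s)) a b = r) in E2 end.
  match type of E1' with _ = ?r => change (RInt (fun s => fB s * xs s) b (a + 1) = r) in E1' end.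
  match type of E2' with _ = ?r => change (RInt (fun s => x s * (fB s * xs s)) b (a + 1) = r) in E2' end.
  assert (CfA : forall s, continuous fA s) by (intros; unfold fA; cont).
  assert (CfB : forall s, continuous fB s) by (intros; unfold fB; cont).
  set (psi := fun s => ps0 s + fA s + fB s).
  assert (Spsi : sm (fun _ s => psi s)) by (unfold psi, fA, fB; smt).
  assert (Cpsi : forall s, continuous psi s) by (intros; unfold psi; cont).
  assert (pA : forall s, fA (s + 1) = fA s).
  { intros s. unfold fA, chA. rewrite arc_per. unfold x, xs. now rewrite pX, pD. }
  assert (pB : forall s, fB (s + 1) = fB s).
  { intros s. unfold fB, chB. rewrite arc_per. unfold x, xs. now rewrite pX, pD. }
  assert (ppsi : periodic psi).
  { intros s. unfold psi. rewrite pA, pB. f_equal. f_equal. unfold ps0. f_equal.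
    replace (2 * PI * (s + 1 - a)) with (2 * PI * (s - a) + 2 * INR 1 * PI) by (simpl; ring).
    apply cos_period. }
  assert (split_int : forall k f g lo hi p, lo < hi -> (forall s, continuous k s) ->
    (forall s, continuous f s) -> (forall s, lo < s < hi -> g s = 0) ->
    (forall s, psi s = ps0 s + f s + g s) ->
    RInt (fun s => k s * (f s * xs s)) lo hi = p - RInt (fun s => k s * (ps0 s * xs s)) lo hi ->
    RInt (fun s => k s * (psi s * xs s)) lo hi = p).
  { intros k f g lo hi p L Ck Cf Z E I.
    transitivity (RInt (fun s => k s * (ps0 s * xs s)) lo hi + RInt (fun s => k s * (f s * xs s)) lo hi).
    - rewrite <- RIplus by (intros; cont). apply RInt_ext. intros s Hs.
      rewrite Rmin_left, Rmax_right in Hs by lra. rewrite E, Z by lra. req. ring.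
    - rewrite I. req. ring. }
  assert (unit_int : forall f lo hi, RInt (fun s => 1 * f s) lo hi = RInt f lo hi).
  { intros f lo hi. rext. ring. }
  assert (zB : forall s, a < s < b -> fB s = 0).
  { intros s Hs. unfold fB, chB. rewrite flat_nonpos; [ring|].
    assert (0 < arc a b s) by (apply arc_pos; lra). lra. }
  assert (zA : forall s, b < s < a + 1 -> fA s = 0).
  { intros s Hs. unfold fA, chA. rewrite flat_nonpos; [ring|].
    assert (arc a b s < 0) by (apply arc_neg; lra). lra. }
  assert (C1 : forall s : R, continuous (fun _ : R => 1) s) by (intros; apply continuous_const).
  assert (eA : forall s, psi s = ps0 s + fA s + fB s) by auto.
  assert (eB : forall s, psi s = ps0 s + fB s + fA s) by (intros; unfold psi; ring).
  assert (IA1 : RInt (fun s => psi s * xs s) a b = p2).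
  { rewrite <- unit_int. apply (split_int _ fA fB); auto; [lra|]. now rewrite !unit_int. }
  assert (IA2 : RInt (fun s => x s * (psi s * xs s)) a b = p3).
  { apply (split_int _ fA fB); auto. lra. }
  assert (IB1 : RInt (fun s => psi s * xs s) b (a + 1) = - p2).
  { rewrite <- unit_int. apply (split_int _ fB fA); auto; [lra|]. now rewrite !unit_int. }
  assert (IB2 : RInt (fun s => x s * (psi s * xs s)) b (a + 1) = - p3).
  { apply (split_int _ fB fA); auto. lra. }
  exists psi. split; [auto|split; [auto|split; [|split; [auto|split; [auto|split]]]]].
  - destruct (arc_ends a b) as [Ea Eb]. unfold psi, fA, fB, chA, chB.
    rewrite Ea, Eb, Ropp_0, flat_nonpos by lra. unfold ps0.
    rewrite Rminus_diag, Rmult_0_r, cos_0.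
    transitivity (p1 / h * h); [unfold h; ring|field; auto].
  - rewrite <- (RInt_periodic _ a), <- (RIchasles _ a b (a + 1)), IA1, IB1; try (intros; cont).
    + req; ring.
    + intros s. rewrite ppsi. unfold xs. now rewrite pD.
  - rewrite <- (RInt_periodic _ a), <- (RIchasles _ a b (a + 1)), IA2, IB2; try (intros; cont).
    + req; ring.
    + intros s. rewrite ppsi. unfold x, xs. now rewrite pD, pX.
Qed.

(** * Counting parameters *)

Module Counting.
Import all_boot.
Local Open Scope nat_scope.

Section Count.
Variables (K n' W : nat).
Hypothesis W_gt0 : 0 < W.
Let n := n'.+1.
Let T := {ffun 'I_K -> 'I_n}.

(** Padding by 0 turns a finite grid point into a function on all indices; 0 is an admissible value
    because [n] is a successor. *)
Definition ext (f : T) (k : nat) : nat := if insub k is Some i then f i : nat else 0.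

Lemma ext_lt f k : ext f k < n.
Proof. by rewrite /ext; case: insubP. Qed.

Lemma ext_ord f (i : 'I_K) : ext f i = f i.
Proof. by rewrite /ext valK. Qed.

(** An element of [P] is determined by its residues modulo W at the four indices of [J] and its
    values elsewhere; the map [code] records exactly these. *)
Lemma card_code (P : {set T}) (J : seq nat) : uniq J -> size J = 4 -> all (fun k => k < K) J ->
  (forall f g, f \in P -> g \in P -> (forall k, k \notin J -> ext f k = ext g k) ->
     (forall k, k \in J -> ext f k = ext g k %[mod W]) ->
     forall k, k \in J -> ext f k = ext g k) ->
  #|P| <= W ^ 4 * n ^ (K - 4).
Proof.
move=> uJ sJ aJ inj.
pose JS := [set i : 'I_K | (i : nat) \in J].
have cJ : #|JS| = 4.
  rewrite cardE -(size_map val) -sJ; apply: perm_size; apply: uniq_perm => //.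
    by rewrite map_inj_uniq ?enum_uniq //; apply: val_inj.
  move=> k; apply/mapP/idP => [[i]|kJ].
    by rewrite mem_enum inE => iJ ->.
  have kK : k < K by move/allP: aJ; apply.
  by exists (Ordinal kK); rewrite // mem_enum inE.
pose code (f : T) : T := [ffun k => if k \in JS then inord (f k %% W) else f k].
have codeJ f k : k \in JS -> code f k = f k %% W :> nat.
  move=> kJ; rewrite ffunE kJ inordK //.
  exact: leq_ltn_trans (leq_mod _ _) (ltn_ord _).
have codeN f k : k \notin JS -> code f k = f k by move=> kJ; rewrite ffunE (negbTE kJ).
have inj' : {in P &, injective code}.
  move=> f g fP gP E.
  have off k : k \notin J -> ext f k = ext g k.
    move=> kJ; rewrite /ext; case: insubP => // i _ ik.
    have iJ : i \notin JS by rewrite inE ik.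
    by rewrite -(codeN f) // E codeN.
  have on k : k \in J -> ext f k = ext g k %[mod W].
    move=> kJ; have kK : k < K by move/allP: aJ; apply.
    rewrite -[k]/(Ordinal kK : nat) !ext_ord -!codeJ ?E // inE //.
  have on' := inj f g fP gP off on.
  apply/ffunP => i; apply: val_inj; rewrite /= -!ext_ord.
  by case: (boolP ((i : nat) \in J)) => iJ; [apply: on'|apply: off].
rewrite -(card_in_imset inj').
pose F (k : 'I_K) : pred 'I_n := if k \in JS then (fun v : 'I_n => v < W) else predT.
have sub : code @: P \subset family F.
  apply/subsetP => h /imsetP [f fP ->]; apply/familyP => k; rewrite /F.
  by case: ifP => kJ //; rewrite unfold_in codeJ // ltn_pmod.
apply: leq_trans (subset_leq_card sub) _.
rewrite card_family foldrE big_map big_enum /= (bigID (mem JS)) /=.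
apply: leq_mul.
  rewrite -cJ -prod_nat_const; apply: leq_prod => k kJ.
  rewrite /F kJ.
  pose w (v : 'I_n) : 'I_W := Ordinal (ltn_pmod v W_gt0).
  rewrite (@eq_card _ _ [pred v : 'I_n | v < W]) //.
  have wI : {in [pred v : 'I_n | v < W] &, injective w}.
    move=> u v; rewrite !inE => uW vW [].
    by rewrite !modn_small // => /val_inj.
  by rewrite -(card_in_image wI) -[X in _ <= X](card_ord W) max_card.
have -> : K - 4 = #|~: JS| by rewrite cardsCs setCK card_ord cJ.
rewrite -[X in _ <= X]prod_nat_const.
have E i : (i \notin JS) = (i \in ~: JS) by rewrite [RHS]inE.
rewrite (eq_bigl _ _ E).
apply: leq_prod => k; rewrite inE => kJ.
by rewrite /F (negbTE kJ) (eq_card (B := {: 'I_n})) ?card_ord.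
Qed.

(** Union bound: n^3 cells with at most W^4 n^(K-4) bad parameters each give fewer than n^K in all,
    because W^4 < n. *)
Lemma good_exists (bad : 'I_n -> 'I_n -> 'I_n -> {set T}) : W ^ 4 < n -> 4 <= K ->
  (forall a b c, #|bad a b c| <= W ^ 4 * n ^ (K - 4)) ->
  exists f, forall a b c, f \notin bad a b c.
Proof.
move=> Wn K4 H.
pose U := \bigcup_(q : 'I_n * 'I_n * 'I_n) bad q.1.1 q.1.2 q.2.
have cU : #|U| < #|T|.
  apply: (@leq_ltn_trans (\sum_(q : 'I_n * 'I_n * 'I_n) #|bad q.1.1 q.1.2 q.2|)).
    rewrite /U; elim/big_ind2: _ => [|x1 A x2 B hA hB|//]; first by rewrite cards0.
    apply: leq_trans (leq_add hA hB). by rewrite cardsU leq_subr.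
  apply: (@leq_ltn_trans (\sum_(q : 'I_n * 'I_n * 'I_n) W ^ 4 * n ^ (K - 4))).
    by apply: leq_sum => q _.
  rewrite sum_nat_const !card_prod card_ffun !card_ord.
  have -> : n ^ K = n * n * n * n * n ^ (K - 4).
    by rewrite -[in LHS](subnK K4) expnD mulnC !expnS expn0 muln1 !mulnA.
  rewrite mulnA ltn_pmul2r ?expn_gt0 // ltn_pmul2l //.
have /subsetPn [f _ fU] : ~~ ([set: T] \subset U).
  by apply: contraL cU => /subset_leq_card; rewrite cardsT -leqNgt.
exists f => a b c; apply: contra fU => fb.
by apply/bigcupP; exists (a, b, c).
Qed.
End Count.

Lemma InE (k : nat) (J : list nat) : List.In k J <-> k \in J.
Proof.
elim: J => [|x J IH] /=; first by [].
rewrite inE IH; split=> [[->|->]|/orP [/eqP ->|]]; rewrite ?eqxx ?orbT //; [by left|by right].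
Qed.

Lemma NoDupE (J : list nat) : List.NoDup J -> uniq J.
Proof.
elim=> [|x l H _ IH] //=; rewrite IH andbT; apply/negP => /InE; exact: H.
Qed.

(* Two bad parameters of a cell that agree outside four coordinates are close in these: among
   the [n^K] parameters, each of the [n^3] cells makes only [O(n^(K-4))] of them bad. *)
Lemma good_parameter (K n W : nat) (bad : nat -> nat -> nat -> (nat -> nat) -> Prop) :
  lt (Nat.mul W (Nat.mul W (Nat.mul W W))) n -> lt 0 W -> le 4 K ->
  (forall a b c, lt a n -> lt b n -> lt c n ->
     exists J : list nat, List.NoDup J /\ List.length J = 4 /\ (forall k, List.In k J -> lt k K) /\
       forall om om', (forall k, lt (om k) n) -> (forall k, lt (om' k) n) ->
         bad a b c om -> bad a b c om' -> (forall k, ~ List.In k J -> om k = om' k) ->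
         (forall k, List.In k J -> om k = om' k \/ le (Nat.add (om k) W) (om' k) \/ le (Nat.add (om' k) W) (om k)) ->
         forall k, List.In k J -> om k = om' k) ->
  exists om, (forall k, lt (om k) n) /\
    forall a b c, lt a n -> lt b n -> lt c n -> ~ bad a b c om.
Proof.
rewrite !multE => /ltP Wn /ltP W0 /leP K4 H.
case: n Wn H => // n' Wn H.
have Wn' : W ^ 4 < n'.+1 by rewrite !expnS expn0 muln1.
pose badb (a b c : 'I_n'.+1) : {set {ffun 'I_K -> 'I_n'.+1}} :=
  [set f | if excluded_middle_informative (bad a b c (ext K n' f)) then true else false].
have badP a b c f : (f \in badb a b c) <-> bad a b c (ext K n' f).
  by rewrite inE; case: excluded_middle_informative.
have cnt a b c : #|badb a b c| <= W ^ 4 * n'.+1 ^ (K - 4).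
  have [J [/NoDupE uJ [sJ [aJ HJ]]]] := H a b c (ltP (ltn_ord a)) (ltP (ltn_ord b)) (ltP (ltn_ord c)).
  apply: (card_code K n' W W0 _ J) => //.
    by apply/allP => k /InE /aJ /ltP.
  move=> f g /badP fb /badP gb off on k /InE kJ.
  apply: (HJ _ _ _ _ fb gb _ _ k kJ).
  - by move=> i; apply/ltP; apply: ext_lt.
  - by move=> i; apply/ltP; apply: ext_lt.
  - by move=> i /InE/negP; apply: off.
  - move=> i /InE iJ; have := on i iJ.
    set u := ext K n' f i; set v := ext K n' g i.
    (* Congruent numbers are equal or at least W apart, which is the alternative that the hypothesis
       on [J] expects. *)
    case: (ltngtP u v) => uv E; last by left.
    + right; left; rewrite plusE; apply/leP; rewrite -(subnKC (ltnW uv)) leq_add2l.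
      apply: dvdn_leq; first by rewrite subn_gt0.
      by rewrite -(eqn_mod_dvd _ (ltnW uv)) E.
    + right; right; rewrite plusE; apply/leP; rewrite -(subnKC (ltnW uv)) leq_add2l.
      apply: dvdn_leq; first by rewrite subn_gt0.
      by rewrite -(eqn_mod_dvd _ (ltnW uv)) E.
have [f Hf] := good_exists K n' W badb Wn' K4 cnt.
exists (ext K n' f); split; first by move=> k; apply/ltP; apply: ext_lt.
move=> a b c /ltP an /ltP bn /ltP cn fb.
by have /negP := Hf (Ordinal an) (Ordinal bn) (Ordinal cn); apply; apply/badP.
Qed.

End Counting.

(** * Bounded Lipschitz functions of the parameters *)

(** The variables of the double point equations: the perturbation parameters, the time and two
    points of the circle. *)
Record pt := Pt { om : nat -> R; tt : R; ss : R; rr : R }.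

Fixpoint wd (K : nat) (u v : nat -> R) : R :=
  match K with O => 0 | S K => wd K u v + Rabs (u K - v K) end.

Definition dd (K : nat) (p q : pt) : R :=
  wd K (om p) (om q) + Rabs (tt p - tt q) + Rabs (ss p - ss q) + Rabs (rr p - rr q).

Definition small (e : R) (w : nat -> R) : Prop := forall k, Rabs (w k) <= e.

(* Arcs of the circle that start in [0, 1] stay in [0, 2]. *)
Definition dom (e : R) (p : pt) : Prop :=
  small e (om p) /\ 0 <= ss p <= 2 /\ 0 <= rr p <= 2.

(** Boundedness is included because products of Lipschitz functions need it. One constant for both
    properties suffices. *)
Definition BL (K : nat) (e : R) (F : pt -> R) : Prop := exists C, 0 <= C /\
  (forall p, dom e p -> Rabs (F p) <= C) /\
  (forall p q, dom e p -> dom e q -> Rabs (F p - F q) <= C * dd K p q).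

Lemma wd_nonneg K u v : 0 <= wd K u v.
Proof. induction K as [|K IH]; simpl; [lra|]. generalize (Rabs_pos (u K - v K)). lra. Qed.

Lemma wd_refl K u : wd K u u = 0.
Proof. induction K as [|K IH]; simpl; [lra|]. rewrite IH, Rminus_diag, Rabs_R0. lra. Qed.

Lemma wd_zero K e w : small e w -> wd K w (fun _ => 0) <= INR K * e.
Proof.
  intros H. induction K as [|K IH]; [simpl; lra|]. rewrite S_INR. simpl wd.
  specialize (H K). rewrite Rminus_0_r. lra.
Qed.

Lemma wd_coord K k u v : (k < K)%nat -> Rabs (u k - v k) <= wd K u v.
Proof.
  induction K as [|K IH]; [lia|]. intros H. simpl.
  destruct (Nat.eq_dec k K) as [->|N].
  - generalize (wd_nonneg K u v). lra.
  - generalize (Rabs_pos (u K - v K)). assert (k < K)%nat by lia. specialize (IH H0). lra.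
Qed.

Lemma dd_nonneg K p q : 0 <= dd K p q.
Proof.
  unfold dd. generalize (wd_nonneg K (om p) (om q)) (Rabs_pos (tt p - tt q))
    (Rabs_pos (ss p - ss q)) (Rabs_pos (rr p - rr q)). lra.
Qed.

Lemma dom_le e e' p : e <= e' -> dom e p -> dom e' p.
Proof. intros L [H1 H2]. split; auto. intros k. specialize (H1 k). lra. Qed.

Lemma BL_le K e e' F : e <= e' -> BL K e' F -> BL K e F.
Proof.
  intros L (C & HC & B & Lp). exists C. split; [auto|split].
  - intros p Hp. apply B. now apply dom_le with e.
  - intros p q Hp Hq. apply Lp; now apply dom_le with e.
Qed.

Lemma BL_ext K e F G : (forall p, F p = G p) -> BL K e F -> BL K e G.
Proof. intros E. replace G with F; auto. now extensionality p. Qed.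

Lemma BL_const K e c : BL K e (fun _ => c).
Proof.
  exists (Rabs c). split; [apply Rabs_pos|split; [intros; lra|]].
  intros p q _ _. rewrite Rminus_diag, Rabs_R0. apply Rmult_le_pos; [apply Rabs_pos|apply dd_nonneg].
Qed.

Lemma BL_plus K e F G : BL K e F -> BL K e G -> BL K e (fun p => F p + G p).
Proof.
  intros (C & HC & B & L) (C' & HC' & B' & L'). exists (C + C'). split; [lra|split].
  - intros p Hp. triang. generalize (B p Hp) (B' p Hp). lra.
  - intros p q Hp Hq.
    replace (F p + G p - (F q + G q)) with ((F p - F q) + (G p - G q)) by ring.
    triang. generalize (L p q Hp Hq) (L' p q Hp Hq). lra.
Qed.

Lemma BL_mult K e F G : BL K e F -> BL K e G -> BL K e (fun p => F p * G p).
Proof.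
  intros (C & HC & B & L) (C' & HC' & B' & L'). exists (C * C' + 2 * (C * C')).
  assert (0 <= C * C') by now apply Rmult_le_pos. split; [lra|split].
  - intros p Hp. rewrite Rabs_mult.
    apply Rle_trans with (C * C'); [|lra]. apply Rmult_le_compat; auto using Rabs_pos.
  - intros p q Hp Hq.
    replace (F p * G p - F q * G q) with (F p * (G p - G q) + (F p - F q) * G q) by ring.
    triang. rewrite !Rabs_mult.
    assert (D := dd_nonneg K p q).
    assert (Rabs (F p) * Rabs (G p - G q) <= C * (C' * dd K p q))
      by (apply Rmult_le_compat; auto using Rabs_pos).
    assert (Rabs (F p - F q) * Rabs (G q) <= (C * dd K p q) * C')
      by (apply Rmult_le_compat; auto using Rabs_pos).
    assert (0 <= C * C' * dd K p q) by now apply Rmult_le_pos. lra.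
Qed.

Lemma BL_opp K e F : BL K e F -> BL K e (fun p => - F p).
Proof.
  intros H. apply BL_ext with (fun p => (-1) * F p); [intros; ring|].
  apply BL_mult; auto. apply BL_const.
Qed.

Lemma BL_minus K e F G : BL K e F -> BL K e G -> BL K e (fun p => F p - G p).
Proof. intros. apply BL_plus; auto. now apply BL_opp. Qed.

Lemma BL_pow K e F n : BL K e F -> BL K e (fun p => F p ^ n).
Proof.
  intros H. induction n as [|n IH]; [exact (BL_const K e 1)|]. exact (BL_mult K e _ _ H IH).
Qed.

Lemma BL_inv K e F c : 0 < c -> (forall p, dom e p -> c <= F p) -> BL K e F -> BL K e (fun p => / F p).
Proof.
  intros Hc H (C & HC & B & L). exists (/ c + C / (c * c)).
  assert (0 < / c) by now apply Rinv_0_lt_compat.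
  assert (P : 0 < c * c) by now apply Rmult_lt_0_compat.
  assert (0 <= C / (c * c)) by now apply Rdiv_le_0_compat.
  split; [lra|split].
  - intros p Hp. specialize (H p Hp). rewrite Rabs_pos_eq.
    + apply Rle_trans with (/ c); [|lra]. now apply Rinv_le_contravar.
    + left. apply Rinv_0_lt_compat. lra.
  - intros p q Hp Hq. assert (Fp := H p Hp). assert (Fq := H q Hq).
    replace (/ F p - / F q) with ((F q - F p) * / (F p * F q)) by (field; lra).
    rewrite Rabs_mult, Rabs_minus_sym.
    assert (c * c <= F p * F q) by (apply Rmult_le_compat; lra).
    rewrite (Rabs_pos_eq (/ _)) by (left; apply Rinv_0_lt_compat; lra).
    apply Rle_trans with (C * dd K p q * / (c * c)).
    + apply Rmult_le_compat; auto using Rabs_pos.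
      * left; apply Rinv_0_lt_compat; lra.
      * now apply Rinv_le_contravar.
    + assert (D := dd_nonneg K p q).
      replace (C * dd K p q * / (c * c)) with (C / (c * c) * dd K p q) by (field; lra).
      apply Rmult_le_compat_r; lra.
Qed.

Lemma BL_om K e k : (k < K)%nat -> BL K e (fun p => om p k).
Proof.
  intros Hk. exists (Rmax e 1). assert (L1 := Rmax_l e 1). assert (L2 := Rmax_r e 1).
  split; [lra|split].
  - intros p [H _]. specialize (H k). lra.
  - intros p q _ _. apply Rle_trans with (dd K p q).
    + unfold dd. generalize (wd_coord K k (om p) (om q) Hk) (Rabs_pos (tt p - tt q))
       (Rabs_pos (ss p - ss q)) (Rabs_pos (rr p - rr q)). lra.
    + rewrite <- (Rmult_1_l (dd K p q)) at 1. apply Rmult_le_compat_r; auto. apply dd_nonneg.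
Qed.

Lemma dper_reduce f t s : dper f -> exists t' s', 0 <= t' <= 2 /\ 0 <= s' <= 2 /\ f t s = f t' s'.
Proof.
  intros [pt ps]. destruct (period_reduce 2 t) as [i Hi]; [lra|].
  destruct (period_reduce 1 s) as [j Hj]; [lra|].
  exists (t + 2 * IZR i), (s + 1 * IZR j). split; [lra|split; [lra|]].
  rewrite (shift_Z 2 (fun t => f t (s + 1 * IZR j))) by (intros; apply pt).
  symmetry. apply (shift_Z 1 (f t)). intros; apply ps.
Qed.

Lemma sm_bounded f : sm f -> dper f -> exists M, 0 <= M /\ forall t s, Rabs (f t s) <= M.
Proof.
  intros S p. destruct (box_bounded 0 2 (fun x y _ => f x y)) as (M & HM & B).
  - apply cont3_of_2. now apply sm_cont.
  - exists M. split; [lra|]. intros t s.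
    destruct (dper_reduce f t s p) as (t' & s' & Ht & Hs & ->).
    apply (B t' s' 0). repeat split; lra.
Qed.

Lemma dper_Dt f : dper f -> dper (Dt f).
Proof.
  intros [p q]. split; intros t s; unfold Dt.
  - assert (E : forall u, f (u + 2) s = f u s) by (intros; apply p).
    rewrite <- (Derive_ext (fun u => f (u + 2) s) (fun u => f u s) t E).
    unfold Derive. apply f_equal, Lim_ext. intros h. now replace (t + h + 2) with (t + 2 + h) by ring.
  - apply Derive_ext. intros; apply q.
Qed.

Lemma lip_of_derive (F F' : R -> R) M : (forall s, is_derive F s (F' s)) ->
  (forall s, Rabs (F' s) <= M) -> forall a b, Rabs (F a - F b) <= M * Rabs (a - b).
Proof.
  intros D B a b.
  destruct (MVT_gen F b a F') as (c & _ & E).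
  - intros; apply D.
  - intros x _. apply continuity_pt_filterlim, (ex_derive_continuous F). eexists; apply D.
  - rewrite E, Rabs_mult. apply Rmult_le_compat_r; [apply Rabs_pos|auto].
Qed.

(** The partial derivatives are doubly periodic and continuous, hence bounded. *)
Lemma BL_sm K e f : sm f -> dper f -> BL K e (fun p => f (tt p) (ss p)).
Proof.
  intros S p. destruct (sm_Ds f S) as [S1 D1], (sm_Dt f S) as [S2 D2].
  destruct (sm_bounded f S p) as (M0 & H0 & B0).
  destruct (sm_bounded _ S1 (dper_Ds f p)) as (M1 & H1 & B1).
  destruct (sm_bounded _ S2 (dper_Dt f p)) as (M2 & H2 & B2).
  exists (M0 + M1 + M2). split; [lra|split].
  - intros q _. specialize (B0 (tt q) (ss q)). lra.
  - intros q r _ _.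
    replace (f (tt q) (ss q) - f (tt r) (ss r)) with
      ((f (tt q) (ss q) - f (tt q) (ss r)) + (f (tt q) (ss r) - f (tt r) (ss r))) by ring.
    triang.
    assert (L1 := lip_of_derive (f (tt q)) (Ds f (tt q)) M1 (D1 (tt q)) (B1 (tt q)) (ss q) (ss r)).
    assert (L2 := lip_of_derive (fun t => f t (ss r)) (fun t => Dt f t (ss r)) M2
       (fun t => D2 t (ss r)) (fun t => B2 t (ss r)) (tt q) (tt r)).
    unfold dd. generalize (wd_nonneg K (om q) (om r)) (Rabs_pos (tt q - tt r))
       (Rabs_pos (ss q - ss r)) (Rabs_pos (rr q - rr r)). intros. nra.
Qed.

(** The domain and the distance are symmetric in the two points of the circle. *)
Lemma BL_swap K e (f : (nat -> R) -> R -> R -> R) :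
  BL K e (fun p => f (om p) (tt p) (ss p)) -> BL K e (fun p => f (om p) (tt p) (rr p)).
Proof.
  intros (C & HC & B & L). exists C. split; [auto|split].
  - intros p (H1 & H2 & H3). apply (B (Pt (om p) (tt p) (rr p) (ss p))). repeat split; simpl; auto; lra.
  - intros p q (H1 & H2 & H3) (H1' & H2' & H3').
    apply Rle_trans with (C * dd K (Pt (om p) (tt p) (rr p) (ss p)) (Pt (om q) (tt q) (rr q) (ss q))).
    + apply (L (Pt (om p) (tt p) (rr p) (ss p)) (Pt (om q) (tt q) (rr q) (ss q))); repeat split; simpl; auto; lra.
    + unfold dd; simpl. apply Rmult_le_compat_l; lra.
Qed.

(** The factor 2 bounds the length of the interval of integration. The integrand varies with the
    parameters and the time, the limits with the two points. *)
Lemma BL_int K e (f : (nat -> R) -> R -> R -> R) :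
  (forall w t s, continuous (f w t) s) ->
  BL K e (fun p => f (om p) (tt p) (ss p)) ->
  BL K e (fun p => RInt (f (om p) (tt p)) (ss p) (rr p)).
Proof.
  intros Cf (C & HC & B & L). exists (2 * C). split; [lra|].
  assert (B' : forall w t a b, small e w -> 0 <= a <= 2 -> 0 <= b <= 2 ->
     Rabs (RInt (f w t) a b) <= C * Rabs (b - a)).
  { intros w t a b Hw Ha Hb. apply abs_RInt_le_both; auto.
    intros x Hx. apply (B (Pt w t x 0)). split; [auto|simpl].
    revert Hx. unfold Rmin, Rmax. destruct (Rle_dec a b); lra. }
  split.
  - intros p (H1 & H2 & H3). apply Rle_trans with (1 := B' _ _ _ _ H1 H2 H3).
    rewrite Rmult_comm. apply Rmult_le_compat_r; auto. apply Rabs_le. lra.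
  - intros p q (H1 & H2 & H3) (H1' & H2' & H3').
    set (g := f (om q) (tt q)). set (h := f (om p) (tt p)).
    assert (Cg : forall s, continuous g s) by (intros; apply Cf).
    assert (Ch : forall s, continuous h s) by (intros; apply Cf).
    replace (RInt h (ss p) (rr p) - RInt g (ss q) (rr q)) with
      (RInt (fun s => h s - g s) (ss p) (rr p) + (RInt g (ss p) (ss q) + RInt g (rr q) (rr p))).
    + triang.
      assert (T := Rabs_triang (RInt g (ss p) (ss q)) (RInt g (rr q) (rr p))).
      assert (G1 := B' (om q) (tt q) (ss p) (ss q) H1' H2 H2').
      assert (G2 := B' (om q) (tt q) (rr q) (rr p) H1' H3' H3).
      fold g in G1, G2. rewrite (Rabs_minus_sym (ss q)) in G1.
      set (d0 := wd K (om p) (om q) + Rabs (tt p - tt q)).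
      assert (D0 : 0 <= d0) by (unfold d0; generalize (wd_nonneg K (om p) (om q)) (Rabs_pos (tt p - tt q)); lra).
      assert (G0 : Rabs (RInt (fun s => h s - g s) (ss p) (rr p)) <= C * d0 * Rabs (rr p - ss p)).
      { apply abs_RInt_le_both; [intros; cont|].
        intros x Hx.
        assert (Hx' : 0 <= x <= 2) by (revert Hx; unfold Rmin, Rmax; destruct (Rle_dec (ss p) (rr p)); lra).
        apply Rle_trans with (C * dd K (Pt (om p) (tt p) x 0) (Pt (om q) (tt q) x 0)).
        - apply (L (Pt (om p) (tt p) x 0) (Pt (om q) (tt q) x 0)); repeat split; simpl; auto; lra.
        - unfold dd; simpl. rewrite !Rminus_diag, Rabs_R0. unfold d0. right. ring. }
      assert (G0' : Rabs (rr p - ss p) <= 2) by (apply Rabs_le; lra).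
      assert (C * d0 * Rabs (rr p - ss p) <= C * d0 * 2).
      { apply Rmult_le_compat_l; auto. now apply Rmult_le_pos. }
      assert (P1 := Rmult_le_pos _ _ HC (Rabs_pos (ss p - ss q))).
      assert (P2 := Rmult_le_pos _ _ HC (Rabs_pos (rr p - rr q))).
      replace (2 * C * dd K p q) with
        (C * d0 * 2 + 2 * (C * Rabs (ss p - ss q)) + 2 * (C * Rabs (rr p - rr q)))
        by (unfold dd, d0; ring).
      lra.
    + assert (E1 := RIchasles g (ss p) (ss q) (rr q) Cg). assert (E2 := RIchasles g (ss p) (rr q) (rr p) Cg).
      assert (E3 : RInt (fun s => h s - g s) (ss p) (rr p) = RInt h (ss p) (rr p) + (-1) * RInt g (ss p) (rr p)).
      { rilin. ring. }
      rewrite E3. lra.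
Qed.

Lemma BL_tot K e (f : (nat -> R) -> R -> R -> R) :
  (forall w t s, continuous (f w t) s) ->
  BL K e (fun p => f (om p) (tt p) (ss p)) ->
  BL K e (fun p => RInt (f (om p) (tt p)) 0 1).
Proof.
  intros Cf H. destruct (BL_int K e f Cf H) as (C & HC & B & L).
  exists C. split; [auto|split].
  - intros p (H1 & _). apply (B (Pt (om p) (tt p) 0 1)). repeat split; simpl; auto; lra.
  - intros p q (H1 & _) (H2 & _).
    apply Rle_trans with (C * dd K (Pt (om p) (tt p) 0 1) (Pt (om q) (tt q) 0 1)).
    + apply (L (Pt (om p) (tt p) 0 1) (Pt (om q) (tt q) 0 1)); repeat split; simpl; auto; lra.
    + apply Rmult_le_compat_l; auto. unfold dd; simpl. rewrite !Rminus_diag, Rabs_R0.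
      generalize (Rabs_pos (ss p - ss q)) (Rabs_pos (rr p - rr q)). lra.
Qed.

Definition base (p : pt) : pt := Pt (fun _ => 0) (tt p) (ss p) (rr p).

Lemma dom_base e p : 0 <= e -> dom e p -> dom e (base p).
Proof. intros He (_ & H). split; auto. intros k. simpl. rewrite Rabs_R0. auto. Qed.

Lemma BL_near K e1 F : BL K e1 F -> exists C, 0 < C /\ forall e p, 0 <= e <= e1 -> dom e p ->
  Rabs (F p - F (base p)) <= C * e.
Proof.
  intros (C & HC & _ & L). exists (C * INR K + 1).
  assert (PK := pos_INR K). split; [generalize (Rmult_le_pos _ _ HC PK); lra|].
  intros e p He Hp. assert (Hp1 : dom e1 p) by (apply dom_le with e; auto; lra).
  apply Rle_trans with (C * dd K p (base p)).
  - apply L; auto. apply dom_base; auto; lra.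
  - unfold dd, base; simpl. rewrite !Rminus_diag, Rabs_R0.
    destruct Hp as [Hp _]. assert (W := wd_zero K e (om p) Hp).
    assert (C * wd K (om p) (fun _ => 0) <= C * (INR K * e)) by now apply Rmult_le_compat_l.
    lra.
Qed.

Lemma BL_stay_near K e1 F c : 0 < e1 -> BL K e1 F -> 0 < c -> exists e0, 0 < e0 <= e1 /\
  forall p, dom e0 p -> Rabs (F p - F (base p)) <= c.
Proof.
  intros H1 H Hc. destruct (BL_near K e1 F H) as (C & HC & L).
  exists (Rmin e1 (c / C)).
  assert (P : 0 < c / C) by (apply Rdiv_lt_0_compat; lra).
  assert (L1 := Rmin_l e1 (c / C)). assert (L2 := Rmin_r e1 (c / C)).
  assert (L0 : 0 < Rmin e1 (c / C)) by (apply Rmin_pos; lra).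
  split; [lra|]. intros p Hp.
  apply Rle_trans with (1 := L _ p (conj (Rlt_le _ _ L0) L1) Hp).
  apply Rle_trans with (C * (c / C)); [apply Rmult_le_compat_l; lra|]. right. field. lra.
Qed.

Lemma BL_stay_pos K e1 F c : 0 < e1 -> BL K e1 F -> 0 < c -> exists e0, 0 < e0 <= e1 /\
  forall p, dom e0 p -> c <= F (base p) -> c / 2 <= F p.
Proof.
  intros H1 H Hc. destruct (BL_stay_near K e1 F (c / 2) H1 H) as (e0 & He & L); [lra|].
  exists e0. split; auto. intros p Hp Hb. specialize (L p Hp). apply Rabs_le_between in L. lra.
Qed.

(** A positive minimum on a compact set at zero parameters: the hypothesis on the complement of
    [guard] says that the guarded part of the box is closed. *)
Lemma BL_min K e F (guard : R -> R -> R -> Prop) : 0 <= e -> BL K e F ->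
  (forall a b c, in_box 0 2 a b c -> ~ guard a b c -> exists d, 0 < d /\
     forall x y z, close3 d a b c x y z -> ~ guard x y z) ->
  (forall t s r, in_box 0 2 t s r -> guard t s r -> 0 < F (Pt (fun _ => 0) t s r)) ->
  exists c, 0 < c /\ forall t s r, in_box 0 2 t s r -> guard t s r -> c <= F (Pt (fun _ => 0) t s r).
Proof.
  intros He (C & HC & _ & L) G P.
  apply (box_uniform 0 2 (fun t s r c => guard t s r -> c <= F (Pt (fun _ => 0) t s r))).
  - intros x y z d d' Hd H Hg. specialize (H Hg). lra.
  - intros a b c Hb. destruct (classic (guard a b c)) as [Hg|Hg].
    2: { destruct (G a b c Hb Hg) as (d & Hd & N). exists d. split; auto.
         intros x y z Hc _ Hg'. exfalso. now apply (N x y z). }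
    assert (Pb := P a b c Hb Hg). set (v := F (Pt (fun _ => 0) a b c)) in *.
    (* Three coordinates, each moved by less than m, change [F] by at most 3 m C <= v / 2; the 1
       added to C avoids a division by zero. *)
    set (m := v / (6 * (C + 1))).
    assert (Hm : 0 < m) by (apply Rdiv_lt_0_compat; lra).
    exists (Rmin m (v / 2)). split; [apply Rmin_pos; lra|].
    intros x y z (H1 & H2 & H3) (_ & Hy & Hz) _.
    assert (L1 := Rmin_l m (v / 2)). assert (L2 := Rmin_r m (v / 2)).
    assert (A : Rabs (F (Pt (fun _ => 0) x y z) - v) <= C * (3 * m)).
    { destruct Hb as (_ & Hb1 & Hb2).
      apply Rle_trans with (C * dd K (Pt (fun _ => 0) x y z) (Pt (fun _ => 0) a b c)).
      - apply L; (split; [intros k; simpl; rewrite Rabs_R0; auto|simpl; auto]).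
      - apply Rmult_le_compat_l; auto. unfold dd; simpl. rewrite wd_refl. lra. }
    apply Rabs_le_between in A.
    assert (C * (3 * m) <= v / 2).
    { apply Rle_trans with ((C + 1) * (3 * m)).
      - apply Rmult_le_compat_r; lra.
      - unfold m. right. field. lra. }
    lra.
Qed.

(** * Perturbing a family *)

(** The amplitude of the perturbation: zero at times 0 and 1, positive in between, and periodic like
    [rho]. *)
Definition beta (t : R) : R := sin (PI * t) ^ 2.

Lemma beta_0 : beta 0 = 0.
Proof. unfold beta. rewrite Rmult_0_r, sin_0. ring. Qed.
Lemma beta_1 : beta 1 = 0.
Proof. unfold beta. rewrite Rmult_1_r, sin_PI. ring. Qed.
Lemma sm_beta : sm (fun t _ => beta t).
Proof. unfold beta. smt. Qed.
Lemma beta_per t : beta (t + 2) = beta t.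
Proof.
  unfold beta. replace (PI * (t + 2)) with (PI * t + 2 * INR 1 * PI) by (simpl; ring).
  now rewrite sin_period.
Qed.
Lemma beta_pos tau t : 0 < tau <= 1 / 2 -> tau <= t <= 1 - tau -> beta tau <= beta t.
Proof.
  intros H Ht. assert (P := PI_RGT_0). unfold beta.
  assert (0 <= sin (PI * tau)) by (apply sin_ge_0; nra).
  apply pow_incr. split; auto. destruct (Rle_dec t (1 / 2)).
  - apply sin_incr_1; nra.
  - rewrite <- (sin_PI_x (PI * t)). apply sin_incr_1; nra.
Qed.
Lemma beta_gt_0 t : 0 < t < 1 -> 0 < beta t.
Proof.
  intros H. assert (P := PI_RGT_0). unfold beta. apply pow_lt. apply sin_gt_0; nra.
Qed.
Definition c1 (s : R) : R := cos (2 * PI * s).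
Definition s1 (s : R) : R := sin (2 * PI * s).

Lemma c1_per s : c1 (s + 1) = c1 s.
Proof.
  unfold c1. replace (2 * PI * (s + 1)) with (2 * PI * s + 2 * INR 1 * PI) by (simpl; ring).
  apply cos_period.
Qed.
Lemma s1_per s : s1 (s + 1) = s1 s.
Proof.
  unfold s1. replace (2 * PI * (s + 1)) with (2 * PI * s + 2 * INR 1 * PI) by (simpl; ring).
  apply sin_period.
Qed.
Lemma sm_c1 : sm (fun _ s => c1 s). Proof. unfold c1. smt. Qed.
Lemma sm_s1 : sm (fun _ s => s1 s). Proof. unfold s1. smt. Qed.
Lemma is_derive_c1 s : is_derive c1 s (- (2 * PI) * s1 s).
Proof. unfold c1, s1. auto_derive; auto. ring. Qed.
Lemma is_derive_s1 s : is_derive s1 s (2 * PI * c1 s).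
Proof. unfold c1, s1. auto_derive; auto. ring. Qed.

Fixpoint lin (psi : nat -> R -> R) (M : nat) (w : nat -> R) (s : R) : R :=
  match M with O => 0 | S M => lin psi M w s + w (2 + M)%nat * psi M s end.

Ltac smt' := repeat first [apply sm_beta | apply sm_c1 | apply sm_s1 | progress smt].

Section Family.
Variables (X Y : R -> R -> R).
Hypotheses (FAM : immersed_family X Y) (CL : closed_family X Y).

Let SX : sm X := proj1 FAM.
Let SY : sm Y := proj1 (proj2 FAM).
Let pX : dper X := proj1 (proj2 (proj2 FAM)).
Let pY : dper Y := proj1 (proj2 (proj2 (proj2 FAM))).

Let Sxs0 : sm (Ds X) := proj1 (sm_Ds X SX).
Let Sxss0 : sm (Ds (Ds X)) := proj1 (sm_Ds _ Sxs0).
Let Sys0 : sm (Ds Y) := proj1 (sm_Ds Y SY).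
Let IM : forall t s, Ds X t s <> 0 \/ Ds Y t s <> 0 := proj2 (proj2 (proj2 (proj2 FAM))).

Section Perturbation.
Variables (psi : nat -> R -> R) (M : nat).
Hypotheses (Spsi : forall j, sm (fun _ s => psi j s)) (ppsi : forall j, periodic (psi j)).

Let K := (2 + M)%nat.

(* The parameters [w 0], [w 1] move [x], and [w (2 + j)] moves [y] along [psi j]. *)
Definition xh (w : nat -> R) (t s : R) : R := X t s + beta t * (w 0%nat * c1 s + w 1%nat * s1 s).
Definition xhs (w : nat -> R) (t s : R) : R :=
  Ds X t s + beta t * (w 0%nat * (- (2 * PI) * s1 s) + w 1%nat * (2 * PI * c1 s)).
Definition xhss (w : nat -> R) (t s : R) : R :=
  Ds (Ds X) t s + beta t * (w 0%nat * (- (2 * PI) * (2 * PI * c1 s)) + w 1%nat * (2 * PI * (- (2 * PI) * s1 s))).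
Definition uh (w : nat -> R) (t s : R) : R := Y t s + beta t * lin psi M w s.
Definition uhs (w : nat -> R) (t s : R) : R := Ds Y t s + beta t * lin (fun j => Derive (psi j)) M w s.
Definition yh (w : nat -> R) (t : R) : R -> R := corr (xh w t) (xhs w t) (uh w t).
(** The derivative of [yh] in closed form, so that its Lipschitz bound can be assembled from those
    of its constituents. *)
Definition yhs (w : nat -> R) (t s : R) : R :=
  uhs w t s - (cc2 (xh w t) (xhs w t) (uh w t) * xhs w t s) * xhs w t s ^ 3
  - (cc1 (xh w t) (xhs w t) (uh w t) + cc2 (xh w t) (xhs w t) (uh w t) * xh w t s)
    * (3 * xhs w t s ^ 2 * xhss w t s).

Lemma sm_lin (phi : nat -> R -> R) m w : (forall j, sm (fun _ s => phi j s)) -> sm (fun _ s => lin phi m w s).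
Proof.
  intros H. induction m as [|m IH]; [exact (sm_const 0)|].
  apply (sm_plus (fun _ s => lin phi m w s)); auto.
  apply (sm_mult (fun _ _ => w (2 + m)%nat) (fun _ s => phi m s)); auto. apply sm_const.
Qed.

Lemma lin_per (phi : nat -> R -> R) m w : (forall j, periodic (phi j)) -> periodic (lin phi m w).
Proof.
  intros H. induction m as [|m IH]; intros s; simpl; auto. now rewrite IH, H.
Qed.

Lemma is_derive_lin m w s : is_derive (lin psi m w) s (lin (fun j => Derive (psi j)) m w s).
Proof.
  induction m as [|m IH]; simpl.
  - apply is_derive_cst.
  - apply (is_derive_plus (lin psi m w) (fun s => w (S (S m)) * psi m s)); auto.
    apply is_derive_scal. exact (proj2 (sm_Ds _ (Spsi m)) 0 s).
Qed.

Lemma sm_xh w : sm (xh w).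
Proof. unfold xh. smt'. Qed.
Lemma sm_xhs w : sm (xhs w).
Proof. unfold xhs. smt'. Qed.
Lemma sm_uh w : sm (uh w).
Proof. unfold uh. assert (H := sm_lin psi M w Spsi). smt'. Qed.

Lemma dper_xh w : dper (xh w).
Proof.
  destruct pX as [p q]. split; intros t s; unfold xh.
  - now rewrite p, beta_per.
  - now rewrite q, c1_per, s1_per.
Qed.
Lemma dper_uh w : dper (uh w).
Proof.
  destruct pY as [p q]. split; intros t s; unfold uh.
  - now rewrite p, beta_per.
  - now rewrite q, (lin_per psi M w ppsi).
Qed.

Lemma is_derive_xh w t s : is_derive (xh w t) s (xhs w t s).
Proof.
  unfold xh, xhs. apply (is_derive_plus (X t)); [apply (sm_Ds X SX)|].
  apply is_derive_scal. apply (is_derive_plus (fun s => w 0%nat * c1 s) (fun s => w 1%nat * s1 s));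
    apply is_derive_scal; [apply is_derive_c1|apply is_derive_s1].
Qed.
Lemma is_derive_xhs w t s : is_derive (xhs w t) s (xhss w t s).
Proof.
  unfold xhs, xhss. apply (is_derive_plus (Ds X t)); [apply (sm_Ds _ Sxs0)|].
  apply is_derive_scal.
  apply (is_derive_plus (fun s => w 0%nat * (- (2 * PI) * s1 s)) (fun s => w 1%nat * (2 * PI * c1 s)));
    apply is_derive_scal, is_derive_scal; [apply is_derive_s1|apply is_derive_c1].
Qed.
Lemma is_derive_uh w t s : is_derive (uh w t) s (uhs w t s).
Proof.
  unfold uh, uhs. apply (is_derive_plus (Y t)); [apply (sm_Ds Y SY)|].
  apply is_derive_scal, is_derive_lin.
Qed.
Lemma is_derive_yh w t s : is_derive (yh w t) s (yhs w t s).
Proof.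
  unfold yh, yhs, corr.
  assert (D1 := is_derive_xh w t s). assert (D2 := is_derive_xhs w t s). assert (D3 := is_derive_uh w t s).
  set (a := cc1 _ _ _). set (b := cc2 _ _ _).
  auto_derive.
  - repeat split; auto; eexists; eauto.
  - change (Derive (fun x => xh w t x) s) with (Derive (xh w t) s).
    change (Derive (fun x => xhs w t x) s) with (Derive (xhs w t) s).
    change (Derive (fun x => uh w t x) s) with (Derive (uh w t) s).
    rewrite (is_derive_unique _ _ _ D1), (is_derive_unique _ _ _ D2), (is_derive_unique _ _ _ D3). ring.
Qed.

Lemma Ds_xh w : Ds (xh w) = xhs w.
Proof. extensionality t. extensionality s. apply is_derive_unique, is_derive_xh. Qed.

Lemma cont_xh w t s : continuous (xh w t) s.
Proof. apply sm_continuous, sm_xh. Qed.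
Lemma cont_xhs w t s : continuous (xhs w t) s.
Proof. apply sm_continuous, sm_xhs. Qed.
Lemma cont_uh w t s : continuous (uh w t) s.
Proof. apply sm_continuous, sm_uh. Qed.
Lemma cont_corr w t U s : (forall s, continuous U s) -> continuous (corr (xh w t) (xhs w t) U) s.
Proof.
  intros H. assert (C1 := cont_xh w t). assert (C2 := cont_xhs w t). unfold corr.
  set (a := cc1 _ _ _). set (b := cc2 _ _ _). cont.
Qed.

(** ** Lipschitz bounds *)

Lemma BL_beta e : BL K e (fun p => beta (tt p)).
Proof. apply (BL_sm K e (fun t _ => beta t)); [apply sm_beta|]. split; intros t s; [apply beta_per|auto]. Qed.
Lemma BL_c1 e : BL K e (fun p => c1 (ss p)).
Proof. apply (BL_sm K e (fun _ s => c1 s)); [apply sm_c1|]. split; intros t s; [auto|apply c1_per]. Qed.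
Lemma BL_s1 e : BL K e (fun p => s1 (ss p)).
Proof. apply (BL_sm K e (fun _ s => s1 s)); [apply sm_s1|]. split; intros t s; [auto|apply s1_per]. Qed.
Lemma BL_X e : BL K e (fun p => X (tt p) (ss p)).
Proof. now apply BL_sm. Qed.
Lemma BL_Xs e : BL K e (fun p => Ds X (tt p) (ss p)).
Proof. apply BL_sm; auto. now apply dper_Ds. Qed.
Lemma BL_Xss e : BL K e (fun p => Ds (Ds X) (tt p) (ss p)).
Proof. apply BL_sm; auto. now apply dper_Ds, dper_Ds. Qed.
Lemma BL_Y e : BL K e (fun p => Y (tt p) (ss p)).
Proof. now apply BL_sm. Qed.
Lemma BL_Ys e : BL K e (fun p => Ds Y (tt p) (ss p)).
Proof. apply BL_sm; auto. now apply dper_Ds. Qed.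
Lemma BL_om0 e : BL K e (fun p => om p 0%nat).
Proof. apply BL_om. unfold K. lia. Qed.
Lemma BL_om1 e : BL K e (fun p => om p 1%nat).
Proof. apply BL_om. unfold K. lia. Qed.

Lemma BL_lin (phi : nat -> R -> R) m e : (m <= M)%nat -> (forall j, sm (fun _ s => phi j s)) ->
  (forall j, periodic (phi j)) -> BL K e (fun p => lin phi m (om p) (ss p)).
Proof.
  intros Hm S p. induction m as [|m IH]; [exact (BL_const K e 0)|].
  apply (BL_plus K e (fun p => lin phi m (om p) (ss p))); [apply IH; lia|].
  apply (BL_mult K e (fun p => om p (2 + m)%nat) (fun p => phi m (ss p))).
  - apply BL_om. unfold K. lia.
  - apply (BL_sm K e (fun _ s => phi m s)); auto. split; intros t s; auto. apply p.
Qed.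

Ltac bl := repeat first [apply BL_beta | apply BL_c1 | apply BL_s1 | apply BL_X | apply BL_Xs | apply BL_Xss
  | apply BL_Y | apply BL_Ys | apply BL_om0 | apply BL_om1 | assumption
  | apply BL_plus | apply BL_minus | apply BL_mult | apply BL_pow | apply BL_opp | apply BL_const].

Lemma BL_xh e : BL K e (fun p => xh (om p) (tt p) (ss p)).
Proof. unfold xh. bl. Qed.
Lemma BL_xhs e : BL K e (fun p => xhs (om p) (tt p) (ss p)).
Proof. unfold xhs. bl. Qed.
Lemma BL_xhss e : BL K e (fun p => xhss (om p) (tt p) (ss p)).
Proof. unfold xhss. bl. Qed.
Lemma BL_uh e : BL K e (fun p => uh (om p) (tt p) (ss p)).
Proof. unfold uh. assert (H := BL_lin psi M e (le_n M) Spsi ppsi). bl. Qed.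
Lemma BL_uhs e : BL K e (fun p => uhs (om p) (tt p) (ss p)).
Proof.
  unfold uhs. assert (H : BL K e (fun p => lin (fun j => Derive (psi j)) M (om p) (ss p))).
  { apply BL_lin; auto.
    - intros j. exact (proj1 (sm_Ds _ (Spsi j))).
    - intros j. now apply periodic_Derive. }
  bl.
Qed.

Definition det (w : nat -> R) (t : R) : R := gdet (xh w t) (wt (xhs w t)) 0 1.

Lemma BL_moments e : BL K e (fun p => m0 (wt (xhs (om p) (tt p))) 0 1) /\
  BL K e (fun p => m1 (xh (om p) (tt p)) (wt (xhs (om p) (tt p))) 0 1) /\
  BL K e (fun p => m2 (xh (om p) (tt p)) (wt (xhs (om p) (tt p))) 0 1).
Proof.
  assert (C1 := cont_xh). assert (C2 := cont_xhs). assert (B1 := BL_xh e). assert (B2 := BL_xhs e).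
  assert (B3 : BL K e (fun p => wt (xhs (om p) (tt p)) (ss p))) by (unfold wt; bl).
  assert (C3 : forall w t s, continuous (wt (xhs w t)) s).
  { intros. unfold wt. cont. }
  split; [|split].
  - unfold m0. now apply (BL_tot K e (fun w t => wt (xhs w t))).
  - unfold m1. apply (BL_tot K e (fun w t s => xh w t s * wt (xhs w t) s)).
    + intros; cont.
    + bl.
  - unfold m2. apply (BL_tot K e (fun w t s => xh w t s * (xh w t s * wt (xhs w t) s))).
    + intros; cont.
    + bl.
Qed.

Lemma BL_det e : BL K e (fun p => det (om p) (tt p)).
Proof. destruct (BL_moments e) as (A & B & C). unfold det, gdet. bl. Qed.

Definition zw : nat -> R := fun _ => 0.

Lemma lin_zw (phi : nat -> R -> R) m s : lin phi m zw s = 0.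
Proof. induction m as [|m IH]; simpl; auto. rewrite IH. unfold zw. ring. Qed.

(** In both cases the perturbation is zero, and the correction is the identity on the closed family
    (X, Y). Zero parameters are the reference for all smallness arguments; the zeros of [beta] fix
    the two ends. *)
Lemma unperturbed w t : w = zw \/ beta t = 0 ->
  xh w t = X t /\ xhs w t = Ds X t /\ yh w t = Y t.
Proof.
  intros H.
  assert (E1 : xh w t = X t).
  { extensionality s. unfold xh. destruct H as [-> | ->]; unfold zw; ring. }
  assert (E2 : xhs w t = Ds X t).
  { extensionality s. unfold xhs. destruct H as [-> | ->]; unfold zw; ring. }
  assert (E3 : uh w t = Y t).
  { extensionality s. unfold uh. destruct H as [-> | ->]; [rewrite lin_zw|]; ring. }
  split; [auto|split; auto]. unfold yh. rewrite E1, E2, E3. extensionality s.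
  apply corr_id; [exact (proj1 (CL t))|exact (proj2 (CL t))].
Qed.

Lemma det_per w t : det w (t + 2) = det w t.
Proof.
  destruct (dper_xh w) as [p _]. destruct (dper_Ds _ (dper_xh w)) as [q _]. rewrite Ds_xh in q.
  unfold det. replace (xh w (t + 2)) with (xh w t) by (extensionality s; auto).
  now replace (xhs w (t + 2)) with (xhs w t) by (extensionality s; auto).
Qed.

Lemma det_base_pos t : 0 < det zw t.
Proof.
  unfold det. destruct (unperturbed zw t (or_introl eq_refl)) as (-> & -> & _).
  now apply (family_det X Y).
Qed.

(** The minimum over one period of the unperturbed determinant is positive, and small parameters
    keep at least half of it. *)
Lemma det_bound : exists e1 c, 0 < e1 <= 1 /\ 0 < c /\ forall w t, small e1 w -> c <= det w t.
Proof.
  destruct (BL_min K 1 (fun p => det (om p) (tt p)) (fun _ _ _ => True)) as (c & Hc & P).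
  - lra.
  - apply BL_det.
  - intros a b d _ N. now destruct N.
  - intros; apply det_base_pos.
  - destruct (BL_stay_pos K 1 (fun p => det (om p) (tt p)) c Rlt_0_1 (BL_det 1) Hc) as (e1 & He & Q).
    exists e1, (c / 2). split; [auto|split; [lra|]]. intros w t Hw.
    destruct (period_reduce 2 t) as [k Hk]; [lra|].
    rewrite <- (shift_Z 2 (det w) k t (det_per w)).
    apply (Q (Pt w (t + 2 * IZR k) 0 0)).
    + split; [auto|simpl; lra].
    + apply (P (t + 2 * IZR k) 0 0); auto. repeat split; lra.
Qed.

Lemma sm_yh w : (forall t, det w t <> 0) -> sm (yh w).
Proof.
  intros H. assert (S := sm_fcorr (xh w) (uh w) (sm_xh w) (sm_uh w)).
  unfold fcorr in S. rewrite Ds_xh in S. now apply S.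
Qed.

Lemma dper_yh w : dper (yh w).
Proof.
  assert (S := dper_fcorr (xh w) (uh w) (dper_xh w) (dper_uh w)).
  unfold fcorr in S. now rewrite Ds_xh in S.
Qed.

Lemma closed_yh w : (forall t, det w t <> 0) -> closed_family (xh w) (yh w).
Proof.
  intros H t. rewrite Ds_xh.
  apply corr_closed; [apply cont_xh|apply cont_xhs|apply cont_uh|apply H].
Qed.

(** ** Lipschitz bounds for the double point equations *)

Section Corrected.
Variables (e1 c : R).
Hypotheses (He1 : 0 < e1 <= 1) (Hc : 0 < c) (Hdet : forall w t, small e1 w -> c <= det w t).

Section OneFunction.
Variable U : (nat -> R) -> R -> R -> R.
Hypotheses (CU : forall w t s, continuous (U w t) s) (BU : BL K e1 (fun p => U (om p) (tt p) (ss p))).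

Let k1 w t := cc1 (xh w t) (xhs w t) (U w t).
Let k2 w t := cc2 (xh w t) (xhs w t) (U w t).
(** The correction of an arbitrary [U]: with [uh] it is the perturbed curve itself, with a single
    [psi j] it gives a coefficient of the linear system for the parameters. *)
Definition yU (w : nat -> R) (t : R) : R -> R := corr (xh w t) (xhs w t) (U w t).

Lemma BL_cc : BL K e1 (fun p => k1 (om p) (tt p)) /\ BL K e1 (fun p => k2 (om p) (tt p)).
Proof.
  destruct (BL_moments e1) as (A & B & C).
  assert (I : BL K e1 (fun p => / det (om p) (tt p))).
  { apply (BL_inv K e1 _ c Hc); [|apply BL_det]. intros p [Hp _]. now apply Hdet. }
  assert (C1 := cont_xh). assert (C2 := cont_xhs). assert (B1 := BL_xh e1). assert (B2 := BL_xhs e1).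
  assert (P : BL K e1 (fun p => RInt (fun s => U (om p) (tt p) s * xhs (om p) (tt p) s) 0 1)).
  { apply (BL_tot K e1 (fun w t s => U w t s * xhs w t s)); [|bl].
    intros; cont. }
  assert (Q : BL K e1 (fun p => RInt (fun s => xh (om p) (tt p) s * (U (om p) (tt p) s * xhs (om p) (tt p) s)) 0 1)).
  { apply (BL_tot K e1 (fun w t s => xh w t s * (U w t s * xhs w t s))); [|bl].
    intros; cont. }
  unfold k1, k2, cc1, cc2, gc1, gc2, Rdiv. split.
  - apply BL_mult; [bl|exact I].
  - apply BL_mult; [bl|exact I].
Qed.

Lemma BL_yU : BL K e1 (fun p => yU (om p) (tt p) (ss p)).
Proof.
  destruct BL_cc as [A B]. assert (B1 := BL_xh e1). assert (B2 := BL_xhs e1).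
  unfold yU, corr. fold k1 k2. 
  apply (BL_minus K e1 (fun p => U (om p) (tt p) (ss p)) (fun p => (k1 (om p) (tt p) + k2 (om p) (tt p) * xh (om p) (tt p) (ss p)) * xhs (om p) (tt p) (ss p) ^ 3)); [exact BU|].
  bl.
Qed.

Definition eq1 w t s r := yU w t s - yU w t r.
Definition eq2 w t s r := RInt (fun v => yU w t v * xhs w t v) s r.
Definition eq3 w t s r := RInt (fun v => xh w t v * (yU w t v * xhs w t v)) s r.

Lemma BL_eqs : BL K e1 (fun p => eq1 (om p) (tt p) (ss p) (rr p)) /\
  BL K e1 (fun p => eq2 (om p) (tt p) (ss p) (rr p)) /\ BL K e1 (fun p => eq3 (om p) (tt p) (ss p) (rr p)).
Proof.
  assert (B0 := BL_yU). assert (B1 := BL_xh e1). assert (B2 := BL_xhs e1).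
  assert (C0 : forall w t s, continuous (yU w t) s) by (intros; apply cont_corr; intros; apply CU).
  assert (C1 := cont_xh). assert (C2 := cont_xhs).
  split; [|split].
  - apply BL_minus; [exact B0|]. now apply (BL_swap K e1 yU).
  - apply (BL_int K e1 (fun w t v => yU w t v * xhs w t v)); [|bl].
    intros; cont.
  - apply (BL_int K e1 (fun w t v => xh w t v * (yU w t v * xhs w t v))); [|bl].
    intros; cont.
Qed.
End OneFunction.

Lemma BL_yhs : BL K e1 (fun p => yhs (om p) (tt p) (ss p)).
Proof.
  destruct (BL_cc uh cont_uh (BL_uh e1)) as [A B].
  assert (B1 := BL_xh e1). assert (B2 := BL_xhs e1). assert (B3 := BL_uhs e1). assert (B4 := BL_xhss e1).
  unfold yhs. bl.
Qed.
End Corrected.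
End Perturbation.

Lemma BL_cont_base K e F a b c eta : 0 <= e -> BL K e F -> in_box 0 2 a b c -> 0 < eta ->
  exists d, 0 < d /\ forall x y z, close3 d a b c x y z -> in_box 0 2 x y z ->
    Rabs (F (Pt zw x y z) - F (Pt zw a b c)) <= eta.
Proof.
  intros He (C & HC & _ & L) (_ & Hb & Hc) Heta.
  exists (eta / (3 * (C + 1))). split; [apply Rdiv_lt_0_compat; lra|].
  intros x y z (H1 & H2 & H3) (_ & Hy & Hz).
  apply Rle_trans with (C * dd K (Pt zw x y z) (Pt zw a b c)).
  - apply L; (split; [intros k; unfold zw; simpl; rewrite Rabs_R0; auto|simpl; auto]).
  - unfold dd; simpl. rewrite wd_refl.
    apply Rle_trans with ((C + 1) * (3 * (eta / (3 * (C + 1))))).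
    + apply Rmult_le_compat; try lra.
      generalize (Rabs_pos (x - a)) (Rabs_pos (y - b)) (Rabs_pos (z - c)). lra.
    + right. field. lra.
Qed.

(** * The linear system formed by the last three equations *)

Lemma corr_lin (x xs u f g h : R -> R) a b c : (forall s, continuous x s) -> (forall s, continuous xs s) ->
  (forall s, continuous u s) -> (forall s, continuous f s) -> (forall s, continuous g s) ->
  (forall s, continuous h s) -> forall s,
  corr x xs (fun s => u s + (a * f s + b * g s + c * h s)) s =
  corr x xs u s + (a * corr x xs f s + b * corr x xs g s + c * corr x xs h s).
Proof.
  intros Cx Cs Cu Cf Cg Ch s.
  set (P := fun v => RInt (fun s => v s * xs s) 0 1).
  set (Q := fun v => RInt (fun s => x s * (v s * xs s)) 0 1).
  assert (EP : P (fun s => u s + (a * f s + b * g s + c * h s)) = P u + (a * P f + b * P g + c * P h)).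
  { unfold P. rilin. ring. }
  assert (EQ : Q (fun s => u s + (a * f s + b * g s + c * h s)) = Q u + (a * Q f + b * Q g + c * Q h)).
  { unfold Q. rilin. ring. }
  unfold P in EP. unfold Q in EQ.
  unfold corr, cc1, cc2, gc1, gc2. rewrite EP, EQ. fold (P u) (P f) (P g) (P h) (Q u) (Q f) (Q g) (Q h).
  unfold Rdiv. ring.
Qed.

(** On the circle: the two points are at distance at least [h0], on either side. *)
Definition guard (h0 s r : R) : Prop := h0 <= r - s <= 1 - h0.
Definition cst (f : R -> R) : (nat -> R) -> R -> R -> R := fun _ _ s => f s.

(** The 3 by 3 matrix of the three functionals evaluated on three functions is entrywise within
    [eta] of the identity. *)
Definition near_id (eta : R) (f g h : R -> R) (w : nat -> R) (t s r : R) : Prop :=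
  (Rabs (eq1 (cst f) w t s r - 1) <= eta /\ Rabs (eq1 (cst g) w t s r) <= eta /\ Rabs (eq1 (cst h) w t s r) <= eta) /\
  (Rabs (eq2 (cst f) w t s r) <= eta /\ Rabs (eq2 (cst g) w t s r - 1) <= eta /\ Rabs (eq2 (cst h) w t s r) <= eta) /\
  (Rabs (eq3 (cst f) w t s r) <= eta /\ Rabs (eq3 (cst g) w t s r) <= eta /\ Rabs (eq3 (cst h) w t s r - 1) <= eta).

(** Diagonal dominance: each unknown is at most m plus a sixth of the sum S of the absolute values;
    adding the three gives S <= 3 m + S / 2. *)
Lemma near_id_solve eta f g h w t s r a b c m : eta <= 1 / 6 -> near_id eta f g h w t s r ->
  Rabs (a * eq1 (cst f) w t s r + b * eq1 (cst g) w t s r + c * eq1 (cst h) w t s r) <= m ->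
  Rabs (a * eq2 (cst f) w t s r + b * eq2 (cst g) w t s r + c * eq2 (cst h) w t s r) <= m ->
  Rabs (a * eq3 (cst f) w t s r + b * eq3 (cst g) w t s r + c * eq3 (cst h) w t s r) <= m ->
  Rabs a <= 6 * m /\ Rabs b <= 6 * m /\ Rabs c <= 6 * m.
Proof.
  intros He ((H11 & H12 & H13) & (H21 & H22 & H23) & (H31 & H32 & H33)) E1 E2 E3.
  assert (G : forall p q k x y z m, Rabs (x - 1) <= eta -> Rabs y <= eta -> Rabs z <= eta ->
    Rabs (p * x + q * y + k * z) <= m -> Rabs p <= m + (Rabs p + Rabs q + Rabs k) / 6).
  { clear - He. intros p q k x y z m Hx Hy Hz H.
    replace p with ((p * x + q * y + k * z) + - (p * (x - 1)) + (- (q * y) + - (k * z))) at 1 by ring.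
    triang.
    assert (T := Rabs_triang (p * x + q * y + k * z) (- (p * (x - 1)))).
    assert (T' := Rabs_triang (- (q * y)) (- (k * z))).
    rewrite Rabs_Ropp, Rabs_mult in T. rewrite (Rabs_Ropp (q * y)), (Rabs_Ropp (k * z)), !Rabs_mult in T'.
    assert (M : forall u v, Rabs v <= eta -> Rabs u * Rabs v <= Rabs u / 6).
    { intros u v Hv. unfold Rdiv. apply Rmult_le_compat_l; [apply Rabs_pos|lra]. }
    generalize (M p _ Hx) (M q _ Hy) (M k _ Hz). lra. }
  assert (G1 := G a b c _ _ _ m H11 H12 H13 E1).
  assert (G2 := G b a c _ _ _ m H22 H21 H23).
  assert (G3 := G c a b _ _ _ m H33 H31 H32).
  rewrite (Rplus_comm (b * _) (a * _)) in G2. specialize (G2 E2).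
  replace (c * eq3 (cst h) w t s r + a * eq3 (cst f) w t s r + b * eq3 (cst g) w t s r)
    with (a * eq3 (cst f) w t s r + b * eq3 (cst g) w t s r + c * eq3 (cst h) w t s r) in G3 by ring.
  specialize (G3 E3).
  generalize (Rabs_pos a) (Rabs_pos b) (Rabs_pos c). lra.
Qed.

(** The derivatives are taken at two different nearby points, because the mean value theorem applied
    to both coordinates on a short arc yields two points. *)
Lemma immersion_gap : exists kap h0, 0 < kap /\ 0 < h0 < 1 / 2 /\ forall t s r,
  0 <= s <= 2 -> 0 <= r <= 2 -> Rabs (r - s) <= h0 -> kap <= Ds X t s ^ 2 + Ds Y t r ^ 2.
Proof.
  set (F := fun p => Ds X (tt p) (ss p) ^ 2 + Ds Y (tt p) (rr p) ^ 2).
  assert (BF : BL 2 1 F).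
  { apply (BL_plus 2 1 (fun p => Ds X (tt p) (ss p) ^ 2) (fun p => Ds Y (tt p) (rr p) ^ 2)).
    - apply BL_pow. exact (BL_Xs 0 1).
    - apply (BL_pow 2 1 (fun p => Ds Y (tt p) (rr p))).
      apply (BL_swap 2 1 (fun _ t s => Ds Y t s)). exact (BL_Ys 0 1). }
  destruct (BL_min 2 1 F (fun _ s r => s = r)) as (c & Hc & P); auto; try lra.
  - intros a b c _ N. assert (A : 0 < Rabs (b - c)) by (apply Rabs_pos_lt; lra).
    exists (Rabs (b - c) / 2). split; [lra|]. intros x y z (_ & H2 & H3) ->.
    rewrite Rabs_minus_sym in H2.
    assert (T := Rabs_triang (b - z) (z - c)). replace (b - z + (z - c)) with (b - c) in T by ring. lra.
  - intros t s r _ <-. unfold F; simpl. destruct (IM t s) as [N|N].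
    + assert (A := pow2_gt_0 _ N). assert (B := pow2_ge_0 (Ds Y t s)). simpl in A, B. lra.
    + assert (A := pow2_gt_0 _ N). assert (B := pow2_ge_0 (Ds X t s)). simpl in A, B. lra.
  - destruct BF as (C & HC & _ & L).
    set (h := Rmin (1 / 4) (c / (2 * (C + 1)))).
    assert (H0 : 0 < h) by (apply Rmin_pos; [lra|apply Rdiv_lt_0_compat; lra]).
    assert (H1 : h <= 1 / 4) by apply Rmin_l.
    assert (H2 : h <= c / (2 * (C + 1))) by apply Rmin_r.
    exists (c / 2), h. split; [lra|split; [lra|]]. intros t s r Hs Hr Hsr.
    destruct (period_reduce 2 t) as [k Hk]; [lra|].
    destruct (dper_Ds X pX) as [q1 _], (dper_Ds Y pY) as [q2 _].
    rewrite <- (shift_Z 2 (fun t => Ds X t s) k t), <- (shift_Z 2 (fun t => Ds Y t r) k t) by auto.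
    set (t' := t + 2 * IZR k) in *.
    assert (A := P t' s s ltac:(repeat split; lra) eq_refl).
    assert (B : Rabs (F (Pt zw t' s r) - F (Pt zw t' s s)) <= C * dd 2 (Pt zw t' s r) (Pt zw t' s s)).
    { apply L; (split; [intros i; unfold zw; simpl; rewrite Rabs_R0; lra|simpl; auto]). }
    unfold dd in B; cbn [om tt ss rr] in B. rewrite wd_refl, !Rminus_diag, Rabs_R0 in B.
    apply Rabs_le_between in B. 
    assert (D : C * (0 + 0 + 0 + Rabs (r - s)) <= c / 2).
    { apply Rle_trans with ((C + 1) * h).
      - apply Rmult_le_compat; try lra. generalize (Rabs_pos (r - s)). lra.
      - apply Rle_trans with ((C + 1) * (c / (2 * (C + 1)))); [apply Rmult_le_compat_l; lra|].
        right. field. lra. }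
    change (c <= F (Pt zw t' s s)) in A.
    change (c / 2 <= F (Pt zw t' s r)). lra.
Qed.

Lemma near_diag psi M e1 c kap h0 : (forall j, sm (fun _ s => psi j s)) -> (forall j, periodic (psi j)) ->
  0 < e1 <= 1 -> 0 < c -> (forall w t, small e1 w -> c <= det w t) -> 0 < kap ->
  (forall t s r, 0 <= s <= 2 -> 0 <= r <= 2 -> Rabs (r - s) <= h0 -> kap <= Ds X t s ^ 2 + Ds Y t r ^ 2) ->
  exists e2, 0 < e2 <= e1 /\ forall w t s r, small e2 w -> 0 <= s <= 2 -> 0 <= r <= 2 ->
    Rabs (r - s) <= h0 -> xhs w t s <> 0 \/ yhs psi M w t r <> 0.
Proof.
  intros Sp pp He Hc Hdet Hk HQ.
  set (F := fun p => xhs (om p) (tt p) (ss p) ^ 2 + yhs psi M (om p) (tt p) (rr p) ^ 2).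
  assert (BF : BL (2 + M) e1 F).
  { apply (BL_plus (2 + M) e1 (fun p => xhs (om p) (tt p) (ss p) ^ 2)).
    - apply BL_pow. exact (BL_xhs M e1).
    - apply (BL_pow (2 + M) e1 (fun p => yhs psi M (om p) (tt p) (rr p))).
      apply (BL_swap (2 + M) e1 (yhs psi M)). now apply BL_yhs with c. }
  destruct (BL_stay_pos (2 + M) e1 F kap (proj1 He) BF Hk) as (e2 & He2 & L).
  exists e2. split; auto. intros w t s r Hw Hs Hr Hsr.
  assert (A : kap / 2 <= F (Pt w t s r)).
  { apply L; [split; simpl; auto|]. unfold F, base. cbn [om tt ss rr].
    change (fun _ : nat => 0) with zw.
    destruct (unperturbed psi M zw t (or_introl eq_refl)) as (E1 & E2 & E3).
    rewrite E2. replace (yhs psi M zw t r) with (Ds Y t r); [now apply HQ|].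
    unfold Ds. rewrite <- E3. apply is_derive_unique. now apply is_derive_yh. }
  unfold F in A; cbn [om tt ss rr] in A. apply not_and_or. intros [Z1 Z2]. rewrite Z1, Z2 in A. simpl in A. lra.
Qed.

(* If [Y] takes the same value at both ends of an arc, then [Ds X] does not vanish identically on the
   arc nor, by periodicity, on its complement; this makes the last three equations independent. *)
Lemma local_dual e1 c h0 t0 s0 r0 : 0 < e1 <= 1 -> 0 < c -> (forall w t, small e1 w -> c <= det w t) ->
  0 < h0 -> in_box 0 1 t0 s0 r0 ->
  exists d (u : (R -> R) * (R -> R) * (R -> R)), 0 < d /\
    ((sm (fun _ s => fst (fst u) s) /\ periodic (fst (fst u))) /\
     (sm (fun _ s => snd (fst u) s) /\ periodic (snd (fst u))) /\
     (sm (fun _ s => snd u s) /\ periodic (snd u))) /\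
    forall t s r, close3 d t0 s0 r0 t s r -> in_box 0 1 t s r ->
      ~ guard h0 s r \/ d <= (Y t s - Y t r) ^ 2 \/
      near_id (1 / 12) (fst (fst u)) (snd (fst u)) (snd u) zw t s r.
Proof.
  intros He Hc Hdet Hh Hbox.
  assert (zs : sm (fun _ _ => 0) /\ periodic (fun _ : R => 0)) by (split; [apply sm_const|intros s; auto]).
  assert (up : forall x y z, in_box 0 1 x y z -> in_box 0 2 x y z).
  { intros x y z (A1 & A2 & A3). repeat split; lra. }
  destruct (classic (guard h0 s0 r0)) as [Hg|Hg].
  2: { assert (N : r0 - s0 < h0 \/ 1 - h0 < r0 - s0).
       { unfold guard in Hg. destruct (Rlt_le_dec (r0 - s0) h0); auto. right.
         destruct (Rlt_le_dec (1 - h0) (r0 - s0)); auto. exfalso. apply Hg. lra. }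
       destruct N as [N|N].
       - exists ((h0 - (r0 - s0)) / 4), (fun _ => 0, fun _ => 0, fun _ => 0).
         split; [lra|split; [auto|]]. intros t s r (_ & H2 & H3) _. left.
         apply Rabs_lt_between' in H2, H3. unfold guard. lra.
       - exists (((r0 - s0) - (1 - h0)) / 4), (fun _ => 0, fun _ => 0, fun _ => 0).
         split; [lra|split; [auto|]]. intros t s r (_ & H2 & H3) _. left.
         apply Rabs_lt_between' in H2, H3. unfold guard. lra. }
  assert (Hsr : s0 < r0 < s0 + 1) by (unfold guard in Hg; lra).
  (* Where the values of [Y] differ, they stay apart nearby and the triple is filled with zero
     functions. *)
  destruct (Req_dec (Y t0 s0) (Y t0 r0)) as [EY|NY].
  2: { set (F := fun p => (Y (tt p) (ss p) - Y (tt p) (rr p)) ^ 2).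
       assert (BF : BL 2 1 F).
       { apply (BL_pow 2 1 (fun p => Y (tt p) (ss p) - Y (tt p) (rr p))).
         apply (BL_minus 2 1 (fun p => Y (tt p) (ss p)) (fun p => Y (tt p) (rr p))).
         - exact (BL_Y 0 1).
         - apply (BL_swap 2 1 (fun _ t s => Y t s)). exact (BL_Y 0 1). }
       assert (Pv : 0 < (Y t0 s0 - Y t0 r0) ^ 2) by (apply pow2_gt_0; lra).
       destruct (BL_cont_base 2 1 F t0 s0 r0 ((Y t0 s0 - Y t0 r0) ^ 2 / 2) Rle_0_1 BF (up _ _ _ Hbox)) as (d & Hd & L); [lra|].
       exists (Rmin d ((Y t0 s0 - Y t0 r0) ^ 2 / 2)), (fun _ => 0, fun _ => 0, fun _ => 0).
       split; [apply Rmin_pos; lra|split; [auto|]].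
       assert (L1 := Rmin_l d ((Y t0 s0 - Y t0 r0) ^ 2 / 2)). assert (L2 := Rmin_r d ((Y t0 s0 - Y t0 r0) ^ 2 / 2)).
       intros t s r (C1 & C2 & C3) Hb. right. left.
       assert (A := L t s r ltac:(repeat split; lra) (up _ _ _ Hb)).
       unfold F in A; cbn [tt ss rr] in A. apply Rabs_le_between in A. lra. }
  assert (N1 := arc_nonconst X Y t0 s0 r0 FAM ltac:(lra) EY).
  assert (N2 := arc_nonconst X Y t0 r0 (s0 + 1) FAM ltac:(lra)
    (eq_trans (eq_sym EY) (eq_sym (proj2 pY t0 s0)))).
  assert (dual : forall p1 p2 p3, exists f, (sm (fun _ s => f s) /\ periodic f) /\
     eq1 (cst f) zw t0 s0 r0 = p1 /\ eq2 (cst f) zw t0 s0 r0 = p2 /\ eq3 (cst f) zw t0 s0 r0 = p3).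
  { intros p1 p2 p3.
    destruct (dual_exists X t0 s0 r0 p1 p2 p3 SX pX Hsr N1 N2) as (f & Sf & pf & L1 & L2 & L3 & L4 & L5).
    exists f. split; [auto|].
    destruct (unperturbed (fun _ _ => 0) 0 zw t0 (or_introl eq_refl)) as (E1 & E2 & _).
    (* [f] has vanishing moments over the circle, so the correction fixes it. *)
    assert (E : yU (cst f) zw t0 = f).
    { extensionality v. unfold yU. rewrite E1, E2. now apply corr_id. }
    unfold eq1, eq2, eq3. rewrite E, E1, E2. auto. }
  destruct (dual 1 0 0) as (f & Pf & F1 & F2 & F3).
  destruct (dual 0 1 0) as (g & Pg & G1 & G2 & G3).
  destruct (dual 0 0 1) as (h & Ph & H1 & H2 & H3).
  (* Of the tolerance 1 / 6 of [near_id_solve], half is spent here on moving the point and half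
     later on the parameters. *)
  assert (near : forall f, sm (fun _ s => f s) -> periodic f -> exists d, 0 < d /\
     forall t s r, close3 d t0 s0 r0 t s r -> in_box 0 1 t s r ->
       Rabs (eq1 (cst f) zw t s r - eq1 (cst f) zw t0 s0 r0) <= 1 / 12 /\
       Rabs (eq2 (cst f) zw t s r - eq2 (cst f) zw t0 s0 r0) <= 1 / 12 /\
       Rabs (eq3 (cst f) zw t s r - eq3 (cst f) zw t0 s0 r0) <= 1 / 12).
  { intros k Sk pk.
    destruct (BL_eqs 0 e1 c Hc Hdet (cst k)) as (B1 & B2 & B3).
    { intros w t s. exact (sm_continuous _ Sk 0 s). }
    { apply (BL_sm 2 e1 (fun _ s => k s)); auto. split; intros t s; auto. }
    assert (P12 : 0 < 1 / 12) by lra.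
    destruct (BL_cont_base _ e1 _ t0 s0 r0 _ (Rlt_le _ _ (proj1 He)) B1 (up _ _ _ Hbox) P12) as (d1 & Hd1 & L1).
    destruct (BL_cont_base _ e1 _ t0 s0 r0 _ (Rlt_le _ _ (proj1 He)) B2 (up _ _ _ Hbox) P12) as (d2 & Hd2 & L2).
    destruct (BL_cont_base _ e1 _ t0 s0 r0 _ (Rlt_le _ _ (proj1 He)) B3 (up _ _ _ Hbox) P12) as (d3 & Hd3 & L3).
    assert (A1 := Rmin_l d1 (Rmin d2 d3)). assert (A2 := Rmin_r d1 (Rmin d2 d3)).
    assert (A3 := Rmin_l d2 d3). assert (A4 := Rmin_r d2 d3).
    exists (Rmin d1 (Rmin d2 d3)). split; [repeat apply Rmin_pos; auto|].
    intros t s r (C1 & C2 & C3) Hb.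
    split; [|split]; [apply L1|apply L2|apply L3]; auto; repeat split; lra. }
  destruct (near f (proj1 Pf) (proj2 Pf)) as (d1 & Hd1 & K1).
  destruct (near g (proj1 Pg) (proj2 Pg)) as (d2 & Hd2 & K2).
  destruct (near h (proj1 Ph) (proj2 Ph)) as (d3 & Hd3 & K3).
  assert (A1 := Rmin_l d1 (Rmin d2 d3)). assert (A2 := Rmin_r d1 (Rmin d2 d3)).
  assert (A3 := Rmin_l d2 d3). assert (A4 := Rmin_r d2 d3).
  exists (Rmin d1 (Rmin d2 d3)), (f, g, h). split; [repeat apply Rmin_pos; auto|split; [auto|]].
  intros t s r (C1 & C2 & C3) Hb. right. right.
  destruct (K1 t s r) as (U1 & U2 & U3); auto; [repeat split; lra|].
  destruct (K2 t s r) as (V1 & V2 & V3); auto; [repeat split; lra|].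
  destruct (K3 t s r) as (W1 & W2 & W3); auto; [repeat split; lra|].
  rewrite ?F1, ?F2, ?F3, ?G1, ?G2, ?G3, ?H1, ?H2, ?H3, ?Rminus_0_r in *.
  unfold near_id; simpl. auto 10.
Qed.

Lemma finite_duals e1 c h0 : 0 < e1 <= 1 -> 0 < c -> (forall w t, small e1 w -> c <= det w t) ->
  0 < h0 -> exists d (psi : nat -> R -> R) (N : nat), 0 < d /\ (0 < N)%nat /\
    (forall j, sm (fun _ s => psi j s)) /\ (forall j, periodic (psi j)) /\
    forall t s r, in_box 0 1 t s r -> guard h0 s r -> exists i, (i < N)%nat /\
      (d <= (Y t s - Y t r) ^ 2 \/
       near_id (1 / 12) (psi (3 * i)%nat) (psi (3 * i + 1)%nat) (psi (3 * i + 2)%nat) zw t s r).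
Proof.
  intros He Hc Hdet Hh.
  destruct (box_choice 0 1
    (fun u : (R -> R) * (R -> R) * (R -> R) =>
    ((sm (fun _ s => fst (fst u) s) /\ periodic (fst (fst u))) /\
     (sm (fun _ s => snd (fst u) s) /\ periodic (snd (fst u))) /\
     (sm (fun _ s => snd u s) /\ periodic (snd u))))
    (fun t s r d u => ~ guard h0 s r \/ d <= (Y t s - Y t r) ^ 2 \/
      near_id (1 / 12) (fst (fst u)) (snd (fst u)) (snd u) zw t s r)) as (d & l & Hd & Hl & Cov).
  - intros x y z d d' u Hd [H|[H|H]]; auto. right; left. lra.
  - intros a b r Hb. now apply (local_dual e1 c).
  - set (dflt := (fun _ : R => 0, fun _ : R => 0, fun _ : R => 0)).
    (* The triples are flattened: index 3 i + k stands for the k-th function of the i-th triple. *)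
    set (psi := fun j => let u := nth (j / 3) l dflt in
       match (j mod 3)%nat with O => fst (fst u) | 1%nat => snd (fst u) | _ => snd u end).
    assert (Q : forall i, let u := nth i l dflt in
       (sm (fun _ s => fst (fst u) s) /\ periodic (fst (fst u))) /\
       (sm (fun _ s => snd (fst u) s) /\ periodic (snd (fst u))) /\
       (sm (fun _ s => snd u s) /\ periodic (snd u))).
    { intros i u. destruct (nth_in_or_default i l dflt) as [H|H]; [now apply Hl|].
      unfold u. rewrite H. unfold dflt; simpl.
      assert (zs : sm (fun _ _ => 0) /\ periodic (fun _ : R => 0)) by (split; [apply sm_const|intros s; auto]).
      auto. }
    (* The successor makes the number of triples positive, which secures the four parameters needed
       by the count; the extra triple consists of zero functions. *)
    exists d, psi, (S (length l)). split; [auto|split; [lia|split; [|split]]].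
    + intros j. unfold psi. destruct (Q (j / 3)%nat) as ((Q1 & _) & (Q2 & _) & (Q3 & _)).
      destruct (j mod 3)%nat as [|[|]]; auto.
    + intros j. unfold psi. destruct (Q (j / 3)%nat) as ((_ & Q1) & (_ & Q2) & (_ & Q3)).
      destruct (j mod 3)%nat as [|[|]]; auto.
    + intros t s r Hb Hg. destruct (Cov t s r Hb) as (u & Hu & P).
      destruct (In_nth l u dflt Hu) as (i & Hi & Ei).
      exists i. split; [lia|]. destruct P as [P|[P|P]]; [now destruct P|auto|]. right.
      assert (D : forall k, (k < 3)%nat -> ((3 * i + k) / 3 = i /\ (3 * i + k) mod 3 = k)%nat).
      { intros k Hk. split.
        - symmetry. apply (Nat.div_unique (3 * i + k) 3 i k); lia.
        - symmetry. apply (Nat.mod_unique (3 * i + k) 3 i k); lia. }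
      destruct (D 0%nat ltac:(lia)) as [D0 D0'], (D 1%nat ltac:(lia)) as [D1 D1'], (D 2%nat ltac:(lia)) as [D2 D2'].
      rewrite Nat.add_0_r in D0, D0'.
      unfold psi. rewrite D0, D0', D1, D1', D2, D2', Ei. exact P.
Qed.

(** * General position *)

Definition eq0 (w : nat -> R) (t s r : R) : R := xh w t s - xh w t r.

Lemma lin_diff3 (psi : nat -> R -> R) m w w' j1 j2 j3 s : j1 <> j2 -> j1 <> j3 -> j2 <> j3 ->
  (forall k, k <> (2 + j1)%nat -> k <> (2 + j2)%nat -> k <> (2 + j3)%nat -> w k = w' k) ->
  (j1 < m)%nat -> (j2 < m)%nat -> (j3 < m)%nat ->
  lin psi m w s = lin psi m w' s + ((w (2 + j1)%nat - w' (2 + j1)%nat) * psi j1 s +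
     (w (2 + j2)%nat - w' (2 + j2)%nat) * psi j2 s + (w (2 + j3)%nat - w' (2 + j3)%nat) * psi j3 s).
Proof.
  intros N1 N2 N3 E.
  set (T := fun j m => if Nat.ltb j m then (w (2 + j)%nat - w' (2 + j)%nat) * psi j s else 0).
  assert (G : lin psi m w s = lin psi m w' s + (T j1 m + T j2 m + T j3 m)).
  { induction m as [|m IH].
    - unfold T; simpl. ring.
    - assert (St : forall j, T j (S m) = T j m + (if Nat.eqb j m then (w (2 + j)%nat - w' (2 + j)%nat) * psi j s else 0)).
      { intros j. unfold T. destruct (Nat.ltb_spec j (S m)), (Nat.ltb_spec j m), (Nat.eqb_spec j m); try lia; ring. }
      rewrite !St. simpl lin. rewrite IH.
      destruct (Nat.eqb_spec j1 m), (Nat.eqb_spec j2 m), (Nat.eqb_spec j3 m); try lia; subst; simpl Nat.add in *; try ring.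
      rewrite (E (S (S m))) by lia. ring. }
  intros L1 L2 L3. rewrite G. unfold T.
  apply Nat.ltb_lt in L1, L2, L3. now rewrite L1, L2, L3.
Qed.

(** The chord between the two points of the unit circle has length 2 sin (PI (r - s)), at least
    twice the bound, so one of its two coordinates reaches the bound. *)
Lemma chord_lower h0 s r : 0 < h0 < 1 / 2 -> guard h0 s r ->
  sin (PI * h0) <= Rabs (c1 s - c1 r) \/ sin (PI * h0) <= Rabs (s1 s - s1 r).
Proof.
  intros Hh [G1 G2]. assert (P := PI_RGT_0).
  set (sg := sin (PI * h0)).
  assert (Hs : 0 < sg) by (apply sin_gt_0; nra).
  assert (Hs' : sg <= sin (PI * (r - s))).
  { destruct (Rle_dec (r - s) (1 / 2)).
    - apply sin_incr_1; nra.
    - rewrite <- (sin_PI_x (PI * (r - s))). apply sin_incr_1; nra. }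
  assert (E : (c1 s - c1 r) ^ 2 + (s1 s - s1 r) ^ 2 = 4 * sin (PI * (r - s)) ^ 2).
  { assert (A := sin2_cos2 (2 * PI * s)). assert (B := sin2_cos2 (2 * PI * r)).
    assert (D : cos (2 * (PI * (r - s))) = cos (2 * PI * r) * cos (2 * PI * s) + sin (2 * PI * r) * sin (2 * PI * s)).
    { rewrite <- cos_minus. f_equal. ring. }
    rewrite cos_2a_sin in D. unfold c1, s1. unfold Rsqr in A, B.
    transitivity ((sin (2 * PI * s) * sin (2 * PI * s) + cos (2 * PI * s) * cos (2 * PI * s)) +
      (sin (2 * PI * r) * sin (2 * PI * r) + cos (2 * PI * r) * cos (2 * PI * r)) -
      2 * (cos (2 * PI * r) * cos (2 * PI * s) + sin (2 * PI * r) * sin (2 * PI * s))); [ring|].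
    rewrite A, B, <- D. ring. }
  destruct (Rle_dec sg (Rabs (c1 s - c1 r))) as [|N1]; auto.
  destruct (Rle_dec sg (Rabs (s1 s - s1 r))) as [|N2]; auto. exfalso.
  assert (Q : forall x, ~ sg <= Rabs x -> x ^ 2 < sg ^ 2).
  { intros x Hx. rewrite <- (pow2_abs x). generalize (Rabs_pos x). nra. }
  apply Q in N1, N2. assert (sg ^ 2 <= sin (PI * (r - s)) ^ 2) by (apply pow_incr; lra).
  assert (0 < sg ^ 2) by nra. lra.
Qed.

Definition wpar (e : R) (n : nat) (om : nat -> nat) (k : nat) : R := e * (INR (om k) / INR n).

Lemma wpar_small e n om : 0 < e -> (0 < n)%nat -> (forall k, (om k < n)%nat) -> small e (wpar e n om).
Proof.
  intros He Hn H k. unfold wpar. assert (Pn : 0 < INR n) by now apply lt_0_INR.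
  assert (Pk := pos_INR (om k)). assert (Lk := lt_INR _ _ (H k)).
  assert (0 <= INR (om k) / INR n <= 1).
  { split; [now apply Rdiv_le_0_compat|]. apply Rle_div_l; lra. }
  rewrite Rabs_pos_eq; nra.
Qed.

(** Grid values are e / n apart, so parameters at distance at most D / n have indices less than W
    apart. *)
Lemma wpar_apart e n om om' k W D : 0 < e -> (0 < n)%nat ->
  om k = om' k \/ (om k + W <= om' k)%nat \/ (om' k + W <= om k)%nat ->
  Rabs (wpar e n om k - wpar e n om' k) <= D / INR n -> D < e * INR W -> om k = om' k.
Proof.
  intros He Hn [H|H] B HW; auto. exfalso. unfold wpar in B.
  assert (Pn : 0 < INR n) by now apply lt_0_INR.
  assert (Pi : 0 < / INR n) by now apply Rinv_0_lt_compat.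
  replace (e * (INR (om k) / INR n) - e * (INR (om' k) / INR n)) with
    (e * (INR (om k) - INR (om' k)) * / INR n) in B by (field; lra).
  rewrite Rabs_mult, (Rabs_pos_eq (/ INR n)) in B by lra. unfold Rdiv in B.
  apply Rmult_le_reg_r in B; auto. rewrite Rabs_mult, (Rabs_pos_eq e) in B by lra.
  assert (INR W <= Rabs (INR (om k) - INR (om' k))).
  { destruct H as [H|H]; apply le_INR in H; rewrite plus_INR in H.
    - rewrite Rabs_left1; generalize (pos_INR W); lra.
    - rewrite Rabs_pos_eq; generalize (pos_INR W); lra. }
  assert (e * INR W <= e * Rabs (INR (om k) - INR (om' k))) by (apply Rmult_le_compat_l; lra). lra.
Qed.

Definition in_cell (n a : nat) (x : R) : Prop := INR a <= INR n * x < INR a + 1.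

Lemma in_cell_exists n x : 0 <= x < 1 -> (0 < n)%nat -> exists a, (a < n)%nat /\ in_cell n a x.
Proof.
  intros Hx Hn. assert (Pn : 0 < INR n) by now apply lt_0_INR.
  destruct (nfloor_ex (INR n * x)) as (a & Ha); [nra|]. exists a. split; auto.
  apply INR_lt. nra.
Qed.

Lemma in_cell_close n a x y : (0 < n)%nat -> in_cell n a x -> in_cell n a y -> Rabs (x - y) <= 1 / INR n.
Proof.
  intros Hn [H1 H2] [H3 H4]. assert (Pn : 0 < INR n) by now apply lt_0_INR.
  assert (A : Rabs (INR n * (x - y)) <= 1) by (apply Rabs_le; lra).
  rewrite Rabs_mult, (Rabs_pos_eq (INR n)) in A by lra. apply Rle_div_r; lra.
Qed.

Definition lip (e C : R) (F : (nat -> R) -> R -> R -> R -> R) : Prop :=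
  forall w t s r t' s' r', small e w -> 0 <= s <= 2 -> 0 <= r <= 2 -> 0 <= s' <= 2 -> 0 <= r' <= 2 ->
    Rabs (F w t s r - F w t' s' r') <= C * (Rabs (t - t') + Rabs (s - s') + Rabs (r - r')).

Lemma lip_common K e l : (forall F, In F l -> BL K e (fun p => F (om p) (tt p) (ss p) (rr p))) ->
  exists C, 0 <= C /\ forall F, In F l -> lip e C F.
Proof.
  induction l as [|F l IH]; intros H; [exists 0; split; [lra|intros F []]|].
  destruct IH as (C & HC & HL); [intros; apply H; now right|].
  destruct (H F (or_introl eq_refl)) as (C' & HC' & _ & L).
  exists (C + C'). split; [lra|]. intros G HG w t s r t' s' r' Hw Hs Hr Hs' Hr'.
  set (D := Rabs (t - t') + Rabs (s - s') + Rabs (r - r')).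
  assert (HD : 0 <= D)
    by (unfold D; generalize (Rabs_pos (t - t')) (Rabs_pos (s - s')) (Rabs_pos (r - r')); lra).
  assert (P := Rmult_le_pos _ _ HC HD). assert (P' := Rmult_le_pos _ _ HC' HD).
  destruct HG as [<-|HG].
  - assert (A := L (Pt w t s r) (Pt w t' s' r') (conj Hw (conj Hs Hr)) (conj Hw (conj Hs' Hr'))).
    unfold dd in A; cbn [om tt ss rr] in A. rewrite wd_refl, Rplus_0_l in A. fold D in A. lra.
  - assert (A := HL G HG w t s r t' s' r' Hw Hs Hr Hs' Hr'). fold D in A. lra.
Qed.

(** The square of [eq1] is listed too because it is what stays bounded below where the values of y
    differ. *)
Definition equations (psi : nat -> R -> R) (M : nat) : list ((nat -> R) -> R -> R -> R -> R) :=
  eq0 :: eq1 (uh psi M) :: eq2 (uh psi M) :: eq3 (uh psi M) ::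
  (fun w t s r => eq1 (uh psi M) w t s r ^ 2) :: nil.

(** The two parameters agree in the coordinates that move x, so the correction is the same linear
    operator for both. *)
Lemma eqs_lin psi M w w' j1 j2 j3 t s r : (forall j, sm (fun _ s => psi j s)) ->
  j1 <> j2 -> j1 <> j3 -> j2 <> j3 -> (j1 < M)%nat -> (j2 < M)%nat -> (j3 < M)%nat ->
  (forall k, k <> (2 + j1)%nat -> k <> (2 + j2)%nat -> k <> (2 + j3)%nat -> w k = w' k) ->
  let a := beta t * (w (2 + j1)%nat - w' (2 + j1)%nat) in
  let b := beta t * (w (2 + j2)%nat - w' (2 + j2)%nat) in
  let c := beta t * (w (2 + j3)%nat - w' (2 + j3)%nat) in
  forall q, q = eq1 \/ q = eq2 \/ q = eq3 ->
  a * q (cst (psi j1)) w t s r + b * q (cst (psi j2)) w t s r + c * q (cst (psi j3)) w t s r =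
  q (uh psi M) w t s r - q (uh psi M) w' t s r.
Proof.
  intros Sp N1 N2 N3 L1 L2 L3 E a b c q Hq.
  assert (Ex : xh w t = xh w' t).
  { extensionality v. unfold xh. now rewrite (E 0%nat), (E 1%nat) by lia. }
  assert (Exs : xhs w t = xhs w' t).
  { extensionality v. unfold xhs. now rewrite (E 0%nat), (E 1%nat) by lia. }
  assert (Cx := cont_xh w t). assert (Cs := cont_xhs w t).
  assert (Cp : forall j s, continuous (psi j) s) by (intros; apply (sm_continuous _ (Sp j) 0)).
  assert (Cu := cont_uh psi M Sp w' t).
  assert (Ey : forall v, yU (uh psi M) w t v = yU (uh psi M) w' t v +
    (a * yU (cst (psi j1)) w t v + b * yU (cst (psi j2)) w t v + c * yU (cst (psi j3)) w t v)).
  { intros v. unfold yU. rewrite <- Ex, <- Exs.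
    rewrite <- (corr_lin (xh w t) (xhs w t) (uh psi M w' t) (psi j1) (psi j2) (psi j3) a b c); auto.
    f_equal. extensionality u. unfold uh. rewrite (lin_diff3 psi M w w' j1 j2 j3 u) by auto.
    unfold a, b, c. ring. }
  assert (C1 : forall v, continuous (yU (uh psi M) w' t) v).
  { intros v. apply (cont_corr w' t). exact Cu. }
  assert (C2 : forall j v, continuous (yU (cst (psi j)) w t) v).
  { intros j v. apply (cont_corr w t). intros u. apply Cp. }
  destruct Hq as [-> |[-> | ->]].
  - unfold eq1. rewrite (Ey s), (Ey r). ring.
  - unfold eq2. rewrite <- Exs.
    rewrite (RInt_ext (fun v => yU (uh psi M) w t v * xhs w t v) (fun v => yU (uh psi M) w' t v * xhs w t v +
      (a * (yU (cst (psi j1)) w t v * xhs w t v) + b * (yU (cst (psi j2)) w t v * xhs w t v) +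
       c * (yU (cst (psi j3)) w t v * xhs w t v)))).
    + rewrite !RIplus, !RIscal by (intros; cont). req. ring.
    + intros v _. rewrite Ey. req. ring.
  - unfold eq3. rewrite <- Exs, <- Ex.
    rewrite (RInt_ext (fun v => xh w t v * (yU (uh psi M) w t v * xhs w t v))
     (fun v => xh w t v * (yU (uh psi M) w' t v * xhs w t v) +
      (a * (xh w t v * (yU (cst (psi j1)) w t v * xhs w t v)) + b * (xh w t v * (yU (cst (psi j2)) w t v * xhs w t v)) +
       c * (xh w t v * (yU (cst (psi j3)) w t v * xhs w t v))))).
    + rewrite !RIplus, !RIscal by (intros; cont). req. ring.
    + intros v _. rewrite Ey. req. ring.
Qed.

Lemma double_point_eqs psi M w t s r :
  double_point (xh w t) (yh psi M w t) (xhs w t) s r ->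
  eq0 w t s r = 0 /\ eq1 (uh psi M) w t s r = 0 /\
  eq2 (uh psi M) w t s r = 0 /\ eq3 (uh psi M) w t s r = 0.
Proof.
  intros (D1 & D2 & D3 & D4). unfold eq0, eq1, eq2, eq3.
  change (yU (uh psi M) w t) with (yh psi M w t).
  split; [lra|split; [lra|auto]].
Qed.

(* The four coordinates of a cell: one of the two that move [x], then, [x] being fixed, three that
   move [y]. *)
Lemma counting_step psi N e C d h0 tau : (forall j, sm (fun _ s => psi j s)) ->
  (0 < N)%nat -> 0 < e -> 0 <= C -> 0 < d -> 0 < h0 < 1 / 2 -> 0 < tau <= 1 / 2 ->
  let M := (3 * N)%nat in
  (forall F, In F (equations psi M) -> lip e C F) ->
  (forall t s r, in_box 0 1 t s r -> guard h0 s r -> exists i, (i < N)%nat /\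
     ((forall w, small e w -> d <= eq1 (uh psi M) w t s r ^ 2) \/
      (forall w, small e w ->
        near_id (1 / 6) (psi (3 * i)%nat) (psi (3 * i + 1)%nat) (psi (3 * i + 2)%nat) w t s r))) ->
  exists w, small e w /\ forall t s r, tau <= t <= 1 - tau -> 0 <= s < 1 -> 0 <= r < 1 ->
    guard h0 s r -> ~ double_point (xh w t) (yh psi M w t) (xhs w t) s r.
Proof.
  intros Sp HN He HC Hd Hh Htau M HL Cov.
  set (sg := sin (PI * h0)).
  assert (P := PI_RGT_0).
  assert (Hsg : 0 < sg <= 1).
  { split; [apply sin_gt_0; nra|]. apply SIN_bound. }
  set (b0 := beta tau).
  assert (Hb0 : 0 < b0) by (apply beta_gt_0; lra).
  assert (Hbs : 0 < b0 * sg) by (apply Rmult_lt_0_compat; lra).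
  (* A double point in the cell leaves each equation at most 3 C / n at a representative; two bad
     parameters double this, and solving the linear system costs a factor 6. Division by beta >= b0,
     and for the x-equation by sg <= 1, gives D / n in all four coordinates. *)
  set (D := 36 * C / (b0 * sg)).
  assert (HD : 0 <= D) by (apply Rdiv_le_0_compat; lra).
  destruct (nfloor_ex (D / e)) as (W' & HW); [now apply Rdiv_le_0_compat|].
  set (W := S W').
  assert (HWD : D < e * INR W).
  { unfold W. rewrite S_INR. assert (D / e < INR W' + 1) by lra.
    apply Rlt_div_l in H; lra. }
  destruct (nfloor_ex (6 * C / d)) as (n' & Hn'); [apply Rdiv_le_0_compat; lra|].
  (* The first summand ensures W^4 < n, the second that the variation 3 C / n over a cell stays
     below [d]. *)
  set (n := (S (W * (W * (W * W))) + n')%nat).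
  assert (Hn : (0 < n)%nat) by (unfold n; lia).
  assert (Pn : 0 < INR n) by now apply lt_0_INR.
  assert (Hnd : 3 * C / INR n < d).
  { apply Rlt_div_l; auto.
    assert (6 * C / d < INR n).
    { apply Rlt_le_trans with (INR n' + 1); [lra|]. unfold n. rewrite plus_INR, S_INR.
      generalize (pos_INR (W * (W * (W * W)))). lra. }
    apply Rlt_div_l in H; auto. lra. }
  set (bad := fun a b c om => exists t s r, in_cell n a t /\ in_cell n b s /\ in_cell n c r /\
     tau <= t <= 1 - tau /\ 0 <= s < 1 /\ 0 <= r < 1 /\ guard h0 s r /\
     double_point (xh (wpar e n om) t) (yh psi M (wpar e n om) t) (xhs (wpar e n om) t) s r).
  destruct (Counting.good_parameter (2 + M) n W bad) as (om & Hom & Good).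
  - unfold n. lia.
  - unfold W. lia.
  - unfold M. lia.
  - intros a b c _ _ _.
    (* If no parameter is bad for the cell, any four indices serve. *)
    match goal with |- ?G =>
      assert (vacuous : (forall om, (forall k, (om k < n)%nat) -> bad a b c om -> False) -> G) end.
    { intros V. exists (0 :: 1 :: 2 :: 3 :: nil)%nat. split; [|split; [auto|split]].
      - repeat constructor; simpl; lia.
      - intros k Hk. simpl in Hk. unfold M. lia.
      - intros om om' Hom _ B. now destruct (V om). }
    destruct (classic (exists t s r, in_cell n a t /\ in_cell n b s /\ in_cell n c r /\
       tau <= t <= 1 - tau /\ 0 <= s < 1 /\ 0 <= r < 1 /\ guard h0 s r)) as [Rep|Rep].
    2: { apply vacuous. intros om _ (t & s & r & B1 & B2 & B3 & B4 & B5 & B6 & B7 & _). apply Rep.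
         exists t, s, r. auto 10. }
    (* One point of the cell serves for all its bad parameters, whose double points lie within 1 / n
       of it in each variable. *)
    destruct Rep as (t0 & s0 & r0 & Ct & Cs & Cr & Ht & Hs & Hr & Hg).
    assert (Hbox : in_box 0 1 t0 s0 r0) by (repeat split; lra).
    assert (bad_small : forall om F, (forall k, (om k < n)%nat) -> In F (equations psi M) -> bad a b c om ->
       (forall t s r, double_point (xh (wpar e n om) t) (yh psi M (wpar e n om) t) (xhs (wpar e n om) t) s r ->
          F (wpar e n om) t s r = 0) -> Rabs (F (wpar e n om) t0 s0 r0) <= 3 * C / INR n).
    { intros om F Hom LF (t & s & r & B1 & B2 & B3 & B4 & B5 & B6 & B7 & B8) Z.
      assert (A := HL F LF (wpar e n om) t0 s0 r0 t s r (wpar_small e n om He Hn Hom)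
        ltac:(lra) ltac:(lra) ltac:(lra) ltac:(lra)).
      rewrite (Z t s r B8), Rminus_0_r in A.
      assert (U1 := in_cell_close n a t0 t Hn Ct B1). assert (U2 := in_cell_close n b s0 s Hn Cs B2).
      assert (U3 := in_cell_close n c r0 r Hn Cr B3).
      apply Rle_trans with (1 := A).
      replace (3 * C / INR n) with (C * (1 / INR n + 1 / INR n + 1 / INR n)) by (field; lra).
      apply Rmult_le_compat_l; lra. }
    destruct (Cov t0 s0 r0 Hbox Hg) as (i & Hi & [Far|Near]).
    + apply vacuous. intros om Hom B.
      assert (A := bad_small om (fun w t s r => eq1 (uh psi M) w t s r ^ 2) Hom ltac:(simpl; auto 6) B).
      assert (F := Far (wpar e n om) (wpar_small e n om He Hn Hom)).
      assert (A' : Rabs (eq1 (uh psi M) (wpar e n om) t0 s0 r0 ^ 2) <= 3 * C / INR n).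
      { apply A. intros t s r D0. apply double_point_eqs in D0. destruct D0 as (_ & -> & _). ring. }
      apply Rabs_le_between in A'. lra.
    + assert (Hb : b0 <= beta t0) by now apply beta_pos.
      (* [m0] is the x-parameter whose function separates [s0] from [r0]; the other one, [m1], is
         outside [J] and so common to both parameters. *)
      assert (mu : exists m0 m1 v, ((m0 = 0%nat /\ m1 = 1%nat) \/ (m0 = 1%nat /\ m1 = 0%nat)) /\ sg <= Rabs v /\
         forall w w', w m1 = w' m1 -> eq0 w t0 s0 r0 - eq0 w' t0 s0 r0 = beta t0 * (w m0 - w' m0) * v).
      { destruct (chord_lower h0 s0 r0 Hh Hg) as [V|V].
        - exists 0%nat, 1%nat, (c1 s0 - c1 r0). split; [auto|split; [auto|]]. intros w w' E.
          unfold eq0, xh. rewrite E. ring.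
        - exists 1%nat, 0%nat, (s1 s0 - s1 r0). split; [auto|split; [auto|]]. intros w w' E.
          unfold eq0, xh. rewrite E. ring. }
      destruct mu as (m0 & m1 & v & Hm & Hv & Hmu).
      set (j1 := (3 * i)%nat) in *. set (j2 := (3 * i + 1)%nat) in *. set (j3 := (3 * i + 2)%nat) in *.
      assert (Hj : (j1 < j2 < j3 /\ j3 < M)%nat) by (unfold j1, j2, j3, M; lia).
      exists (m0 :: (2 + j1) :: (2 + j2) :: (2 + j3) :: nil)%nat. split; [|split; [auto|split]].
      * repeat constructor; simpl; lia.
      * intros k Hk. simpl in Hk. lia.
      * intros om om' Hom Hom' Bd Bd' Off On.
        set (w := wpar e n om) in *. set (w' := wpar e n om') in *.
        assert (Offw : forall k, k <> m0 -> k <> (2 + j1)%nat -> k <> (2 + j2)%nat -> k <> (2 + j3)%nat -> w k = w' k).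
        { intros k K0 K1 K2 K3. unfold w, w', wpar. rewrite Off; auto. simpl. lia. }
        assert (both : forall F, In F (equations psi M) ->
           (forall w t s r, double_point (xh w t) (yh psi M w t) (xhs w t) s r -> F w t s r = 0) ->
           Rabs (F w t0 s0 r0 - F w' t0 s0 r0) <= 6 * C / INR n).
        { intros F LF Z.
          assert (A := bad_small om F Hom LF Bd (Z w)). assert (A' := bad_small om' F Hom' LF Bd' (Z w')).
          fold w in A. fold w' in A'.
          replace (6 * C / INR n) with (3 * C / INR n + 3 * C / INR n) by (field; lra).
          unfold Rminus. triang. rewrite Rabs_Ropp. lra. }
        assert (Hbn : 0 < beta t0) by lra.
        assert (Pin : 0 < / INR n) by now apply Rinv_0_lt_compat.
        (* This has to come first: only when the x-coordinates coincide are the differences of the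
           other three equations linear in the differences of the parameters. *)
        assert (Em : om m0 = om' m0).
        { apply (wpar_apart e n om om' m0 W D); auto; [apply On; simpl; auto|].
          assert (A := both eq0 ltac:(simpl; auto) (fun w t s r D0 => proj1 (double_point_eqs psi M w t s r D0))).
          rewrite Hmu in A by (apply Offw; lia).
          rewrite !Rabs_mult, (Rabs_pos_eq (beta t0)) in A by lra.
          fold w w'. set (z := Rabs (w m0 - w' m0)) in *.
          assert (Hz : 0 <= z) by apply Rabs_pos.
          assert (B : (b0 * sg) * z <= 6 * C / INR n).
          { apply Rle_trans with (2 := A). replace (b0 * sg * z) with (b0 * z * sg) by ring.
            apply Rmult_le_compat; try lra; [apply Rmult_le_pos; lra|].
            apply Rmult_le_compat_r; lra. }
          unfold D. apply Rmult_le_reg_l with (b0 * sg); auto. apply Rle_trans with (1 := B).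
          replace (b0 * sg * (36 * C / (b0 * sg) / INR n)) with (36 * C / INR n) by (field; lra).
          unfold Rdiv. apply Rmult_le_compat_r; lra. }
        assert (Offw' : forall k, k <> (2 + j1)%nat -> k <> (2 + j2)%nat -> k <> (2 + j3)%nat -> w k = w' k).
        { intros k K1 K2 K3. destruct (Nat.eq_dec k m0) as [->|K0]; auto.
          unfold w, w', wpar. now rewrite Em. }
        assert (Lin := eqs_lin psi M w w' j1 j2 j3 t0 s0 r0 Sp ltac:(lia) ltac:(lia) ltac:(lia)
           ltac:(lia) ltac:(lia) ltac:(lia) Offw').
        cbv zeta in Lin.
        set (x1 := beta t0 * (w (2 + j1)%nat - w' (2 + j1)%nat)) in *.
        set (x2 := beta t0 * (w (2 + j2)%nat - w' (2 + j2)%nat)) in *.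
        set (x3 := beta t0 * (w (2 + j3)%nat - w' (2 + j3)%nat)) in *.
        destruct (near_id_solve (1 / 6) (psi j1) (psi j2) (psi j3) w t0 s0 r0 x1 x2 x3 (6 * C / INR n))
          as (Q1 & Q2 & Q3).
        -- lra.
        -- apply Near. now apply wpar_small.
        -- rewrite (Lin (eq1)) by auto. apply both; [simpl; auto 6|].
           intros u t s r D0. now apply double_point_eqs in D0.
        -- rewrite (Lin (eq2)) by auto. apply both; [simpl; auto 6|].
           intros u t s r D0. now apply double_point_eqs in D0.
        -- rewrite (Lin (eq3)) by auto. apply both; [simpl; auto 6|].
           intros u t s r D0. now apply double_point_eqs in D0.
        -- assert (fin : forall k, List.In k (m0 :: (2 + j1) :: (2 + j2) :: (2 + j3) :: nil)%nat ->
              Rabs (beta t0 * (w k - w' k)) <= 6 * (6 * C / INR n) -> om k = om' k).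
           { intros k Hk A. apply (wpar_apart e n om om' k W D); auto. fold w w'.
             rewrite Rabs_mult, (Rabs_pos_eq (beta t0)) in A by lra.
             set (z := Rabs (w k - w' k)) in *. assert (Hz : 0 <= z) by apply Rabs_pos.
             assert (B : (b0 * sg) * z <= 36 * C / INR n).
             { apply Rle_trans with (beta t0 * z).
               - apply Rmult_le_compat_r; auto. nra.
               - apply Rle_trans with (1 := A). right. field. lra. }
             unfold D. apply Rmult_le_reg_l with (b0 * sg); auto. apply Rle_trans with (1 := B).
             right. field. lra. }
           intros k Hk. simpl in Hk. destruct Hk as [<-|[<-|[<-|[<-|[]]]]]; auto;
             apply fin; auto; simpl; auto.
  - exists (wpar e n om). split; [now apply wpar_small|].
    intros t s r Ht Hs Hr Hg DP.
    destruct (in_cell_exists n t) as (a & Ha & Ca); [lra|auto|].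
    destruct (in_cell_exists n s Hs Hn) as (b & Hb & Cb).
    destruct (in_cell_exists n r Hr Hn) as (c & Hc & Cc).
    apply (Good a b c Ha Hb Hc). exists t, s, r. auto 10.
Qed.

(** * Times near 0 and 1, and the choice of the constants *)

Lemma BL_eq0 M e : BL (2 + M) e (fun p => eq0 (om p) (tt p) (ss p) (rr p)).
Proof.
  apply (BL_minus (2 + M) e (fun p => xh (om p) (tt p) (ss p))).
  - exact (BL_xh M e).
  - apply (BL_swap (2 + M) e (xh)). exact (BL_xh M e).
Qed.

(** At time [t1] the curve is the same for all parameters, so the sum [F] of the squares of the four
    equations has there a positive lower bound independent of [w]; the Lipschitz bound in t carries
    it to nearby times. *)
Lemma end_simple psi (M : nat) e1 c h0 t1 : (forall j, sm (fun _ s => psi j s)) -> (forall j, periodic (psi j)) ->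
  0 < e1 <= 1 -> 0 < c -> (forall w t, small e1 w -> c <= det w t) -> 0 < h0 ->
  0 <= t1 <= 1 -> beta t1 = 0 -> simple_at X Y t1 ->
  exists tau, 0 < tau /\ forall w t s r, small e1 w -> Rabs (t - t1) < tau ->
    0 <= s <= 1 -> 0 <= r <= 1 -> guard h0 s r ->
    ~ double_point (xh w t) (yh psi M w t) (xhs w t) s r.
Proof.
  intros Sp pp He Hc Hdet Hh Ht1 Hb Si.
  destruct (BL_eqs M e1 c Hc Hdet (uh psi M) (cont_uh psi M Sp) (BL_uh psi M Sp pp e1))
    as (B1 & B2 & B3).
  set (F := fun p => eq0 (om p) (tt p) (ss p) (rr p) ^ 2 + eq1 (uh psi M) (om p) (tt p) (ss p) (rr p) ^ 2 +
     (eq2 (uh psi M) (om p) (tt p) (ss p) (rr p) ^ 2 + eq3 (uh psi M) (om p) (tt p) (ss p) (rr p) ^ 2)).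
  assert (BF : BL (2 + M) e1 F).
  { assert (B0 := BL_eq0 M e1). unfold F. repeat apply BL_plus; now apply BL_pow. }
  set (g := fun t s r => t = t1 /\ s <= 1 /\ r <= 1 /\ guard h0 s r).
  assert (same : forall w s r, F (Pt w t1 s r) = F (Pt zw t1 s r)).
  { intros w s r. unfold F; cbn [om tt ss rr]. unfold eq0, eq1, eq2, eq3.
    change (yU (uh psi M) w t1) with (yh psi M w t1).
    change (yU (uh psi M) zw t1) with (yh psi M zw t1).
    destruct (unperturbed psi M w t1 (or_intror Hb)) as (-> & -> & ->).
    now destruct (unperturbed psi M zw t1 (or_intror Hb)) as (-> & -> & ->). }
  destruct (BL_min (2 + M) e1 F g) as (m & Hm & Pm); auto; try lra.
  - intros x y z _ N.
    assert (Cs : x <> t1 \/ 1 < y \/ 1 < z \/ z - y < h0 \/ 1 - h0 < z - y).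
    { apply NNPP. intros Q. apply N. unfold g, guard.
      apply not_or_and in Q. destruct Q as [Q1 Q]. apply not_or_and in Q. destruct Q as [Q2 Q].
      apply not_or_and in Q. destruct Q as [Q3 Q]. apply not_or_and in Q. destruct Q as [Q4 Q5].
      apply NNPP in Q1. lra. }
    destruct Cs as [Q|[Q|[Q|[Q|Q]]]].
    + exists (Rabs (x - t1)). split; [apply Rabs_pos_lt; lra|]. intros a b d (A1 & _ & _) (-> & _).
      rewrite Rabs_minus_sym in A1. lra.
    + exists (y - 1). split; [lra|]. intros a b d (_ & A2 & _) (_ & G & _). apply Rabs_lt_between' in A2. lra.
    + exists (z - 1). split; [lra|]. intros a b d (_ & _ & A3) (_ & _ & G & _). apply Rabs_lt_between' in A3. lra.
    + exists ((h0 - (z - y)) / 2). split; [lra|]. intros a b d (_ & A2 & A3) (_ & _ & _ & G).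
      apply Rabs_lt_between' in A2, A3. unfold guard in G. lra.
    + exists (((z - y) - (1 - h0)) / 2). split; [lra|]. intros a b d (_ & A2 & A3) (_ & _ & _ & G).
      apply Rabs_lt_between' in A2, A3. unfold guard in G. lra.
  - intros t s r (_ & Bs & Br) (-> & G1 & G2 & G3). unfold guard in G3.
    change (0 < F (Pt zw t1 s r)).
    destruct (Rle_lt_dec (F (Pt zw t1 s r)) 0) as [Z|]; auto. exfalso.
    apply (Si s r); try lra.
    destruct (unperturbed psi M zw t1 (or_intror Hb)) as (E1 & E2 & E3).
    unfold F in Z; cbn [om tt ss rr] in Z. unfold eq0, eq1, eq2, eq3 in Z.
    change (yU (uh psi M) zw t1) with (yh psi M zw t1) in Z. rewrite E1, E2, E3 in Z.
    set (z0 := X t1 s - X t1 r) in *. set (z1 := Y t1 s - Y t1 r) in *.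
    assert (sq0 : forall a b c d : R, a ^ 2 + b ^ 2 + (c ^ 2 + d ^ 2) <= 0 -> a = 0 /\ b = 0 /\ c = 0 /\ d = 0).
    { clear. intros a b c d H.
      assert (A := pow2_ge_0 a). assert (B := pow2_ge_0 b). assert (C := pow2_ge_0 c). assert (D := pow2_ge_0 d).
      assert (R : forall u, u ^ 2 <= 0 -> u = 0).
      { intros u Hu. apply Rsqr_0_uniq. rewrite Rsqr_pow2. generalize (pow2_ge_0 u). lra. }
      repeat split; apply R; lra. }
    apply sq0 in Z. destruct Z as (Z0 & Z1 & Z2 & Z3). unfold z0 in Z0. unfold z1 in Z1.
    split; [lra|split; [lra|split; [exact Z2|exact Z3]]].
  - destruct BF as (C & HC & _ & L).
    exists (m / (C + 1)). split; [apply Rdiv_lt_0_compat; lra|].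
    intros w t s r Hw Ht Hs Hr Hg DP.
    apply double_point_eqs in DP. destruct DP as (Z0 & Z1 & Z2 & Z3).
    assert (F0 : F (Pt w t s r) = 0) by (unfold F; cbn [om tt ss rr]; rewrite Z0, Z1, Z2, Z3; ring).
    assert (F1 : m <= F (Pt w t1 s r)).
    { rewrite same. apply Pm; [repeat split; lra|].
      split; [auto|split; [lra|split; [lra|exact Hg]]]. }
    assert (A : Rabs (F (Pt w t s r) - F (Pt w t1 s r)) <= C * dd (2 + M) (Pt w t s r) (Pt w t1 s r)).
    { apply L; (split; [auto|simpl; lra]). }
    unfold dd in A; cbn [om tt ss rr] in A. rewrite wd_refl, !Rminus_diag, Rabs_R0, F0 in A.
    apply Rabs_le_between in A.
    assert (C * (0 + Rabs (t - t1) + 0 + 0) <= C * Rabs (t - t1)) by lra.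
    assert ((C + 1) * Rabs (t - t1) < m).
    { apply Rlt_div_r in Ht; lra. }
    generalize (Rabs_pos (t - t1)). lra.
Qed.

Lemma finite_stay psi (M : nat) e1 c eta : (forall j, sm (fun _ s => psi j s)) -> (forall j, periodic (psi j)) ->
  0 < e1 <= 1 -> 0 < c -> (forall w t, small e1 w -> c <= det w t) -> 0 < eta -> forall m,
  exists e0, 0 < e0 <= e1 /\ forall j w t s r q, (j < m)%nat -> small e0 w -> 0 <= s <= 2 -> 0 <= r <= 2 ->
    q = eq1 \/ q = eq2 \/ q = eq3 ->
    Rabs (q (cst (psi j)) w t s r - q (cst (psi j)) zw t s r) <= eta.
Proof.
  intros Sp pp He Hc Hdet Heta. induction m as [|m (e0 & He0 & IH)].
  - exists e1. split; [lra|]. intros; lia.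
  - destruct (BL_eqs M e1 c Hc Hdet (cst (psi m))) as (B1 & B2 & B3).
    { intros w t s. exact (sm_continuous _ (Sp m) 0 s). }
    { apply (BL_sm (2 + M) e1 (fun _ s => psi m s)); auto. split; intros t s; [auto|apply pp]. }
    destruct (BL_stay_near _ e1 _ eta (proj1 He) B1 Heta) as (d1 & Hd1 & L1).
    destruct (BL_stay_near _ e1 _ eta (proj1 He) B2 Heta) as (d2 & Hd2 & L2).
    destruct (BL_stay_near _ e1 _ eta (proj1 He) B3 Heta) as (d3 & Hd3 & L3).
    set (ee := Rmin (Rmin e0 d1) (Rmin d2 d3)).
    assert (A1 : ee <= e0) by (unfold ee; rmin).
    assert (A2 : ee <= d1) by (unfold ee; rmin).
    assert (A3 : ee <= d2) by (unfold ee; rmin).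
    assert (A4 : ee <= d3) by (unfold ee; rmin).
    exists ee. split; [split; [unfold ee; repeat apply Rmin_pos|]; lra|].
    assert (sl : forall e' w, ee <= e' -> small ee w -> small e' w).
    { intros e' w L S k. specialize (S k). lra. }
    intros j w t s r q Hj Hw Hs Hr Hq. destruct (Nat.eq_dec j m) as [->|N].
    + destruct Hq as [-> |[-> | ->]].
      * apply (L1 (Pt w t s r)). split; [now apply (sl d1)|simpl; auto].
      * apply (L2 (Pt w t s r)). split; [now apply (sl d2)|simpl; auto].
      * apply (L3 (Pt w t s r)). split; [now apply (sl d3)|simpl; auto].
    + apply IH; auto. lia.
Qed.

(** Pairs close to each other on the circle are excluded by [near_diag], times near the ends by
    [end_simple], and everything else by the parameter that [counting_step] provides. *)
Lemma general_position : simple_at X Y 0 -> simple_at X Y 1 ->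
  exists X' Y', sm X' /\ sm Y' /\ dper X' /\ dper Y' /\ closed_family X' Y' /\
    (forall t s, Ds X' t s <> 0 \/ Ds Y' t s <> 0) /\
    (forall t s u, 0 <= t <= 1 -> 0 <= s < u -> u < 1 -> ~ double_point (X' t) (Y' t) (Ds X' t) s u) /\
    X' 0 = X 0 /\ Y' 0 = Y 0 /\ X' 1 = X 1 /\ Y' 1 = Y 1.
Proof.
  intros S0 S1.
  destruct (immersion_gap) as (kap & h0 & Hk & Hh & Gap).
  (* A placeholder for [psi]: the determinant involves only x, and its bound is needed before the
     functions moving y can be chosen. *)
  destruct (det_bound (fun _ _ => 0) 0) as (e1 & c & He1 & Hc & Hdet).
  destruct (finite_duals e1 c h0 He1 Hc Hdet (proj1 Hh)) as (d & psi & N & Hd & HN & Sp & pp & Cov).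
  set (M := (3 * N)%nat).
  destruct (near_diag psi M e1 c kap h0 Sp pp He1 Hc Hdet Hk Gap) as (e2 & He2 & Diag).
  destruct (end_simple psi M e1 c h0 0 Sp pp He1 Hc Hdet (proj1 Hh) ltac:(lra) beta_0 S0) as (t0 & Ht0 & End0).
  destruct (end_simple psi M e1 c h0 1 Sp pp He1 Hc Hdet (proj1 Hh) ltac:(lra) beta_1 S1) as (t1 & Ht1 & End1).
  destruct (BL_eqs M e1 c Hc Hdet (uh psi M) (cont_uh psi M Sp) (BL_uh psi M Sp pp e1))
    as (B1 & B2 & B3).
  assert (Bq : BL (2 + M) e1 (fun p => eq1 (uh psi M) (om p) (tt p) (ss p) (rr p) ^ 2))
    by now apply BL_pow.
  destruct (BL_stay_pos _ e1 _ d (proj1 He1) Bq Hd) as (e3 & He3 & Far).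
  destruct (finite_stay psi M e1 c (1 / 12) Sp pp He1 Hc Hdet ltac:(lra) M) as (e4 & He4 & Near).
  set (e := Rmin e2 (Rmin e3 e4)).
  assert (A2 : e <= e2) by apply Rmin_l.
  assert (A3 : e <= e3) by (unfold e; rmin).
  assert (A4 : e <= e4) by (unfold e; rmin).
  assert (He : 0 < e) by (unfold e; repeat apply Rmin_pos; lra).
  assert (sl : forall e' w, e <= e' -> small e w -> small e' w).
  { intros e' w L S k. specialize (S k). lra. }
  assert (le : e <= e1) by lra.
  destruct (lip_common (2 + M) e (equations psi M)) as (C & HC & HL).
  { intros F HF. apply BL_le with e1; auto. simpl in HF.
    destruct HF as [<-|[<-|[<-|[<-|[<-|[]]]]]]; auto. apply BL_eq0. }
  set (tau := Rmin (1 / 2) (Rmin (t0 / 2) (t1 / 2))).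
  assert (T0 : 0 < tau) by (unfold tau; repeat apply Rmin_pos; lra).
  assert (T1 : tau <= 1 / 2) by apply Rmin_l.
  assert (T2 : tau <= t0 / 2) by (unfold tau; rmin).
  assert (T3 : tau <= t1 / 2) by (unfold tau; rmin).
  destruct (counting_step psi N e C (d / 2) h0 tau Sp HN He) as (w & Hw & Mid);
    auto; try lra.
  - intros t s r Hb Hg. destruct (Cov t s r Hb Hg) as (i & Hi & P).
    assert (Hs : 0 <= s <= 2) by (destruct Hb as (_ & ? & _); lra).
    assert (Hr : 0 <= r <= 2) by (destruct Hb as (_ & _ & ?); lra).
    exists i. split; auto. destruct P as [P|P]; [left|right]; intros w Hw.
    + apply (Far (Pt w t s r)).
      * split; [now apply (sl e3)|simpl; auto].
      * unfold base; cbn [om tt ss rr]. change (fun _ : nat => 0) with zw.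
        unfold eq1. change (yU (uh psi M) zw t) with (yh psi M zw t).
        destruct (unperturbed psi M zw t (or_introl eq_refl)) as (_ & _ & ->). exact P.
    + assert (near : forall j q, (j < M)%nat -> q = eq1 \/ q = eq2 \/ q = eq3 -> forall v,
        Rabs (q (cst (psi j)) zw t s r - v) <= 1 / 12 -> Rabs (q (cst (psi j)) w t s r - v) <= 1 / 6).
      { intros j q Hj Hq v H.
        assert (A := Near j w t s r q Hj (sl e4 w A4 Hw) Hs Hr Hq).
        replace (q (cst (psi j)) w t s r - v) with
          ((q (cst (psi j)) w t s r - q (cst (psi j)) zw t s r) + (q (cst (psi j)) zw t s r - v)) by ring.
        triang. lra. }
      assert (near0 : forall j q, (j < M)%nat -> q = eq1 \/ q = eq2 \/ q = eq3 ->
        Rabs (q (cst (psi j)) zw t s r) <= 1 / 12 -> Rabs (q (cst (psi j)) w t s r) <= 1 / 6).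
      { intros j q Hj Hq H. rewrite <- (Rminus_0_r (q (cst (psi j)) w t s r)). apply near; auto.
        now rewrite Rminus_0_r. }
      assert (M1 : (3 * i < M)%nat) by (unfold M; lia). assert (M2 : (3 * i + 1 < M)%nat) by (unfold M; lia).
      assert (M3 : (3 * i + 2 < M)%nat) by (unfold M; lia).
      destruct P as ((P11 & P12 & P13) & (P21 & P22 & P23) & (P31 & P32 & P33)).
      split; [|split]; (split; [|split]); first [apply near|apply near0]; auto.
  - assert (Hw1 : small e1 w) by now apply (sl e1).
    assert (Hw2 : small e2 w) by now apply (sl e2).
    assert (ND : forall t, det w t <> 0) by (intros t; specialize (Hdet w t Hw1); lra).
    assert (DX := Ds_xh w).
    assert (qX := dper_xh w). assert (qY := dper_yh psi M pp w).
    assert (Dy := is_derive_yh psi M Sp w). assert (Dx := is_derive_xh w).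
    assert (DY : forall t s, Ds (yh psi M w) t s = yhs psi M w t s)
      by (intros; now apply is_derive_unique).
    exists (xh w), (yh psi M w).
    split; [exact (sm_xh w)|]. split; [now apply sm_yh|]. split; [auto|]. split; [auto|].
    split; [now apply closed_yh|]. split; [|split].
    + intros t s. destruct (period_reduce 1 s Rlt_0_1) as [k Hk'].
      destruct (dper_Ds _ qX) as [_ q1]. destruct (dper_Ds _ qY) as [_ q2].
      rewrite <- (shift_Z 1 (Ds (xh w) t) k s), <- (shift_Z 1 (Ds (yh psi M w) t) k s) by auto.
      rewrite DX, DY. apply Diag; auto; try lra. rewrite Rminus_diag, Rabs_R0. lra.
    (* On a short arc with equal end values, the mean value theorem gives nearby zeros of x' and of
       y', against [Diag]. *)
    + intros t s u Ht Hs Hu. rewrite DX.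
      assert (short : forall a b, 0 <= a < b -> b <= 2 -> b - a < h0 -> xh w t a = xh w t b ->
         yh psi M w t a = yh psi M w t b -> False).
      { intros a b Ha Hb Hab Ex Ey.
        destruct (MVT_cor2 (xh w t) (xhs w t) a b) as (p & E1 & Hp); [lra| |].
        { intros v _. apply is_derive_Reals, Dx. }
        destruct (MVT_cor2 (yh psi M w t) (yhs psi M w t) a b) as (q & E2 & Hq); [lra| |].
        { intros v _. apply is_derive_Reals, Dy. }
        destruct (Diag w t p q Hw2) as [Z|Z]; try lra.
        - apply Rabs_le. lra.
        - apply Z. apply Rmult_eq_reg_r with (b - a); lra.
        - apply Z. apply Rmult_eq_reg_r with (b - a); lra. }
      intros DP. assert (DP' := DP). destruct DP' as (D1 & D2 & _).
      destruct (Rlt_le_dec (u - s) h0) as [L|L].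
      { apply (short s u); auto; lra. }
      (* An arc longer than 1 - h0 has a short complement, from u to s + 1. *)
      destruct (Rlt_le_dec (1 - h0) (u - s)) as [L'|L'].
      { apply (short u (s + 1)); try lra.
        - destruct qX as [_ q]. rewrite q. auto.
        - destruct qY as [_ q]. rewrite q. auto. }
      assert (Hg : guard h0 s u) by (unfold guard; lra).
      destruct (Rlt_le_dec t tau) as [Q|Q].
      { apply (End0 w t s u); auto; try lra. rewrite Rminus_0_r, Rabs_pos_eq; lra. }
      destruct (Rlt_le_dec (1 - tau) t) as [Q'|Q'].
      { apply (End1 w t s u); auto; try lra. rewrite Rabs_left1; lra. }
      apply (Mid t s u); auto; lra.
    + destruct (unperturbed psi M w 0 (or_intror beta_0)) as (-> & _ & ->).
      destruct (unperturbed psi M w 1 (or_intror beta_1)) as (-> & _ & ->). auto.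
Qed.
End Family.

Theorem mainTheorem1 (g0 g1 : R -> R4)
    (h0 : horizontal_loop g0) (h1 : horizontal_loop g1) :
  horizontally_isotopic g0 g1 <-> rot g0 = rot g1.
Proof.
  split; [apply isotopic_rot|]. intros E.
  destruct (whitney_graustein g0 g1 h0 h1 E) as (X & U & FU & X0 & U0 & X1 & U1).
  destruct (family_corr X U FU) as [FAM CL].
  set (Y := fcorr X U) in *.
  assert (Y0 : forall s, Y 0 s = cy (g0 s)).
  { intros s. rewrite <- U0. unfold Y, fcorr. destruct (closed_end g0 X U 0 h0 X0 U0). now apply corr_id. }
  assert (Y1 : forall s, Y 1 s = cy (g1 s)).
  { intros s. rewrite <- U1. unfold Y, fcorr. destruct (closed_end g1 X U 1 h1 X1 U1). now apply corr_id. }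
  destruct (general_position X Y FAM CL (loop_simple g0 X Y 0 h0 X0 Y0) (loop_simple g1 X Y 1 h1 X1 Y1))
    as (X' & Y' & SX & SY & pX & pY & CL' & Im & Si & E0 & F0 & E1 & F1).
  apply (lift_isotopy g0 g1 X' Y'); auto; intros s.
  - now rewrite E0.
  - now rewrite F0.
  - now rewrite E1.
  - now rewrite F1.
Qed.
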